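(* Let $n\geq2$ and let $\tilde X^{6n-4}$ be the complex nilmanifold of complex dimension $6n-4$ constructed by Kasuya and Stelzig, defined by a $(1,0)$-coframe $\{\tau^1,\dots,\tau^{4n-2},\theta^1,\dots,\theta^{n-1},\eta^1,\dots,\eta^{n-1}\}$ with structure equations $$d\tau^1=\cdots=d\tau^{3n-2}=0,$$ $$d\tau^{3n-2+j}=\tau^j\wedge\tau^{n+j}+\tau^{n-1+j}\wedge\overline{\tau^{2n-1+j}}\quad(1\leq j\leq n-1),$$ $$d\tau^{4n-2}=\tau^{2n}\wedge\overline{\tau^n},$$ $$d\theta^j=\tau^{j+n-1}\wedge\overline{\tau^{j+n-1}}+\tau^{j+2n-1}\wedge\overline{\tau^{j+2n-1}}\quad(1\leq j\leq n-1),$$ $$d\eta^j=\tau^j\wedge\overline{\tau^j}+\tau^{j+n}\wedge\overline{\tau^{j+n}}\quad(1\leq j\leq n-1).$$ Then $\tilde X^{6n-4}$ does not admit strongly Gauduchon metrics, and it does not admit astheno-Kähler metrics.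
   Context: A complex nilmanifold $X=(M,J)$ is a nilmanifold $M=\Gamma\backslash G$ (compact quotient of a connected, simply connected real nilpotent Lie group $G$ by a lattice $\Gamma$) endowed with an invariant complex structure $J$, i.e. one induced by an integrable complex structure on the Lie algebra $\mathfrak g$ of $G$; structure equations are for a basis of invariant $(1,0)$-forms. Hermitian metrics are identified with their fundamental forms $F$ and need not be invariant. On a complex manifold of complex dimension $N$, $F$ is astheno-Kähler if $\partial\bar\partial F^{N-2}=0$, and strongly Gauduchon if there exists an $(N,N-2)$-form $\gamma$ with $\partial F^{N-1}=\bar\partial\gamma$. *)

(* Defs.v *)
From mathcomp Require Import all_boot all_order all_algebra.
From mathcomp Require Import all_classical all_reals all_analysis.
From mathcomp Require Import complex.

Set Implicit Arguments.
Unset Strict Implicit.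
Unset Printing Implicit Defensive.

Import Order.TTheory GRing.Theory Num.Theory.
Import numFieldNormedType.Exports.

Local Open Scope classical_set_scope.
Local Open Scope ring_scope.
Local Open Scope complex_scope.

(** * Smooth functions on R^m

    Points and tangent vectors of R^m are row vectors. *)

Section Smooth.
Variables (R : realType) (m : nat).
Implicit Types f : 'rV[R]_m -> R.

Definition pderiv (f : 'rV[R]_m -> R) (i : 'I_m) (x : 'rV[R]_m) : R :=
  'D_(delta_mx 0 i) f x.

Fixpoint Ck (k : nat) (f : 'rV[R]_m -> R) : Prop :=
  if k is k'.+1 then
    continuous f /\
    forall i : 'I_m, (forall x, derivable f x (delta_mx 0 i)) /\ Ck k' (pderiv f i)
  else continuous f.

Definition smooth (f : 'rV[R]_m -> R) : Prop := forall k, Ck k f.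

Definition csmooth (f : 'rV[R]_m -> R[i]) : Prop :=
  smooth (fun x => complex.Re (f x)) /\ smooth (fun x => complex.Im (f x)).

Definition cpderiv (f : 'rV[R]_m -> R[i]) (i : 'I_m) (x : 'rV[R]_m) : R[i] :=
  pderiv (fun y => complex.Re (f y)) i x +i* pderiv (fun y => complex.Im (f y)) i x.

(** Jacobian acting on row vectors: the differential of [phi] at [x] is
    [v |-> v *m jac phi x]. *)
Definition jac (phi : 'rV[R]_m -> 'rV[R]_m) (x : 'rV[R]_m) : 'M[R]_m :=
  \matrix_(i, j) pderiv (fun y => phi y 0 j) i x.

End Smooth.

(** * Complex-valued differential forms on R^m

    An element [a] of the exterior algebra is the family of its coefficients:
    [a = \sum_I a I *: dx_I], where [dx_I] is the wedge product of the [dx_i],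
    [i] in [I], taken in increasing order. *)

Section Forms.
Variables (R : realType) (m : nat).

Definition ext : Type := {ffun {set 'I_m} -> R[i]}.

Definition ext1 : ext := [ffun I => (I == finset.set0)%:R].
Definition dx (i : 'I_m) : ext := [ffun I => (I == [set i]%SET)%:R].

Definition inversions (I J : {set 'I_m}) : nat :=
  #|[set p : 'I_m * 'I_m | [&& p.1 \in I, p.2 \in J & (p.2 < p.1)%N]]%SET|.

Definition wedge (a b : ext) : ext :=
  [ffun K => \sum_(I in powerset K)
     (-1) ^+ inversions I (K :\: I) * a I * b (K :\: I)].

Definition wedges (s : seq ext) : ext := foldr wedge ext1 s.

Definition ext_conj (a : ext) : ext := [ffun I => (a I)^*].

(** Value of the degree 2 component of [a] on two real vectors. *)
Definition eval2 (a : ext) (v w : 'rV[R]_m) : R[i] :=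
  \sum_(i < m) \sum_(j < m | (i < j)%N)
    a [set i; j]%SET * (v 0 i * w 0 j - v 0 j * w 0 i)%:C.

Definition diff_form : Type := 'rV[R]_m -> ext.

Definition smooth_form (a : diff_form) : Prop :=
  forall I, csmooth (fun x => a x I).

Definition fwedge (a b : diff_form) : diff_form := fun x => wedge (a x) (b x).
Definition fadd (a b : diff_form) : diff_form := fun x => a x + b x.
Definition fconj (a : diff_form) : diff_form := fun x => ext_conj (a x).
Definition fpow (a : diff_form) (k : nat) : diff_form :=
  fun x => iter k (wedge (a x)) ext1.
Definition fzero : diff_form := fun=> 0.

Definition ext_d (a : diff_form) : diff_form := fun x =>
  \sum_(i < m) wedge (dx i) [ffun I => cpderiv (fun y => a y I) i x].

Definition pullback (phi : 'rV[R]_m -> 'rV[R]_m) (a : diff_form) : diff_form :=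
  fun x => \sum_(I : {set 'I_m}) a (phi x) I *:
    wedges [seq \sum_(j < m) (jac phi x j i)%:C *: dx j | i <- enum I].

(** ** Bidegrees

    [J] is a complex structure on the tangent space, acting on row vectors by
    [v |-> v *m J].  [dx10 J i] and [dx01 J i] are the (1,0) and (0,1) parts
    [(dx_i -+ 'i * (dx_i \o J)) / 2] of [dx_i].
    (The imaginary unit is spelled [0 +i* 1]: here the notation ['i] would
    denote an abstractly chosen square root of -1.)  Expanding each factor of
    [dx_I] as [dx10 J i + dx01 J i] gives the bidegree (p,q) part. *)

Definition dx10 (J : 'M[R]_m) (i : 'I_m) : ext :=
  2^-1 *: (dx i - (0 +i* 1) *: \sum_(j < m) (J j i)%:C *: dx j).
Definition dx01 (J : 'M[R]_m) (i : 'I_m) : ext :=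
  2^-1 *: (dx i + (0 +i* 1) *: \sum_(j < m) (J j i)%:C *: dx j).

Definition pq_part (J : 'M[R]_m) (p q : nat) (a : ext) : ext :=
  \sum_(I : {set 'I_m}) a I *:
    \sum_(A in powerset I | (#|A| == p) && (#|I :\: A| == q))
      wedges [seq if i \in A then dx10 J i else dx01 J i | i <- enum I].

End Forms.

Arguments fzero {R m}.

(** * Lie groups, lattices, complex nilmanifolds

    A connected, simply connected nilpotent Lie group is diffeomorphic to its
    Lie algebra through the exponential map, so such groups are taken to be
    smooth group structures on R^m. *)

Record lie_group (R : realType) (m : nat) := LieGroup {
  gmul : 'rV[R]_m -> 'rV[R]_m -> 'rV[R]_m;
  gone : 'rV[R]_m;
  ginv : 'rV[R]_m -> 'rV[R]_m;
  gmulA : associative gmul;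
  gmul1 : left_id gone gmul;
  gmulV : left_inverse gone ginv gmul;
  gmul_smooth : forall k : 'I_m,
    smooth (fun z : 'rV[R]_(m + m) => gmul (lsubmx z) (rsubmx z) 0 k);
  ginv_smooth : forall k : 'I_m, smooth (fun x => ginv x 0 k)
}.

Section LieGroups.
Variables (R : realType) (m : nat) (G : lie_group R m).

Definition is_subgroup (H : set 'rV[R]_m) : Prop :=
  [/\ H (gone G), forall x y, H x -> H y -> H (gmul G x y)
    & forall x, H x -> H (ginv G x)].

Definition generated (A : set 'rV[R]_m) : set 'rV[R]_m :=
  [set z | forall H, is_subgroup H -> A `<=` H -> H z].

Definition commutator (x y : 'rV[R]_m) : 'rV[R]_m :=
  gmul G (gmul G (ginv G x) (ginv G y)) (gmul G x y).

Fixpoint lower_central (k : nat) : set 'rV[R]_m :=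
  if k is k'.+1 then
    generated [set z | exists x y, lower_central k' x /\ z = commutator x y]
  else setT.

Definition nilpotent_group : Prop := exists k, lower_central k = [set gone G].

(** [Gamma] is discrete and [Gamma \ G] is compact. *)
Definition lattice (Gamma : set 'rV[R]_m) : Prop :=
  [/\ is_subgroup Gamma,
      \forall x \near gone G, Gamma x -> x = gone G
    & exists2 K : set 'rV[R]_m, compact K &
        forall x, exists g k, [/\ Gamma g, K k & x = gmul G g k]].

Definition invariant_under (A : set 'rV[R]_m) (a : diff_form R m) : Prop :=
  forall g, A g -> forall x, pullback (gmul G g) a x = a x.

End LieGroups.

Section ComplexStructures.
Variables (R : realType) (m : nat).
Implicit Types J : 'rV[R]_m -> 'M[R]_m.

Definition smooth_vf (X : 'rV[R]_m -> 'rV[R]_m) : Prop :=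
  forall k : 'I_m, smooth (fun x => X x 0 k).

Definition lie_bracket (X Y : 'rV[R]_m -> 'rV[R]_m) : 'rV[R]_m -> 'rV[R]_m :=
  fun x => X x *m jac Y x - Y x *m jac X x.

(** Vanishing of the Nijenhuis tensor. *)
Definition integrable_structure J : Prop :=
  forall X Y, smooth_vf X -> smooth_vf Y ->
  let JX := fun x => X x *m J x in let JY := fun x => Y x *m J x in
  forall x, lie_bracket X Y x + lie_bracket JX Y x *m J x
            + lie_bracket X JY x *m J x - lie_bracket JX JY x = 0.

End ComplexStructures.

(** The nilmanifold [Gamma \ G] of complex dimension [N], with the complex
    structure induced by the left-invariant structure [cn_J] on [G]. *)
Record complex_nilmanifold (R : realType) (N : nat) := ComplexNilmanifold {
  cn_group : lie_group R N.*2;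
  cn_lattice : set 'rV[R]_(N.*2);
  cn_J : 'rV[R]_(N.*2) -> 'M[R]_(N.*2);
  cn_nilpotent : nilpotent_group cn_group;
  cn_latticeP : lattice cn_group cn_lattice;
  cn_J_smooth : forall i j, smooth (fun x => cn_J x i j);
  cn_J_sqr : forall x, cn_J x *m cn_J x = - 1%:M;
  cn_J_invariant : forall g x,
    cn_J x *m jac (gmul cn_group g) x
      = jac (gmul cn_group g) x *m cn_J (gmul cn_group g x);
  cn_J_integrable : integrable_structure cn_J
}.

Section ComplexNilmanifolds.
Variables (R : realType) (N : nat) (X : complex_nilmanifold R N).
Local Notation formX := (diff_form R N.*2).

(** Smooth forms on [Gamma \ G], identified with the [Gamma]-invariant smooth
    forms on [G]. *)
Definition form_on (a : formX) : Prop :=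
  smooth_form a /\ invariant_under (cn_group X) (cn_lattice X) a.

Definition left_invariant_form (a : formX) : Prop :=
  smooth_form a /\ invariant_under (cn_group X) setT a.

Definition fpq_part (p q : nat) (a : formX) : formX :=
  fun x => pq_part (cn_J X x) p q (a x).

Definition has_type (p q : nat) (a : formX) : Prop :=
  forall x, fpq_part p q a x = a x.

Definition del (a : formX) : formX := fun x =>
  \sum_(p < N.+1) \sum_(q < N.+1) fpq_part p.+1 q (ext_d (fpq_part p q a)) x.

Definition delbar (a : formX) : formX := fun x =>
  \sum_(p < N.+1) \sum_(q < N.+1) fpq_part p q.+1 (ext_d (fpq_part p q a)) x.

(** Fundamental forms of Hermitian metrics on [X], with the sign convention
    [F(v, Jv) > 0]; in particular [F] need not be left-invariant.  In [R[i]],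
    [0 < z] means that [z] is real and positive. *)
Definition hermitian_metric (F : formX) : Prop :=
  [/\ form_on F, has_type 1 1 F, forall x, fconj F x = F x
    & forall x (v : 'rV[R]_(N.*2)), v != 0 -> 0 < eval2 (F x) v (v *m cn_J X x)].

Definition strongly_Gauduchon (F : formX) : Prop :=
  exists gamma : formX,
    [/\ form_on gamma, has_type N (N - 2) gamma
      & forall x, del (fpow F (N - 1)) x = delbar gamma x].

Definition astheno_Kahler (F : formX) : Prop :=
  forall x, del (delbar (fpow F (N - 2))) x = 0.

(** A basis of left-invariant (1,0)-forms: at each point they form a basis of
    the (1,0)-covectors.  Covectors are the elements of degree 1, and the
    bidegree (1,0) part is in degree 1. *)
Definition coframe10 (s : seq formX) : Prop :=
  [/\ size s = N,
      forall k, (k < N)%N ->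
        left_invariant_form (nth fzero s k) /\ has_type 1 0 (nth fzero s k)
    & forall x (a : ext R N.*2), pq_part (cn_J X x) 1 0 a = a ->
        exists! c : 'rV[R[i]]_N, a = \sum_(k < N) c 0 k *: nth fzero s k x].

End ComplexNilmanifolds.

(* Main.v *)
Require Import Defs.
From HB Require Import structures.
From mathcomp Require Import all_boot all_order all_algebra.
From mathcomp Require Import all_classical all_reals all_analysis.
From mathcomp Require Import complex.
From mathcomp Require Import zify ring lra.
From mathcomp Require Import fintype finset.

Set Implicit Arguments.
Unset Strict Implicit.
Unset Printing Implicit Defensive.

Import Order.TTheory GRing.Theory Num.Theory.
Import numFieldNormedType.Exports.

Local Open Scope ring_scope.
Local Open Scope complex_scope.

(** Let [N] be the complex dimension and [omega = d eta^1], a closed (1,1)-form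
    equal to the sum of [tau /\ conj tau] over two basis forms.

    If [del F^(N-1) = delbar gamma], comparing bidegrees gives
    [F^(N-1) /\ omega = d ((gamma - F^(N-1)) /\ conj eta^1)].  If
    [del delbar H = 0] with [H = F^(N-2)], it gives [H /\ omega /\ omega =
    d (H /\ eta^1 /\ omega - delbar H /\ conj eta^1 /\ eta^1)].  Up to a constant
    the left-hand sides are positive multiples of an invariant volume form,
    because [F] is positive and [omega] is semipositive of rank two, so both
    identities contradict Stokes' theorem on [Gamma \ G].

    Instead of integrating over [Gamma \ G], one uses amenability.  In a
    left-invariant coframe an exact top-degree form is the divergence of
    [Gamma]-invariant functions with respect to left-invariant fields: the other
    terms vanish because the structure equations are homogeneous for positive
    weights.  A divergence that is positive everywhere is bounded below by
    compactness of [Gamma \ G], and so is the sum of the corresponding difference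
    quotients [(V (x exp(t Y)) - V x) / t] for small [t].  But a nilpotent group
    carries finitely supported probability measures that are almost invariant
    under translation (Reiter's condition), and averaging such differences of
    bounded functions over them gives arbitrarily small values. *)

(** * The exterior algebra *)

Section ExteriorAlgebra.
Variables (R : realType) (m : nat).
Local Notation C := R[i].
Local Notation E := (ext R m).
Implicit Types (I J K : {set 'I_m}) (a b c : E) (i j : 'I_m).

(** The two primitives come from integration by parts. As [omega = d eta^1] has type (1,1),
    [del (conj eta^1) = - omega] and [delbar (conj eta^1) = 0], so [omega] is the differential of
    [- conj eta^1] and [omega /\ omega = - del delbar (eta^1 /\ conj eta^1)]. An exact semipositive
    (1,1)-form is the usual current-type obstruction to strongly Gauduchon metrics; its square plays
    the same part for astheno-Kähler ones. The obstacle is that forms, [d] and bidegrees are given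
    in the coordinates of R^m, where [J] varies with the point. In the left-invariant coframe
    [e_k, conj e_k] a bidegree becomes a count of indices and an invariant form a constant. Bidegree
    parts are carried over by their generating function: [\sum t^p s^q a^(p,q)] is the image of [a]
    under the substitution that scales (1,0)-covectors by [t] and (0,1)-covectors by [s], hence does
    not depend on the basis. The weights are 1 on the closed [tau] and 2 on the other forms. Since
    [d] preserves them, an invariant form of codegree one has no room for a differential in top
    degree: this is the unimodularity that Stokes' theorem rests on. *)

Definition ext_basis I : E := [ffun K => (K == I)%:R].

Lemma ext_scaleE (z : C) a I : (z *: a) I = z * a I.
Proof. by rewrite ffunE. Qed.

Lemma ext_sum_basis a : a = \sum_I a I *: ext_basis I.
Proof.
apply/ffunP => K; rewrite sum_ffunE (bigD1 K) //= ext_scaleE ffunE eqxx mulr1.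
rewrite big1 ?addr0 // => I neIK.
by rewrite ext_scaleE ffunE eq_sym (negPf neIK) mulr0.
Qed.

Lemma wedgeDl : left_distributive (@wedge R m) +%R.
Proof.
move=> a b c; apply/ffunP => K; rewrite !ffunE -big_split /=.
by apply: eq_bigr => I _; rewrite ffunE mulrDr mulrDl.
Qed.

Lemma wedgeDr : right_distributive (@wedge R m) +%R.
Proof.
move=> a b c; apply/ffunP => K; rewrite !ffunE -big_split /=.
by apply: eq_bigr => I _; rewrite ffunE mulrDr.
Qed.

Lemma wedgeZl (z : C) a b : wedge (z *: a) b = z *: wedge a b.
Proof.
apply/ffunP => K; rewrite ext_scaleE !ffunE mulr_sumr.
by apply: eq_bigr => I _; rewrite ext_scaleE !mulrA [z * _]mulrC.
Qed.

Lemma wedgeZr (z : C) a b : wedge a (z *: b) = z *: wedge a b.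
Proof.
apply/ffunP => K; rewrite ext_scaleE !ffunE mulr_sumr.
by apply: eq_bigr => I _; rewrite ext_scaleE mulrCA.
Qed.

Lemma wedge0l a : wedge 0 a = 0.
Proof. by rewrite -[X in wedge X](scale0r (0 : E)) wedgeZl scale0r. Qed.

Lemma wedge0r a : wedge a 0 = 0.
Proof. by rewrite -[X in wedge _ X](scale0r (0 : E)) wedgeZr scale0r. Qed.

Lemma wedge_suml (T : Type) (r : seq T) (P : pred T) (f : T -> E) a :
  wedge (\sum_(t <- r | P t) f t) a = \sum_(t <- r | P t) wedge (f t) a.
Proof.
apply: (big_morph (fun b => wedge b a)); last exact: wedge0l.
by move=> ? ?; rewrite wedgeDl.
Qed.

Lemma wedge_sumr (T : Type) (r : seq T) (P : pred T) (f : T -> E) a :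
  wedge a (\sum_(t <- r | P t) f t) = \sum_(t <- r | P t) wedge a (f t).
Proof.
apply: (big_morph (wedge a)); last exact: wedge0r.
by move=> ? ?; rewrite wedgeDr.
Qed.

Lemma wedge_basis I J :
  wedge (ext_basis I) (ext_basis J) =
  (if [disjoint I & J] then (-1) ^+ inversions I J else 0)
    *: ext_basis (I :|: J).
Proof.
apply/ffunP => K; rewrite ext_scaleE !ffunE.
have [dIJ|ndIJ] := boolP [disjoint I & J]; last first.
  rewrite mul0r big1 // => L LK; rewrite !ffunE.
  case: (L =P I) => [->|_]; last by rewrite mulr0 mul0r.
  case: eqP => [defJ|_]; last by rewrite mulr0.
  case/negP: ndIJ; rewrite -defJ -setI_eq0; apply/eqP/setP => x.
  by rewrite !inE andbA andbN.
case: (K =P _) => [->|neK].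
  rewrite (bigD1 I) /=; last by rewrite powersetE subsetUl.
  rewrite !ffunE eqxx.
  have -> : (I :|: J) :\: I = J.
    by rewrite setDUl setDv set0U; apply/setDidPl; rewrite disjoint_sym.
  rewrite eqxx big1 ?addr0 ?mulr1 // => L /andP[_ neL].
  by rewrite ffunE (negPf neL) mulr0 mul0r.
rewrite mulr0 big1 // => L; rewrite powersetE => LK; rewrite !ffunE.
case: (L =P I) => [eLI|_]; last by rewrite mulr0 mul0r.
case: eqP => [defJ|_]; last by rewrite mulr0.
case: neK; rewrite -defJ -eLI; apply/setP => x; rewrite !inE.
by have [/(subsetP LK)->|] := boolP (x \in L).
Qed.

Lemma inversionsUl I J K : [disjoint I & J] ->
  inversions (I :|: J) K = (inversions I K + inversions J K)%N.
Proof.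
move=> dIJ; rewrite /inversions -cardsUI.
set A := [set p | _]%SET; set B := [set p | _]%SET; set D := [set p | _]%SET.
have -> : B :&: D = set0.
  apply/setP => -[x y]; rewrite !inE /=; apply/negP.
  case/andP => /andP[xI _] /andP[xJ _].
  by have := disjointFr dIJ xI; rewrite xJ.
rewrite cards0 addn0; apply: eq_card => -[x y]; rewrite !inE /=.
by rewrite andb_orl.
Qed.

Lemma inversionsUr I J K : [disjoint J & K] ->
  inversions I (J :|: K) = (inversions I J + inversions I K)%N.
Proof.
move=> dJK; rewrite /inversions -cardsUI.
set A := [set p | _]%SET; set B := [set p | _]%SET; set D := [set p | _]%SET.
have -> : B :&: D = set0.
  apply/setP => -[x y]; rewrite !inE /=; apply/negP.
  case/andP => /and3P[_ yJ _] /and3P[_ yK _].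
  by have := disjointFr dJK yJ; rewrite yK.
rewrite cards0 addn0; apply: eq_card => -[x y]; rewrite !inE /=.
by case: (x \in I) => //=; rewrite andb_orl.
Qed.

(** Both bracketings vanish unless [I], [J], [K] are pairwise disjoint, and then both signs count
    the inversions of the same three pairs of sets. *)
Lemma wedge_basisA I J K :
  wedge (ext_basis I) (wedge (ext_basis J) (ext_basis K)) =
  wedge (wedge (ext_basis I) (ext_basis J)) (ext_basis K).
Proof.
rewrite !wedge_basis wedgeZl wedgeZr !wedge_basis !scalerA setUA.
congr (_ *: _).
have disjUl : [disjoint I :|: J & K] = [disjoint I & K] && [disjoint J & K].
  by rewrite -!setI_eq0 setIUl setU_eq0.
have disjUr : [disjoint I & J :|: K] = [disjoint I & J] && [disjoint I & K].
  by rewrite -!setI_eq0 setIUr setU_eq0.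
rewrite disjUl disjUr.
case: (boolP [disjoint J & K]) => dJK; last by rewrite andbF mul0r mulr0.
case: (boolP [disjoint I & J]) => dIJ; last by rewrite mul0r mulr0.
case: (boolP [disjoint I & K]) => dIK; last by rewrite !mulr0.
by rewrite /= inversionsUl // inversionsUr // -!exprD; congr (_ ^+ _); lia.
Qed.

Lemma wedgeA : associative (@wedge R m).
Proof.
move=> a b c; rewrite [a]ext_sum_basis [b]ext_sum_basis [c]ext_sum_basis.
rewrite !wedge_suml; apply: eq_bigr => I _.
rewrite wedge_sumr [X in _ = wedge X _]wedge_sumr wedge_suml.
apply: eq_bigr => J _.
rewrite !wedge_sumr; apply: eq_bigr => K _.
have defL (x y z : C) (A B D : E) : wedge (x *: A) (wedge (y *: B) (z *: D)) =
    (x * y * z) *: wedge A (wedge B D).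
  by rewrite !wedgeZl !wedgeZr !scalerA.
have defR (x y z : C) (A B D : E) : wedge (wedge (x *: A) (y *: B)) (z *: D) =
    (x * y * z) *: wedge (wedge A B) D.
  by rewrite !(wedgeZr, wedgeZl) !scalerA; congr (_ *: _); ring.
by rewrite defL defR wedge_basisA.
Qed.

Lemma ext1E : ext1 R m = ext_basis set0.
Proof. by []. Qed.

Lemma wedge1l : left_id (ext1 R m) (@wedge R m).
Proof.
move=> a; rewrite [a]ext_sum_basis wedge_sumr; apply: eq_bigr => I _.
rewrite ext1E wedgeZr wedge_basis set0U -setI_eq0 set0I eqxx.
rewrite /inversions (_ : [set p | _]%SET = set0) ?cards0 ?scale1r //.
by apply/setP => -[x y]; rewrite !inE.
Qed.

Lemma wedge1r : right_id (ext1 R m) (@wedge R m).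
Proof.
move=> a; rewrite [a]ext_sum_basis wedge_suml; apply: eq_bigr => I _.
rewrite ext1E wedgeZl wedge_basis setU0 -setI_eq0 setI0 eqxx.
rewrite /inversions (_ : [set p | _]%SET = set0) ?cards0 ?scale1r //.
by apply/setP => -[x y]; rewrite !inE andbF.
Qed.

Lemma ext1_neq0 : ext1 R m != 0.
Proof.
by apply/eqP => /ffunP /(_ set0) /eqP; rewrite !ffunE eqxx oner_eq0.
Qed.

HB.instance Definition _ :=
  GRing.Lmodule.copy (ext R m) {ffun {set 'I_m} -> R[i]}.
HB.instance Definition _ := GRing.Zmodule_isNzRing.Build (ext R m)
  wedgeA wedge1l wedge1r wedgeDl wedgeDr ext1_neq0.
HB.instance Definition _ := GRing.Lmodule_isLalgebra.Build R[i] (ext R m)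
  (fun z a b => esym (wedgeZl z a b)).
HB.instance Definition _ := GRing.Lalgebra_isAlgebra.Build R[i] (ext R m)
  (fun z a b => esym (wedgeZr z a b)).

Lemma wedgeE a b : wedge a b = a * b. Proof. by []. Qed.

Lemma ext_mulZl (z : C) a b : (z *: a) * b = z *: (a * b).
Proof. exact: wedgeZl. Qed.

Lemma ext_mulZr (z : C) a b : a * (z *: b) = z *: (a * b).
Proof. exact: wedgeZr. Qed.

Lemma wedgesE (s : seq E) : wedges s = \prod_(u <- s) u.
Proof. by elim: s => [|u s IHs]; rewrite ?big_nil //= big_cons -IHs. Qed.

Lemma iter_wedge a k : iter k (wedge a) (ext1 R m) = a ^+ k.
Proof. by elim: k => [|k IHk] //=; rewrite exprS IHk. Qed.

End ExteriorAlgebra.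

(** * Products of anticommuting elements of square zero *)

Section Anticommuting.
Variables (A : nzRingType) (m : nat) (u : 'I_m -> A).
Hypothesis anti_u : forall i j, u i * u j = - (u j * u i).
Hypothesis sq_u : forall i, u i * u i = 0.

Lemma anticomm_prod i (s : seq 'I_m) (P : pred 'I_m) :
  u i * \prod_(j <- s | P j) u j =
  (-1) ^+ count P s * (\prod_(j <- s | P j) u j * u i).
Proof.
elim: s => [|j s IHs]; first by rewrite !big_nil mul1r mulr1 mul1r.
rewrite !big_cons /=; case: ifP => // _.
rewrite mulrA anti_u mulNr -[u j * u i * _]mulrA IHs add1n exprS mulN1r mulNr.
by congr (- _); rewrite mulrA commr_sign !mulrA.
Qed.

Lemma inversions_set1 i (J : {set 'I_m}) :
  inversions [set i] J = #|[set j in J | (j < i)%N]|.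
Proof.
have inj_pair : injective (pair i : 'I_m -> 'I_m * 'I_m) by move=> x y [].
rewrite -(card_imset _ inj_pair).
apply: eq_card => -[x y]; rewrite !inE /=; apply/idP/imsetP.
  case/and3P => /eqP -> yJ ltyi; exists y => //.
  by rewrite inE yJ.
by case=> z; rewrite inE => /andP[zJ ltzi] [-> ->]; rewrite eqxx zJ.
Qed.

(** Either [u i] meets its own copy, or it crosses the members of [J] below [i] to reach its place.
    The family is abstract because the formula serves for the [dx i] and also for their images under
    a linear substitution. *)
Lemma mul_anticomm_prod i (J : {set 'I_m}) :
  u i * \prod_(j in J) u j =
  if i \in J then 0
  else (-1) ^+ inversions [set i] J * \prod_(j in i |: J) u j.
Proof.
have := mem_index_enum i; have := index_enum_uniq 'I_m.
have : sorted (relpre val ltn) (index_enum 'I_m).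
  rewrite -sorted_map /index_enum; case: index_enum_key.
  by rewrite -enumT val_enum_ord iota_ltn_sorted.
rewrite inversions_set1 cardE /enum_mem size_filter -enumT.
have -> : enum 'I_m = index_enum 'I_m.
  by rewrite enumT /index_enum; case: index_enum_key.
(* The index list is increasing, so cutting it at [i] leaves on the left exactly the indices that
   the inversions count. *)
move=> + + /splitPr mem_i; case: mem_i => s1 s2 srt.
move: srt; rewrite sorted_pairwise; last by move=> x y z /=; apply: ltn_trans.
rewrite pairwise_cat /= => /and3P[/allrelP lt12 _ /andP[/allP lti _]].
rewrite cat_uniq /= => /and3P[_]; rewrite negb_or => /andP[i1 _] /andP[i2 _].
rewrite !big_cat !big_cons /= mulrA anticomm_prod.
have [iJ|niJ] := boolP (i \in J).
  by rewrite -!mulrA [u i * (u i * _)]mulrA sq_u mul0r !mulr0.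
rewrite setU11 -!mulrA; congr (_ ^+ _ * _).
  rewrite count_cat /= [in RHS]inE /= ltnn andbF add0n.
  rewrite [X in (_ + X)%N](_ : _ = 0)%N ?addn0.
    apply: eq_in_count => j js1 /=; rewrite inE.
    have -> : (j < i)%N by apply: lt12; rewrite ?mem_head.
    by rewrite andbT.
  apply/eqP; rewrite -leqn0 leqNgt -has_count; apply/hasPn => j js2.
  by rewrite /= inE ltnNge (ltnW (lti _ js2)) andbF.
have prodU s : i \notin s ->
    \prod_(j <- s | j \in i |: J) u j = \prod_(j <- s | j \in J) u j.
  move=> nis; rewrite big_seq_cond [RHS]big_seq_cond.
  apply: eq_bigl => j; rewrite !inE.
  by have [->|//] := eqVneq j i; rewrite (negPf nis).
by rewrite !prodU.
Qed.

End Anticommuting.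

(** * Algebra endomorphisms induced by linear substitutions, and gradings *)

Section ExtMap.
Variables (R : realType) (m : nat).
Local Notation C := R[i].
Local Notation E := (ext R m).
Implicit Types (I J K : {set 'I_m}) (a b c : E) (i j : 'I_m).
Implicit Types (M : 'M[C]_m) (r s : 'rV[C]_m) (z : C).

Lemma ext_signE n a : (-1) ^+ n * a = ((-1) ^+ n : C) *: a.
Proof. by rewrite -scaleN1r exprZn expr1n mulr_algl. Qed.

Lemma dx_anti i j : dx R i * dx R j = - (dx R j * dx R i).
Proof.
rewrite -!wedgeE !(wedge_basis R [set _] [set _]).
rewrite disjoint_sym; have [->|neij] := eqVneq i j.
  by rewrite -setI_eq0 setIid -cards_eq0 cards1 scale0r oppr0.
have -> : [disjoint [set j] & [set i]] by rewrite disjoints1 inE eq_sym.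
rewrite setUC -scaleNr !inversions_set1.
have cardE1 (k l : 'I_m) : #|[set x in [set l] | (x < k)%N]| = (l < k)%N.
  have [ltlk|leklk] := ltnP l k.
    rewrite /= -(cards1 l); apply: eq_card => x; rewrite !inE.
    by case: eqP => // ->.
  apply/eqP; rewrite cards_eq0; apply/eqP/setP => x; rewrite !inE.
  by case: eqP => // ->; rewrite ltnNge leklk.
rewrite !cardE1; case: (ltngtP j i) => [_|_|/val_inj eij].
- by rewrite expr0 expr1.
- by rewrite expr0 expr1 opprK.
- by rewrite eij eqxx in neij.
Qed.

Lemma dx_sq i : dx R i * dx R i = 0.
Proof.
rewrite -!wedgeE !(wedge_basis R [set _] [set _]).
by rewrite -setI_eq0 setIid -cards_eq0 cards1 scale0r.
Qed.

Lemma ext_basis_prod I : ext_basis R I = \prod_(i in I) dx R i.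
Proof.
have [n] := ubnP #|I|; elim: n I => // n IHn I.
have [->|[i iI]] := set_0Vmem I; first by rewrite big_set0.
rewrite -(setD1K iI) cardsU1 setD11 add1n ltnS => ltn.
have := mul_anticomm_prod dx_anti dx_sq i (I :\ i); rewrite setD11.
rewrite -(IHn _ ltn) ext_signE -wedgeE (wedge_basis R [set i]) disjoints1 setD11.
by move/scalerI; apply; rewrite signr_eq0.
Qed.

Fact lform_key : unit. Proof. exact: tt. Qed.
Definition lform := locked_with lform_key
  (fun r => \sum_j r 0 j *: dx R j : E).
Lemma lformE r : lform r = \sum_j r 0 j *: dx R j.
Proof. by rewrite /lform unlock. Qed.

Lemma lformD r s : lform (r + s) = lform r + lform s.
Proof.
by rewrite !lformE -big_split; apply: eq_bigr => j _; rewrite mxE scalerDl.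
Qed.

Lemma lformZ z r : lform (z *: r) = z *: lform r.
Proof.
by rewrite !lformE scaler_sumr; apply: eq_bigr => j _; rewrite mxE scalerA.
Qed.

Lemma lform_set1 r j : lform r [set j] = r 0 j.
Proof.
rewrite !lformE sum_ffunE (bigD1 j) //= big1 ?addr0 => [|k nekj].
  by rewrite ext_scaleE ffunE eqxx mulr1.
by rewrite ext_scaleE ffunE (inj_eq set1_inj) eq_sym (negPf nekj) mulr0.
Qed.

Lemma lform_anti r s : lform r * lform s = - (lform s * lform r).
Proof.
rewrite !lformE !mulr_suml -sumrN.
under eq_bigr do rewrite mulr_sumr.
under [in RHS]eq_bigr do rewrite mulr_sumr -sumrN.
rewrite exchange_big; apply: eq_bigr => i _; apply: eq_bigr => j _.
by rewrite !ext_mulZl !ext_mulZr dx_anti !scalerN !scalerA mulrC.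
Qed.

Lemma lform_sq r : lform r * lform r = 0.
Proof.
have := lform_anti r r; move/eqP; rewrite -addr_eq0 -mulr2n -scaler_nat.
by rewrite scaler_eq0 pnatr_eq0 => /eqP.
Qed.

Fact ext_map_key : unit. Proof. exact: tt. Qed.
(** The algebra endomorphism that extends the substitution [dx i |-> lform (row i M)]. Pullbacks,
    changes of coframe, the splitting into bidegrees and the sign in the graded Leibniz rule are all
    instances of it. *)
Definition ext_map := locked_with ext_map_key
  (fun M a => \sum_I a I *: \prod_(i in I) lform (row i M) : E).
Lemma ext_mapE M a : ext_map M a = \sum_I a I *: \prod_(i in I) lform (row i M).
Proof. by rewrite /ext_map unlock. Qed.

Fact ext_map_is_linear M : linear (ext_map M).
Proof.
move=> z a b; rewrite !ext_mapE scaler_sumr -big_split; apply: eq_bigr => I _.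
by rewrite ffunE ext_scaleE scalerDl scalerA.
Qed.

HB.instance Definition _ M :=
  GRing.isLinear.Build C E E *:%R (ext_map M) (ext_map_is_linear M).

Lemma ext_mapZ M z a : ext_map M (z *: a) = z *: ext_map M a.
Proof. exact: linearZ. Qed.
Lemma ext_mapD M a b : ext_map M (a + b) = ext_map M a + ext_map M b.
Proof. exact: linearD. Qed.
Lemma ext_mapN M a : ext_map M (- a) = - ext_map M a.
Proof. exact: linearN. Qed.
Lemma ext_map0 M : ext_map M 0 = 0.
Proof. exact: linear0. Qed.
Lemma ext_map_sum M (T : Type) (s : seq T) (P : pred T) (f : T -> E) :
  ext_map M (\sum_(t <- s | P t) f t) = \sum_(t <- s | P t) ext_map M (f t).
Proof. exact: linear_sum. Qed.

Lemma ext_map_basis M I :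
  ext_map M (ext_basis R I) = \prod_(i in I) lform (row i M).
Proof.
rewrite !ext_mapE (bigD1 I) //= ffunE eqxx scale1r [X in _ + X]big1 ?addr0 // => J neJI.
by rewrite ffunE (negPf neJI) scale0r.
Qed.

Lemma ext_map_dx M i : ext_map M (dx R i) = lform (row i M).
Proof. by rewrite (ext_map_basis M [set i]) big_set1. Qed.

(** The core of multiplicativity: the images of the [dx i] anticommute and square to zero as the
    [dx i] do, so sorting a new factor into a monomial costs the same sign on both sides. *)
Lemma ext_map_dxM M i a : ext_map M (dx R i * a) = lform (row i M) * ext_map M a.
Proof.
rewrite [a]ext_sum_basis mulr_sumr !ext_map_sum mulr_sumr; apply: eq_bigr => J _.
rewrite (ext_mulZr (a J) (dx R i)).
rewrite (ext_mapZ M (a J) (dx R i * ext_basis R J)).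
rewrite (ext_mapZ M (a J) (ext_basis R J)).
rewrite [RHS]ext_mulZr.
congr (_ *: _).
rewrite ext_map_basis (mul_anticomm_prod (u := fun j => lform (row j M))).
- rewrite -wedgeE (wedge_basis R [set i]) ext_mapZ ext_map_basis disjoints1.
  by case: (i \in J) => /=; rewrite ?scale0r ?ext_signE.  
- by move=> *; apply: lform_anti.
- by move=> *; apply: lform_sq.
Qed.

Fact ext_map_is_monoid_morphism M : monoid_morphism (ext_map M).
Proof.
split; first by rewrite (ext_map_basis M finset.set0) big_set0.
have mulb I b : ext_map M (ext_basis R I * b) =
    ext_map M (ext_basis R I) * ext_map M b.
  rewrite ext_map_basis ext_basis_prod.
  elim/big_rec2: _ => [|i x y _ IH]; first by rewrite !mul1r.
  by rewrite -mulrA ext_map_dxM IH mulrA.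
move=> a b; rewrite [a]ext_sum_basis mulr_suml !ext_map_sum mulr_suml.
by apply: eq_bigr => I _; rewrite (ext_mulZl (a I) _ b)
  (ext_mapZ M (a I) (ext_basis R I * b))
  (ext_mapZ M (a I) (ext_basis R I)) mulb ext_mulZl.
Qed.

HB.instance Definition _ M :=
  GRing.isMonoidMorphism.Build E E (ext_map M) (ext_map_is_monoid_morphism M).

Lemma ext_mapM M a b : ext_map M (a * b) = ext_map M a * ext_map M b.
Proof. exact: rmorphM. Qed.
Lemma ext_mapX M a n : ext_map M (a ^+ n) = ext_map M a ^+ n.
Proof. exact: rmorphXn. Qed.
Lemma ext_map_prod M (T : Type) (s : seq T) (P : pred T) (f : T -> E) :
  ext_map M (\prod_(t <- s | P t) f t) = \prod_(t <- s | P t) ext_map M (f t).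
Proof. exact: rmorph_prod. Qed.

Lemma ext_map_lform M r : ext_map M (lform r) = lform (r *m M).
Proof.
rewrite !lformE ext_map_sum.
under eq_bigr do rewrite ext_mapZ ext_map_dx lformE scaler_sumr.
rewrite exchange_big; apply: eq_bigr => j _; rewrite !mxE scaler_suml.
by apply: eq_bigr => k _; rewrite mxE scalerA.
Qed.

Lemma ext_map_comp M N a : ext_map M (ext_map N a) = ext_map (N *m M) a.
Proof.
rewrite [a]ext_sum_basis !ext_map_sum; apply: eq_bigr => I _.
rewrite !ext_mapZ !ext_map_basis ext_map_prod; congr (_ *: _).
by apply: eq_bigr => i _; rewrite ext_map_lform row_mul.
Qed.

Lemma ext_map1 a : ext_map 1%:M a = a.
Proof.
rewrite [RHS]ext_sum_basis ext_mapE; apply: eq_bigr => I _; congr (_ *: _).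
rewrite ext_basis_prod; apply: eq_bigr => i _.
rewrite !lformE (bigD1 i) //= !mxE eqxx scale1r big1 ?addr0 // => j neji.
by rewrite !mxE eq_sym (negPf neji) scale0r.
Qed.

Lemma ext_map_diag (d : 'rV[C]_m) a I :
  ext_map (diag_mx d) a I = (\prod_(i in I) d 0 i) * a I.
Proof.
have -> : ext_map (diag_mx d) a = \sum_(J : {set 'I_m}) (\prod_(i in J) d 0 i) * a J *: ext_basis R J.
  rewrite ext_mapE; apply: eq_bigr => J _; rewrite mulrC -scalerA; congr (_ *: _).
  rewrite ext_basis_prod -scaler_prod; apply: eq_bigr => i _.
  rewrite !lformE (bigD1 i) //= !mxE eqxx mulr1n big1 ?addr0 // => j neji.
  by rewrite !mxE eq_sym (negPf neji) mulr0n scale0r.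
rewrite sum_ffunE (bigD1 I) //= [X in _ + X]big1 ?addr0 => [|J neJI].
  by rewrite ext_scaleE ffunE eqxx mulr1.
by rewrite ext_scaleE ffunE eq_sym (negPf neJI) mulr0.
Qed.

Lemma ext_coefM a b K :
  (a * b) K = \sum_(I in powerset K)
     (-1) ^+ inversions I (K :\: I) * a I * b (K :\: I).
Proof. by rewrite -wedgeE ffunE. Qed.

(** The substitution [-1] multiplies degree [k] by [(-1)^k]. It is the sign that a one-form picks up
    on crossing an element, expressed without fixing the degree of that element. *)
Local Notation parity := (ext_map (- 1%:M)).

Lemma parity_dx i : parity (dx R i) = - dx R i.
Proof.
have -> : dx R i = lform (delta_mx 0 i).
  rewrite !lformE (bigD1 i) //= !mxE !eqxx scale1r big1 ?addr0 // => j neji.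
  by rewrite !mxE (negPf neji) andbF scale0r.
by rewrite ext_map_lform mulmxN mulmx1 -scaleN1r lformZ scaleN1r.
Qed.

Lemma dx_parity i a : dx R i * a = parity a * dx R i.
Proof.
rewrite [a]ext_sum_basis !(mulr_sumr, ext_map_sum, mulr_suml) /=.
apply: eq_bigr => I _; rewrite ext_mapZ ext_mulZr ext_mulZl; congr (_ *: _).
rewrite ext_basis_prod ext_map_prod.
elim/big_rec2: _ => [|j x y _ IH]; first by rewrite mulr1 mul1r.
by rewrite mulrA dx_anti mulNr -[dx R j * _ * _]mulrA IH parity_dx !mulrA !mulNr.
Qed.

(** Homogeneity of weight [k] for the grading that gives [dx i] the weight [w i]; the constant
    weight 1 is the degree. Zero is homogeneous of every weight. *)
Definition supported (w : 'I_m -> nat) (k : nat) a :=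
  forall I, a I != 0 -> (\sum_(i in I) w i)%N = k.

Lemma supportedM w k l a b :
  supported w k a -> supported w l b -> supported w (k + l) (a * b).
Proof.
move=> wa wb K; rewrite ext_coefM => nz.
have [I IK] : exists2 I, I \in powerset K & a I * b (K :\: I) != 0.
  apply/exists_inP; apply: contra_neqT nz => /exists_inPn nz.
  by rewrite big1 // => I /nz; rewrite negbK -mulrA => /eqP ->; rewrite mulr0.
rewrite mulf_eq0 negb_or => /andP[/wa <- /wb <-].
rewrite powersetE in IK; rewrite (big_setID I) /=.
by rewrite (setIidPr IK).
Qed.

Lemma supportedD w k a b :
  supported w k a -> supported w k b -> supported w k (a + b).
Proof.
move=> wa wb K; rewrite ffunE; have [->|/wa//] := eqVneq (a K) 0.
by rewrite add0r => /wb.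
Qed.

Lemma supportedZ w k z a : supported w k a -> supported w k (z *: a).
Proof.
by move=> wa K; rewrite ext_scaleE mulf_eq0 negb_or => /andP[_ /wa].
Qed.

Lemma supportedN w k a : supported w k a -> supported w k (- a).
Proof. by rewrite -scaleN1r; apply: supportedZ. Qed.

Lemma supported0 w k : supported w k 0.
Proof. by move=> K; rewrite ffunE eqxx. Qed.

Lemma supported_sum w k (T : Type) (s : seq T) (P : pred T) (f : T -> E) :
  (forall t, P t -> supported w k (f t)) ->
  supported w k (\sum_(t <- s | P t) f t).
Proof.
move=> wf; apply: big_ind => //; first exact: supported0.
by move=> *; apply: supportedD.
Qed.

Lemma supported_basis w I : supported w (\sum_(i in I) w i) (ext_basis R I).
Proof. by move=> J; rewrite ffunE; case: (J =P I) => [->|]; rewrite ?eqxx. Qed.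

Arguments supported_basis : clear implicits.
Lemma supported_dx w i : supported w (w i) (dx R i).
Proof. by have := supported_basis w [set i]; rewrite big_set1. Qed.

Lemma supported1 w : supported w 0 (1 : E).
Proof. by have := supported_basis w finset.set0; rewrite big_set0. Qed.

Lemma supportedX w k n a : supported w k a -> supported w (n * k) (a ^+ n).
Proof.
move=> wa; elim: n => [|n IHn]; first exact: supported1.
by rewrite exprS mulSn; apply: supportedM.
Qed.

Lemma parity_supported k a : supported (fun=> 1%N) k a ->
  parity a = (-1) ^+ k *: a.
Proof.
move=> wa; apply/ffunP => I; rewrite ext_scaleE -scaleN1r scalemx1.
have -> : (-1)%:M = diag_mx (const_mx (-1) : 'rV[C]_m).
  by rewrite diag_const_mx.
rewrite ext_map_diag; under eq_bigr do rewrite mxE.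
have [->|/wa <-] := eqVneq (a I) 0; first by rewrite !mulr0.
by rewrite sum1_card prodr_const.
Qed.

(** The parity involution fixes an element of even degree, so each [dx i] crosses it without a
    sign. *)
Lemma even_comm k a b : supported (fun=> 1%N) k.*2 a -> a * b = b * a.
Proof.
move=> /parity_supported; rewrite -muln2 exprM -signr_odd; move=> ea.
have pa : parity a = a by rewrite ea -exprM mulnC exprM sqrrN !expr1n scale1r.
rewrite [b]ext_sum_basis mulr_suml mulr_sumr; apply: eq_bigr => I _.
rewrite ext_mulZl ext_mulZr; congr (_ *: _); rewrite ext_basis_prod.
elim/big_rec: _ => [|i x _ IH]; first by rewrite mul1r mulr1.
by rewrite mulrA -[a * dx R i]/(a * _) -{1}pa -dx_parity -!mulrA IH.
Qed.

End ExtMap.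

(** A polynomial with infinitely many roots is zero, applied to one variable after the other. It is
    used to compare coefficients of generating functions. *)
Lemma poly2_eq0 (K : numFieldType) (n : nat) (c : 'I_n -> 'I_n -> K) :
  (forall t s : K, \sum_(p < n) \sum_(q < n) t ^+ p * s ^+ q * c p q = 0) ->
  forall p q, c p q = 0.
Proof.
have poly0 (d : 'I_n -> K) :
    (forall t, \sum_(p < n) t ^+ p * d p = 0) -> forall p, d p = 0.
  move=> d0; pose f := \poly_(p < n) (if insub p is Some i then d i else 0).
  have f0 : f = 0.
    apply/eqP/contraT => nzf.
    have := max_poly_roots nzf (rs := [seq k%:R | k <- iota 0 (size f)]).
    rewrite size_map size_iota ltnn; apply.
      apply/allP => _ /mapP[k _ ->]; rewrite /root horner_poly.
      rewrite -[X in _ == X](d0 k%:R); apply/eqP; apply: eq_bigr => p _.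
      by rewrite valK mulrC.
    by rewrite map_inj_uniq ?iota_uniq // => k l /eqP; rewrite eqr_nat => /eqP.
  move=> p; have := congr1 (fun g : {poly K} => g`_p) f0.
  by rewrite coef_poly ltn_ord valK coef0.
move=> c0 p; apply: (poly0 (c p)) => s; apply: (poly0 (fun p => \sum_(q < n) s ^+ q * c p q)) => t.
rewrite -[RHS](c0 t s); apply: eq_bigr => {}p _; rewrite mulr_sumr.
by apply: eq_bigr => q _; rewrite mulrA.
Qed.

(** * Bidegrees with respect to a complex structure *)

Section Bidegree.
Variables (R : realType) (m : nat).
Local Notation C := R[i].
Local Notation E := (ext R m).
Implicit Types (a b : E) (J : 'M[R]_m) (I A K : {set 'I_m}).
Local Notation imag := (0 +i* 1 : C).

Lemma imag_sqr : imag * imag = -1.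
Proof. by apply/eqP; rewrite eq_complex /= !(mul0r, mulr0, mul1r, oppr0, addr0, add0r, sub0r, eqxx). Qed.

Lemma prod_wedges (f : 'I_m -> E) I :
  wedges [seq f i | i <- enum I] = \prod_(i in I) f i.
Proof.
rewrite wedgesE big_map /enum_mem big_filter -enumT enumT.
by rewrite /index_enum; case: index_enum_key.
Qed.

(** Transposed because rows are now covectors: vectors move by [v *m J], and row [i] of [cJ J] holds
    the coefficients of [dx i] composed with [J]. *)
Definition cJ J : 'M[C]_m := (map_mx (real_complex R) J)^T.
Definition p10 J : 'M[C]_m := 2^-1 *: (1%:M - imag *: cJ J).
Definition p01 J : 'M[C]_m := 2^-1 *: (1%:M + imag *: cJ J).

Lemma lform_row1 i : lform (row i (1%:M : 'M[C]_m)) = dx R i.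
Proof. by rewrite -ext_map_dx ext_map1. Qed.

Lemma lform_row_comb i (t s : C) (A B : 'M[C]_m) :
  lform (row i (t *: A + s *: B)) = t *: lform (row i A) + s *: lform (row i B).
Proof.
have -> : row i (t *: A + s *: B) = t *: row i A + s *: row i B.
  by apply/rowP => j; rewrite !mxE.
by rewrite lformD 2!lformZ.
Qed.

Lemma lform_cJ J i : lform (row i (cJ J)) = \sum_j (J j i)%:C *: dx R j.
Proof. by rewrite lformE; apply: eq_bigr => j _; rewrite !mxE. Qed.

Lemma lform_p10 J i : lform (row i (p10 J)) = dx10 J i.
Proof.
rewrite /p10 /dx10 linearZ /= lformZ linearB /= lformD -scaleN1r lformZ.
by rewrite linearZ /= lformZ lform_row1 lform_cJ scaleN1r.
Qed.

Lemma lform_p01 J i : lform (row i (p01 J)) = dx01 J i.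
Proof.
rewrite /p01 /dx01 linearZ /= lformZ linearD /= lformD.
by rewrite linearZ /= lformZ lform_row1 lform_cJ.
Qed.

Lemma cJ_sqr J : J *m J = - 1%:M -> cJ J *m cJ J = - 1%:M.
Proof.
by move=> J2; rewrite -trmx_mul -map_mxM J2 map_mxN map_mx1 linearN /= trmx1.
Qed.

Lemma icJ_sqr J : J *m J = - 1%:M ->
  (imag *: cJ J) *m (imag *: cJ J) = 1%:M.
Proof.
move=> /cJ_sqr J2.
by rewrite -scalemxAl -scalemxAr scalerA imag_sqr J2 scaleN1r opprK.
Qed.

Lemma p10_p01 J : J *m J = - 1%:M -> p10 J *m p01 J = 0.
Proof.
rewrite /p10 /p01 => /icJ_sqr; move: (imag *: cJ J) => K K2.
rewrite -scalemxAl -scalemxAr mulmxBl mul1mx mulmxDr mulmx1 K2.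
by rewrite [K + _]addrC subrr !scaler0.
Qed.

Definition type_mx J (t s : C) : 'M[C]_m := t *: p10 J + s *: p01 J.

Lemma prod_eq0 (f : 'I_m -> E) i (P : pred 'I_m) : P i -> f i = 0 ->
  \prod_(j | P j) f j = 0.
Proof.
move=> Pi fi; case/splitPr: (mem_index_enum i) => s1 s2.
by rewrite big_cat big_cons /= Pi fi mul0r mulr0.
Qed.

Lemma prod_addE (u v : 'I_m -> E) I (t s : C) :
  \prod_(i in I) (t *: u i + s *: v i) =
  \sum_(A in powerset I) (t ^+ #|A| * s ^+ #|I :\: A|) *:
     \prod_(i in I) (if i \in A then u i else v i).
Proof.
rewrite big_mkcond /=.
pose f i := if i \in I then t *: u i else 0.
pose g i := if i \in I then s *: v i else 1.
rewrite (eq_bigr (fun i => f i + g i)); last first.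
  by move=> i _; rewrite /f /g; case: ifP => _; rewrite ?add0r.
rewrite bigA_distr /= (bigID (fun A : {set 'I_m} => A \subset I)) /=.
rewrite [X in _ + X]big1 ?addr0; last first.
  move=> A /subsetPn[i iA niI]; apply: (@prod_eq0 _ i) => //.
  by rewrite iA /f (negPf niI).
apply: eq_big => [A|A AI]; first by rewrite powersetE.
rewrite (eq_bigr (fun i => if i \in I then
    (if i \in A then t else s) *: (if i \in A then u i else v i) else 1)).
  rewrite -big_mkcond /= scaler_prod; congr (_ *: _).
  rewrite (big_setID A) /= (setIidPr AI) -!prodr_const; congr (_ * _).
    by apply: eq_bigr => i ->.
  by apply: eq_bigr => i; rewrite inE => /andP[/negPf ->].
move=> i _; rewrite /f /g; case: (boolP (i \in A)) => [iA|//].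
by rewrite (subsetP AI).
Qed.

(** Expanding every factor [t *: dx10 J i + s *: dx01 J i] sorts the terms by the set of factors
    taken of type (1,0); grouping these sets by their cardinal and that of their complement yields
    the bidegree parts. *)
Lemma ext_map_type J (t s : C) a :
  ext_map (type_mx J t s) a =
  \sum_(p < m.+1) \sum_(q < m.+1) (t ^+ p * s ^+ q) *: pq_part J p q a.
Proof.
rewrite ext_mapE /pq_part.
under [RHS]eq_bigr => p _ do under eq_bigr => q _ do rewrite scaler_sumr.
under [RHS]eq_bigr => p _ do rewrite exchange_big.
rewrite [RHS]exchange_big; apply: eq_bigr => I _.
under [RHS]eq_bigr => p _ do under eq_bigr => q _ do rewrite scalerA mulrC -scalerA.
under [RHS]eq_bigr => p _ do rewrite -scaler_sumr.
rewrite -scaler_sumr; congr (_ *: _).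
rewrite (eq_bigr (fun i => t *: dx10 J i + s *: dx01 J i)); last first.
  by move=> i _; rewrite lform_row_comb lform_p10 lform_p01.
rewrite prod_addE.
have card_ub A : (#|A| < m.+1)%N by rewrite ltnS; have := max_card (mem A); rewrite card_ord.
rewrite (partition_big (fun A => Ordinal (card_ub A)) predT) //=.
apply: eq_bigr => p _.
rewrite (partition_big (fun A => Ordinal (card_ub (I :\: A))) predT) //=.
apply: eq_bigr => q _; rewrite scaler_sumr.
apply: eq_big => [A|A /andP[/andP[_ /eqP <-] /eqP <-]]; last first.
  by rewrite prod_wedges.
by rewrite -andbA.
Qed.

End Bidegree.

(** * Powers of positive (1,1)-forms *)

Section DegreeOne.
Variables (R : realType) (m : nat).
Local Notation C := R[i].
Local Notation E := (ext R m).
Local Notation deg := (supported (fun=> 1%N)).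

Lemma deg1_lform (c : E) : deg 1 c -> c = lform (\row_j c [set j]).
Proof.
move=> d1; apply/ffunP => I.
have [/cards1P[j ->]|nI] := boolP (#|I| == 1%N).
  by rewrite lform_set1 mxE.
have zero (a : E) : deg 1 a -> a I = 0.
  by move=> d; apply: contraNeq nI => /d; rewrite sum1_card => ->.
rewrite zero // zero // lformE; apply: supported_sum => j _.
by apply: supportedZ; apply: supported_dx.
Qed.

Lemma deg1_anti (a b : E) : deg 1 a -> deg 1 b -> a * b = - (b * a).
Proof. by move=> /deg1_lform -> /deg1_lform ->; apply: lform_anti. Qed.

Lemma deg1_sq (a : E) : deg 1 a -> a * a = 0.
Proof. by move=> /deg1_lform ->; apply: lform_sq. Qed.

Lemma deg1_pair_sq (a b : E) : deg 1 a -> deg 1 b -> (a * b) * (a * b) = 0.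
Proof.
move=> da db; rewrite -mulrA [b * _]mulrA (deg1_anti db da) mulNr mulrN !mulrA.
by rewrite deg1_sq // !mul0r oppr0.
Qed.

Lemma prod_dx_uniq (s : seq 'I_m) : uniq s ->
  exists2 e : C, e != 0 & \prod_(j <- s) dx R j = e *: ext_basis R [set j in s].
Proof.
elim: s => [|j s IHs] /= => [_|/andP[njs /IHs[e nze IH]]].
  exists 1; rewrite ?oner_neq0 // big_nil scale1r.
  by congr ext_basis; apply/setP => j; rewrite !inE.
exists (e * (-1) ^+ inversions [set j] [set j in s]).
  by rewrite mulf_neq0 // signr_eq0.
rewrite big_cons IH ext_mulZr -wedgeE (wedge_basis R [set j]) disjoints1 inE njs.
rewrite scalerA; congr (_ *: ext_basis R _).
by apply/setP => k; rewrite !inE.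
Qed.

Lemma prod_comm_perm (A : nzRingType) (T : eqType) (f : T -> A) :
  (forall x y, f x * f y = f y * f x) ->
  forall s t : seq T, perm_eq s t -> \prod_(x <- s) f x = \prod_(x <- t) f x.
Proof.
move=> comm s t pst.
have prodC (u v : seq T) :
    (\prod_(x <- u) f x) * (\prod_(x <- v) f x) =
    (\prod_(x <- v) f x) * (\prod_(x <- u) f x).
  apply: commr_prod => x _; apply/commr_sym/commr_prod => y _.
  exact: comm.
have catCA (s1 s2 s3 : seq T) : \prod_(x <- s1 ++ s2 ++ s3) f x =
    \prod_(x <- s2 ++ s1 ++ s3) f x.
  by rewrite !big_cat /= !mulrA [X in X * _]prodC.
exact: (catCA_perm_subst (F := fun r => \prod_(x <- r) f x) catCA).
Qed.

(** All further terms of the binomial formula contain [y * y]. *)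
Lemma exprD_sq0 (A : nzRingType) (x y : A) k : y * y = 0 -> x * y = y * x ->
  (x + y) ^+ k.+1 = x ^+ k.+1 + (y * x ^+ k) *+ k.+1.
Proof.
move=> y2 xy; elim: k => [|k IHk]; first by rewrite !expr1 expr0 mulr1 mulr1n.
have e1 : x * (y * x ^+ k) = y * x ^+ k.+1 by rewrite mulrA xy -mulrA -exprS.
have e2 : y * (y * x ^+ k) = 0 by rewrite mulrA y2 mul0r.
rewrite exprS IHk mulrDl !mulrDr !mulrnAr e1 e2 mul0rn addr0 -exprS -addrA.
by rewrite -mulrSr.
Qed.

End DegreeOne.

Section LowHigh.
Variable N : nat.

(** [lo k] is the place of the [k]-th (1,0)-form of a coframe and [hi k] that of its conjugate. *)
Definition lo (k : 'I_N) : 'I_(N.*2) := cast_ord (addnn N) (lshift N k).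
Definition hi (k : 'I_N) : 'I_(N.*2) := cast_ord (addnn N) (rshift N k).

Lemma big_lohi (T : Type) (idx : T) (op : Monoid.com_law idx) (f : 'I_(N.*2) -> T) :
  \big[op/idx]_i f i =
  op (\big[op/idx]_(k < N) f (lo k)) (\big[op/idx]_(k < N) f (hi k)).
Proof.
rewrite (reindex (cast_ord (addnn N))) /=; last first.
  exists (cast_ord (esym (addnn N))) => i _; first exact: cast_ordK.
  exact: cast_ordKV.
by rewrite big_split_ord.
Qed.

Lemma lo_inj : injective lo.
Proof. by move=> k l /cast_ord_inj /lshift_inj. Qed.

Lemma hi_inj : injective hi.
Proof. by move=> k l /cast_ord_inj /rshift_inj. Qed.

Lemma lo_hi k l : (lo k == hi l) = false.
Proof. by rewrite (inj_eq (@cast_ord_inj _ _ _)) eq_lrshift. Qed.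

Lemma hi_lo k l : (hi k == lo l) = false.
Proof. by rewrite eq_sym lo_hi. Qed.

Lemma lohiP (i : 'I_(N.*2)) : {k | i = lo k} + {k | i = hi k}.
Proof.
have <- := cast_ordKV (addnn N) i; move: (cast_ord _ i) => j.
by case: (split_ordP j) => k ->; [left | right]; exists k.
Qed.

Definition lo_wt (i : 'I_(N.*2)) : nat := (i < N)%N.
Definition hi_wt (i : 'I_(N.*2)) : nat := (N <= i)%N.

Lemma lo_wt_lo k : lo_wt (lo k) = 1%N.
Proof. by rewrite /lo_wt /= ltn_ord. Qed.
Lemma lo_wt_hi k : lo_wt (hi k) = 0%N.
Proof. by rewrite /lo_wt /= ltnNge leq_addr. Qed.
Lemma hi_wt_lo k : hi_wt (lo k) = 0%N.
Proof. by rewrite /hi_wt /= leqNgt ltn_ord. Qed.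
Lemma hi_wt_hi k : hi_wt (hi k) = 1%N.
Proof. by rewrite /hi_wt /= leq_addr. Qed.

End LowHigh.

Section Positivity.
Variables (R : realType) (N : nat).
Local Notation C := R[i].
Local Notation E := (ext R N.*2).
Local Notation deg := (supported (fun=> 1%N)).
Implicit Types (h : 'I_N -> 'I_N -> C) (U : seq 'I_N) (z : 'I_N -> C).

Definition pairform (k : 'I_N) : E := dx R (lo k) * dx R (hi k).

Definition herm_form h U : E :=
  \sum_(k <- U) \sum_(l <- U) h k l *: (dx R (lo k) * dx R (hi l)).

(** Positivity in [R[i]] includes being real, and so carries the Hermitian symmetry of [h] on
    [U]. *)
Definition pos_def h U :=
  forall z, (exists2 k, k \in U & z k != 0) ->
  0 < \sum_(k <- U) \sum_(l <- U) h k l * (z k * conjc (z l)).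

Lemma pairform_comm k (a : E) : pairform k * a = a * pairform k.
Proof.
apply: (@even_comm _ _ 1); rewrite -[1.*2]/(1 + 1)%N.
by apply: supportedM; apply: supported_dx.
Qed.

Lemma prod_pairform_dx0 k U : k \in U ->
  (dx R (lo k) * \prod_(l <- U) pairform l = 0) *
  (dx R (hi k) * \prod_(l <- U) pairform l = 0).
Proof.
elim: U => // l U IHU; rewrite inE big_cons => /predU1P[->|/IHU[e1 e2]].
  rewrite !mulrA dx_sq !mul0r; split=> //.
  by rewrite dx_anti mulNr -[dx _ _ * _ * dx _ _]mulrA dx_sq mulr0 mulNr mul0r oppr0.
by rewrite !(mulrA _ (pairform l)) -!(pairform_comm l) -!(mulrA (pairform l)) e1 e2 !mulr0.
Qed.

(** Completing the square at [u] writes the form as a Schur complement on the remaining indices plus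
    a multiple of a product of two one-forms. That product squares to zero, so the power reduces to
    its linear term, and the induction hypothesis applies to the Schur complement. *)
Lemma wedge_pow_pos U : uniq U -> forall h, pos_def h U ->
  exists2 r : C, 0 < r &
    herm_form h U ^+ size U = r *: \prod_(k <- U) pairform k.
Proof.
elim: U => [_ h _|u U IHU /= /andP[nuU uU] h hpos].
  by exists 1; rewrite ?ltr01 // big_nil expr0 scale1r.
pose hu := h u u.
have neu k : k \in U -> (k == u) = false.
  by move=> kU; apply: contraNF nuU => /eqP <-.
have hu_gt0 : 0 < hu.
  have nz1 : exists2 k, k \in u :: U & (if k == u then 1 else 0 : C) != 0.
    by exists u; rewrite ?mem_head // eqxx oner_eq0.
  have := hpos _ nz1; rewrite !big_cons eqxx.
  rewrite conjc1 mulr1 mulr1 [X in _ + X + _]big_seq [X in _ + X + _]big1 ?addr0 => [|l lU]; last first.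
    by rewrite (neu l lU) conjc0 !mulr0.
  rewrite big_seq big1 ?addr0 // => k kU.
  rewrite !(big_cons, neu k kU) mul0r mulr0 add0r big1 // => l _.
  by rewrite mul0r mulr0.
have nzhu : hu != 0 by rewrite gt_eqF.
pose p : E := \sum_(k <- u :: U) h k u *: dx R (lo k).
pose q : E := \sum_(l <- u :: U) h u l *: dx R (hi l).
(* The Schur complement of the entry at [u]: its row and its column at [u] vanish. *)
pose h' k l := h k l - h k u * h u l / hu.
have degp : deg 1 p.
  by apply: supported_sum => k _; apply: supportedZ; apply: supported_dx.
have degq : deg 1 q.
  by apply: supported_sum => k _; apply: supportedZ; apply: supported_dx.
have pq_comm a : (p * q) * a = a * (p * q).
  by apply: (@even_comm _ _ 1); apply: (supportedM degp degq).
have hE : herm_form h (u :: U) = herm_form h' (u :: U) + hu^-1 *: (p * q).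
  rewrite mulr_suml scaler_sumr -big_split; apply: eq_bigr => k _.
  rewrite ext_mulZl mulr_sumr !scaler_sumr -big_split; apply: eq_bigr => l _.
  rewrite /= ext_mulZr !scalerA -scalerDl; congr (_ *: _).
  by rewrite /h'; field.
have h'E : herm_form h' (u :: U) = herm_form h' U.
  rewrite /herm_form big_cons [X in X + _]big1 ?add0r => [|l _]; last first.
    by rewrite /h' -/hu mulrAC divff // mul1r subrr scale0r.
  apply: eq_bigr => k _; rewrite big_cons [h' _ _](_ : _ = 0).
    by rewrite scale0r add0r.
  by rewrite /h' -/hu mulfK // subrr.
have h'pos : pos_def h' U.
  move=> z [k kU zk]; pose s := \sum_(k <- U) h k u * z k.
  (* The coordinate at [u] is chosen to annihilate the completed square, so that [h] at [z'] equals
     [h'] at [z]. *)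
  pose z' k := if k == u then - (s / hu) else z k.
  have zU (g : C -> 'I_N -> C) : \sum_(l <- U) g (z' l) l = \sum_(l <- U) g (z l) l.
    by rewrite big_seq [RHS]big_seq; apply: eq_bigr => l /neu; rewrite /z' => ->.
  have s0 : \sum_(k <- u :: U) h k u * z' k = 0.
    rewrite big_cons (zU (fun x k => h k u * x)) -/s /z' eqxx -/hu.
    by rewrite mulrN mulrCA divff // mulr1 addNr.
  have := hpos z'; rewrite (_ : \sum_(k <- u :: U) _ =
      \sum_(k <- U) \sum_(l <- U) h' k l * (z k * conjc (z l))).
    by apply; exists k; rewrite ?inE ?kU ?orbT // /z' neu.
  transitivity (\sum_(k <- u :: U) \sum_(l <- u :: U) h' k l * (z' k * conjc (z' l))).
    rewrite -[RHS]addr0 -[X in _ = _ + X](mul0r (\sum_(l <- u :: U) h u l / hu * conjc (z' l))).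
    rewrite -[X in _ + X * _]s0 mulr_suml -big_split /=; apply: eq_bigr => i _.
    rewrite mulr_sumr -big_split; apply: eq_bigr => l _.
    by rewrite /h' /=; field.
  rewrite big_cons [X in X + _]big1 ?add0r => [|l _]; last first.
    by rewrite /h' -/hu mulrAC divff // mul1r subrr mul0r.
  rewrite -(zU (fun x k => \sum_(l <- U) h' k l * (x * conjc (z l) ))).
  apply: eq_bigr => i _; rewrite big_cons [h' _ _](_ : _ = 0).
    by rewrite mul0r add0r (zU (fun x l => h' i l * (z' i * conjc x))).
  by rewrite /h' -/hu mulfK // subrr.
have [r r0 hr] := IHU uU h' h'pos.
exists ((size U).+1%:R * r * hu); first by rewrite !mulr_gt0 // ltr0Sn.
rewrite hE h'E exprD_sq0; last 2 first.
- by rewrite (ext_mulZl hu^-1 (p * q)) (ext_mulZr _ (p * q) (p * q)) deg1_pair_sq // !scaler0.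
- by rewrite (ext_mulZl hu^-1 (p * q)) (ext_mulZr hu^-1 _ (p * q)) pq_comm.
(* The power [size U] already contains both forms of every pair of [U], so a further factor in the
   same indices kills it. *)
have -> : herm_form h' U ^+ (size U).+1 = 0.
  rewrite exprS hr ext_mulZr mulr_suml big_seq big1 ?scaler0 // => k kU.
  rewrite mulr_suml big_seq big1 // => l lU.
  by rewrite ext_mulZl -mulrA prod_pairform_dx0 // mulr0 scaler0.
have Q0 k : k \in U -> _ := @prod_pairform_dx0 k U.
rewrite add0r big_cons hr; move: (\prod_(k <- U) pairform k) Q0 => Q Q0.
(* [Q] contains both forms of every pair of [U], so only the terms of index [u] in [q] and [p]
   survive against it. *)
have qQ : q * Q = hu *: (dx R (hi u) * Q).
  rewrite /q big_cons mulrDl (ext_mulZl _ (dx R _)) mulr_suml.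
  rewrite [X in _ + X]big_seq [X in _ + X]big1 ?addr0 // => k kU.
  by rewrite (ext_mulZl _ (dx R _)) Q0 // scaler0.
have pQ : p * (dx R (hi u) * Q) = hu *: (pairform u * Q).
  rewrite /p big_cons mulrDl (ext_mulZl _ (dx R _)) mulr_suml.
  rewrite [X in _ + X]big_seq [X in _ + X]big1 ?addr0 => [|k kU].
    by congr (_ *: _); apply: mulrA.
  rewrite (ext_mulZl _ (dx R _)) (mulrA _ _ Q) dx_anti mulNr -(mulrA _ _ Q).
  by rewrite (Q0 k kU).1 mulr0 oppr0 scaler0.
have -> : hu^-1 *: (p * q) * (r *: Q) = (hu^-1 * r * hu * hu) *: (pairform u * Q).
  rewrite (ext_mulZl hu^-1 (p * q) (r *: Q)) (ext_mulZr r (p * q) Q).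
  rewrite -(mulrA p q Q) (congr1 (fun x => p * x) qQ) (ext_mulZr hu p _).
  by rewrite (congr1 (fun x => hu *: x) pQ) !scalerA.
rewrite -scaler_nat scalerA; congr (_ *: _).
by field.
Qed.

End Positivity.

(** * Bidegree as a count of indices; the top coefficient *)

Section Bigrading.
Variables (R : realType) (N : nat).
Local Notation C := R[i].
Local Notation E := (ext R N.*2).
Local Notation m := (N.*2).
Implicit Types (a b c : E) (I : {set 'I_m}).

Definition bidegree p q c :=
  supported (@lo_wt N) p c /\ supported (@hi_wt N) q c.

Definition bipart p q c : E :=
  [ffun I : {set 'I_m} => if ((\sum_(i in I) lo_wt i)%N == p) && ((\sum_(i in I) hi_wt i)%N == q)
             then c I else 0].

Lemma bidegreeM p q p' q' a b : bidegree p q a -> bidegree p' q' b ->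
  bidegree (p + p') (q + q') (a * b).
Proof. by case=> la ha [lb hb]; split; apply: supportedM. Qed.

Lemma bidegreeX p q n a : bidegree p q a -> bidegree (n * p) (n * q) (a ^+ n).
Proof. by case=> la ha; split; apply: supportedX. Qed.

Lemma bidegreeD p q a b : bidegree p q a -> bidegree p q b -> bidegree p q (a + b).
Proof. by case=> la ha [lb hb]; split; apply: supportedD. Qed.

Lemma bidegree_lo k : bidegree 1 0 (dx R (lo k)).
Proof.
split; first by rewrite -(lo_wt_lo k); apply: supported_dx.
by rewrite -(hi_wt_lo k); apply: supported_dx.
Qed.

Lemma bidegree_hi k : bidegree 0 1 (dx R (hi k)).
Proof.
split; first by rewrite -(lo_wt_hi k); apply: supported_dx.
by rewrite -(hi_wt_hi k); apply: supported_dx.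
Qed.

Lemma bidegree_bipart p q c : bidegree p q (bipart p q c).
Proof. by split=> I; rewrite ffunE; case: ifP => [/andP[/eqP ? /eqP ?]|]; rewrite ?eqxx. Qed.

Lemma bipart_id p q c : bidegree p q c -> bipart p q c = c.
Proof.
case=> lc hc; apply/ffunP => I; rewrite ffunE; case: ifP => // /negbT neq.
apply/esym; apply: contraNeq neq => nz.
by rewrite lc // hc // !eqxx.
Qed.

Lemma bipart_neq p q p' q' c : bidegree p q c -> (p', q') != (p, q) ->
  bipart p' q' c = 0.
Proof.
case=> lc hc neq; apply/ffunP => I; rewrite ffunE [RHS]ffunE.
case: ifP => // /andP[/eqP <- /eqP <-] in neq *.
apply: contraNeq neq => nz.
by rewrite lc // hc // !eqxx.
Qed.

Lemma bidegree_deg p q c : bidegree p q c -> supported (fun=> 1%N) (p + q) c.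
Proof.
case=> lc hc I nz; rewrite -(lc I nz) -(hc I nz) -big_split.
by apply: eq_bigr => i _; rewrite /= /lo_wt /hi_wt; case: ltnP.
Qed.

Definition top c : C := c [set: 'I_m].

Lemma topD a b : top (a + b) = top a + top b.
Proof. by rewrite /top ffunE. Qed.
Lemma topN a : top (- a) = - top a.
Proof. by rewrite /top ffunE. Qed.
Lemma topZ z a : top (z *: a) = z * top a.
Proof. by rewrite /top ext_scaleE. Qed.
Lemma top0 : top 0 = 0.
Proof. by rewrite /top ffunE. Qed.
Lemma top_sum (T : Type) (s : seq T) (P : pred T) (f : T -> E) :
  top (\sum_(t <- s | P t) f t) = \sum_(t <- s | P t) top (f t).
Proof. by apply: (big_morph top); [exact: topD | exact: top0]. Qed.

Lemma lo_wt_total : (\sum_(i in [set: 'I_m]) @lo_wt N i)%N = N.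
Proof.
rewrite (eq_bigl predT) => [|i]; last by rewrite inE.
rewrite big_lohi /= (eq_bigr (fun=> 1%N)) => [|k _]; last exact: lo_wt_lo.
rewrite [X in (_ + X)%N]big1 => [|k _]; last exact: lo_wt_hi.
by rewrite sum1_card card_ord addn0.
Qed.

Lemma hi_wt_total : (\sum_(i in [set: 'I_m]) @hi_wt N i)%N = N.
Proof.
rewrite (eq_bigl predT) => [|i]; last by rewrite inE.
rewrite big_lohi /= [X in (_ + X)%N](eq_bigr (fun=> 1%N)) => [|k _]; last exact: hi_wt_hi.
rewrite big1 => [|k _]; last exact: hi_wt_lo.
by rewrite sum1_card card_ord.
Qed.

Lemma top_bidegree0 p q c : bidegree p q c -> (p, q) != (N, N) -> top c = 0.
Proof.
case=> lc hc; apply: contraNeq => nz.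
by rewrite -(lc _ nz) -(hc _ nz) lo_wt_total hi_wt_total.
Qed.

(** In a top-degree monomial the complement of bidegree [(p', q')] has bidegree [(N - p', N - q')].
    Inside a top coefficient this allows [d] to be replaced by [del] or [delbar]. *)
Lemma top_mul_bipart p q p' q' a b : (p + p' = N)%N -> (q + q' = N)%N ->
  bidegree p' q' b -> top (a * b) = top (bipart p q a * b).
Proof.
move=> pN qN [lb hb]; rewrite /top !ext_coefM; apply: eq_bigr => I _.
rewrite ffunE; case: ifP => // /negbT neq; rewrite mulr0 mul0r.
have -> : b ([set: 'I_m] :\: I) = 0; last by rewrite mulr0.
apply: contraNeq neq => nz.
have el := lo_wt_total; rewrite (big_setID I) /= (lb _ nz) setTI in el.
have eh := hi_wt_total; rewrite (big_setID I) /= (hb _ nz) setTI in eh.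
move: (etrans el (esym pN)) (etrans eh (esym qN)) => /addIn -> /addIn ->.
by rewrite !eqxx.
Qed.

Definition type_vec (t s : C) : 'rV[C]_m :=
  \row_i (if (i < N)%N then t else s).

Lemma ext_map_type_vec t s c :
  ext_map (diag_mx (type_vec t s)) c =
  \sum_(p < m.+1) \sum_(q < m.+1) (t ^+ p * s ^+ q) *: bipart p q c.
Proof.
have wt_ub (w : 'I_m -> nat) I : (forall i, w i <= 1)%N -> (\sum_(i in I) w i < m.+1)%N.
  move=> w1; rewrite ltnS; apply: leq_trans (_ : \sum_(i in I) 1 <= _)%N.
    by apply: leq_sum.
  by rewrite sum1_card; have := max_card (mem I); rewrite card_ord.
have lo1 (i : 'I_m) : (@lo_wt N i <= 1)%N by rewrite /lo_wt leq_b1.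
have hi1 (i : 'I_m) : (@hi_wt N i <= 1)%N by rewrite /hi_wt leq_b1.
apply/ffunP => I; rewrite ext_map_diag.
set l := (\sum_(i in I) lo_wt i)%N; set h := (\sum_(i in I) hi_wt i)%N.
have coefE p q : ((t ^+ p * s ^+ q) *: bipart p q c) I =
    if (l == p) && (h == q) then t ^+ p * s ^+ q * c I else 0.
  by rewrite ext_scaleE ffunE -/l -/h; case: ifP; rewrite ?mulr0.
transitivity (t ^+ l * s ^+ h * c I).
  congr (_ * _); rewrite /l /h.
  elim/big_rec3: _ => [|i x y z _ ->]; first by rewrite !expr0 mulr1.
  rewrite !exprD mxE /lo_wt /hi_wt; case: ltnP => _; rewrite ?expr1 ?expr0.
    by rewrite mul1r mulrA.
  by rewrite mul1r mulrCA.
rewrite sum_ffunE (bigD1 (Ordinal (wt_ub _ I lo1 : (l < _)%N))) //=.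
rewrite [X in _ + X]big1 ?addr0 => [|p nep]; last first.
  rewrite sum_ffunE big1 // => q _; rewrite coefE ifN //.
  by apply: contra nep => /andP[/eqP e _]; apply/eqP/val_inj.
rewrite sum_ffunE (bigD1 (Ordinal (wt_ub _ I hi1 : (h < _)%N))) //=.
rewrite [X in _ + X]big1 => [|q neq].
  rewrite addr0 coefE.
  by rewrite (eqxx l) (eqxx h).
rewrite coefE ifN //.
by apply: contra neq => /andP[_ /eqP e]; apply/eqP/val_inj.
Qed.

(** The hypothesis says that the rows of [T] are eigencovectors of the scaling by [t] and [s]. Both
    sides then have the same generating function, and its coefficients are compared. *)
Lemma pq_part_ext_map (J : 'M[R]_m) (T : 'M[C]_m) :
  (forall t s, T *m type_mx J t s = diag_mx (type_vec t s) *m T) ->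
  forall p q c, (p <= m)%N -> (q <= m)%N ->
  pq_part J p q (ext_map T c) = ext_map T (bipart p q c).
Proof.
move=> TJ p q c pm qm; apply/ffunP => K.
pose d (p q : 'I_m.+1) := pq_part J p q (ext_map T c) K - ext_map T (bipart p q c) K.
suff d0 : forall p q, d p q = 0.
  by have /eqP := d0 (Ordinal (pm : (p < m.+1)%N)) (Ordinal (qm : (q < m.+1)%N)); rewrite subr_eq0 => /eqP.
apply: poly2_eq0 => t s.
have : ext_map (type_mx J t s) (ext_map T c) K =
       ext_map T (ext_map (diag_mx (type_vec t s)) c) K.
  by rewrite !ext_map_comp TJ.
rewrite ext_map_type ext_map_type_vec ext_map_sum => /eqP.
rewrite -subr_eq0 => /eqP e0; rewrite -[RHS]e0 !sum_ffunE -sumrB; apply: eq_bigr => p' _.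
rewrite ext_map_sum !sum_ffunE -sumrB; apply: eq_bigr => q' _.
by rewrite ext_mapZ !ext_scaleE mulrBr.
Qed.

End Bigrading.

(** * Amenability of nilpotent groups *)

Lemma sumr_const_seq (R : nmodType) (T : Type) (s : seq T) (x : R) :
  \sum_(i <- s) x = x *+ size s.
Proof. by rewrite big_const_seq count_predT iter_addr_0. Qed.

Section Amenability.
Local Open Scope classical_set_scope.
Variables (R : realType) (m : nat) (G : lie_group R m).
Local Notation V := 'rV[R]_m.
Local Notation "x · y" := (gmul G x y) (at level 40, left associativity).
Local Notation e := (gone G).
Local Notation inv := (ginv G).

Lemma gmulKV x y : inv x · (x · y) = y.
Proof. by rewrite gmulA gmulV gmul1. Qed.

Lemma gmulrV x : x · inv x = e.
Proof.
rewrite -[LHS](gmulKV (inv x)) [inv x · _]gmulA gmulV gmul1.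
exact: gmulV.
Qed.

Lemma gmulr1 x : x · e = x.
Proof. by rewrite -(gmulV G x) gmulA gmulrV gmul1. Qed.

Lemma gmulK x y : x · y · inv y = x.
Proof. by rewrite -gmulA gmulrV gmulr1. Qed.

Lemma gmulVK x y : x · inv y · y = x.
Proof. by rewrite -gmulA gmulV gmulr1. Qed.

Lemma ginvK x : inv (inv x) = x.
Proof. by rewrite -[LHS]gmulr1 -(gmulV G x) gmulA gmulV gmul1. Qed.

Fixpoint gpow (h : V) (a : nat) : V := if a is a'.+1 then gpow h a' · h else e.

(** The distance between a measure and its translate is tested on functions bounded by 1.
    Translation is on the right, since the functions to be averaged are invariant under the lattice
    on the left. *)
Definition almost_invariant (hs : seq V) (eps : R) (S : seq V) : Prop :=
  forall W : V -> R, (forall x, `|W x| <= 1) -> forall h, h \in hs ->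
  `|\sum_(s <- S) (W (s · h) - W s)| <= eps * (size S)%:R.

(* Reiter's condition, with uniform probability measures on finite lists. *)
Definition amenable (H : set V) : Prop :=
  forall hs : seq V, (forall h, h \in hs -> H h) -> forall eps : R, 0 < eps ->
  exists2 S : seq V, (0 < size S)%N & almost_invariant hs eps S.

Lemma amenable1 : amenable [set e].
Proof.
move=> hs hs1 eps eps0; exists [:: e] => // W _ h /hs1 ->.
by rewrite big_seq1 gmulr1 subrr normr0 mulr1 ltW.
Qed.

(** [H] normalizes [K] and is abelian modulo [K]. A list almost invariant under enough elements of
    [K] is spread along the powers of a new element [h]: translation by [h] telescopes, and any
    other element crosses [gpow h a] at the price of a conjugate or commutator in [K]. *)
Lemma amenable_ext (H K : set V) : amenable K -> is_subgroup G H ->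
  (forall h k, H h -> K k -> K (h · k · inv h)) ->
  (forall g h, H g -> H h -> K (inv g · h · g · inv h)) ->
  amenable H.
Proof.
move=> amK [H1 HM HV] conjK commK hs Hhs.
(* The induction on [hs] carries an arbitrary finite part [E] of [K], because each added [h] asks
   for invariance under new elements of [K]. *)
suff am E : (forall k, k \in E -> K k) -> forall eps : R, 0 < eps ->
    exists2 S : seq V, (0 < size S)%N & almost_invariant (hs ++ E) eps S.
  by move=> eps eps0; have [//|S S0 invS] := am [::] _ eps eps0; exists S => // W W1 h hhs; apply: invS => //; rewrite cats0.
elim: hs Hhs E => [_ E EK eps|h hs IH Hhs E EK eps eps0]; first exact: amK.
have Hh : H h by apply: Hhs; rewrite mem_head.
have Hpow a : H (gpow h a) by elim: a => //= a IHa; apply: HM.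
have {}Hhs g : g \in hs -> H g by move=> ghs; apply: Hhs; rewrite inE ghs orbT.
(* A telescoping sum over [L] powers is bounded by 2, to be compared with [L] terms. *)
have [L L0 epsL] : exists2 L, (0 < L)%N & 2 <= eps * L%:R.
  exists (Num.truncn (2 / eps)).+1 => //.
  by rewrite mulrC -ler_pdivrMr // ltW // truncnS_gt.
(* [E1] and [E2] collect the corrections in [K] that arise when an element of [E], respectively of
   [hs], crosses [gpow h a]. *)
pose E1 := [seq gpow h a · k · inv (gpow h a) | k <- E, a <- iota 0 L].
pose E2 := [seq inv g · gpow h a · g · inv (gpow h a) | g <- hs, a <- iota 0 L].
have EK' k : k \in E1 ++ E2 -> K k.
  rewrite mem_cat => /orP[] /allpairsP[[x a] /= [xin _ ->]].
    exact: conjK (Hpow a) (EK _ xin).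
  exact: commK (Hhs _ xin) (Hpow a).
(* Halved because an element of [hs] is handled by two successive translations of [S'], by itself
   and by its correction. *)
have eps2 : 0 < eps / 2 by rewrite divr_gt0.
have [S' S'0 invS'] := IH Hhs _ EK' _ eps2.
exists [seq s · gpow h a | a <- iota 0 L, s <- S'].
  by rewrite size_allpairs size_iota muln_gt0 L0.
move=> W W1 g gin; rewrite size_allpairs size_iota big_allpairs_dep natrM.
have term_le a k : k \in hs ++ (E1 ++ E2) ->
    `|\sum_(s <- S') (W (s · k · gpow h a) - W (s · gpow h a))| <= eps / 2 * (size S')%:R.
  by move=> kin; apply: (invS' (fun z => W (z · gpow h a))).
move: gin; rewrite /= inE mem_cat => /or3P[/eqP -> | ghs | gE].
- rewrite exchange_big /=; apply: le_trans (ler_norm_sum _ _ _) _.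
  rewrite mulrA mulr_natr -sumr_const_seq.
  apply: ler_sum => s _; have -> : iota 0 L = index_iota 0 L by rewrite /index_iota subn0.
  under eq_bigr do rewrite -gmulA -/(gpow h _.+1).
  rewrite telescope_sumr //; apply: le_trans epsL.
  apply: le_trans (ler_normB _ _) _; rewrite -[2]/(1 + 1); exact: lerD.
- apply: le_trans (ler_norm_sum _ _ _) _.
  rewrite [leRHS](_ : _ = \sum_(a <- iota 0 L) eps * (size S')%:R); last first.
    by rewrite sumr_const_seq size_iota [LHS]mulrCA mulr_natl.
  rewrite big_seq [leRHS]big_seq; apply: ler_sum => a aL.
  pose k := inv g · gpow h a · g · inv (gpow h a).
  have kin : k \in hs ++ (E1 ++ E2).
    rewrite !mem_cat; apply/orP; right; apply/orP; right.
    by apply/allpairsP; exists (g, a).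
  have -> : \sum_(s <- S') (W (s · gpow h a · g) - W (s · gpow h a)) =
      \sum_(s <- S') (W (s · g · (k · gpow h a)) - W (s · (k · gpow h a))) +
      \sum_(s <- S') (W (s · k · gpow h a) - W (s · gpow h a)).
    rewrite -big_split; apply: eq_bigr => s _ /=.
    rewrite !gmulA subrKA; congr (W _ - _).
    by rewrite ?/k ?gmulA gmulVK gmulK.
  apply: le_trans (ler_normD _ _) _.
  rewrite [eps]splitr mulrDl lerD ?term_le //.
  apply: (invS' (fun z => W (z · (k · gpow h a)))) => //.
  by rewrite mem_cat ghs.
- apply: le_trans (ler_norm_sum _ _ _) _.
  rewrite [leRHS](_ : _ = \sum_(a <- iota 0 L) eps * (size S')%:R); last first.
    by rewrite sumr_const_seq size_iota [LHS]mulrCA mulr_natl.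
  rewrite big_seq [leRHS]big_seq; apply: ler_sum => a aL.
  pose k := gpow h a · g · inv (gpow h a).
  have kin : k \in hs ++ (E1 ++ E2).
    rewrite !mem_cat; apply/orP; right; apply/orP; left.
    by apply/allpairsP; exists (g, a).
  have -> : \sum_(s <- S') (W (s · gpow h a · g) - W (s · gpow h a)) =
      \sum_(s <- S') (W (s · k · gpow h a) - W (s · gpow h a)).
    by apply: eq_bigr => s _; rewrite /k !gmulA gmulVK.
  apply: le_trans (term_le _ _ kin) _.
  by rewrite ler_wpM2r ?ler0n //; lra.
Qed.

Lemma generated_subgroup A : is_subgroup G (generated G A).
Proof.
split=> [H [H1 _ _] _ //|x y gx gy H sH AH|x gx H sH AH].
  by have [_ HM _] := sH; apply: HM; [apply: gx | apply: gy].
by have [_ _ HV] := sH; apply: HV; apply: gx.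
Qed.

Lemma lower_central_subgroup k : is_subgroup G (lower_central G k).
Proof. by case: k => [|k]; [split | apply: generated_subgroup]. Qed.

Lemma commutator_lower_central k x y : lower_central G k x ->
  lower_central G k.+1 (commutator G x y).
Proof. by move=> kx H _; apply; exists x, y. Qed.

Lemma lower_central_decr k : lower_central G k.+1 `<=` lower_central G k.
Proof.
elim: k => [//|k IHk] z kz H sH AH; apply: kz => // _ [x [y [kx ->]]].
by apply: AH; exists x, y; split=> //; apply: IHk.
Qed.

(** Climb the lower central series from its trivial end: each term is abelian modulo the next
    one. *)
Lemma nilpotent_amenable : nilpotent_group G -> amenable classical_sets.setT.
Proof.
case=> K lcK; have : amenable (lower_central G K) by rewrite lcK; apply: amenable1.
elim: K {lcK} => // K IHK amK; apply: IHK; apply: amenable_ext amK _ _ _.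
- exact: lower_central_subgroup.
- move=> h k _ Kk.
  have -> : h · k · inv h = k · commutator G k (inv h).
    by rewrite /commutator ginvK !gmulA gmulrV gmul1.
  have [_ HM _] := lower_central_subgroup K.+1; apply: HM => //.
  by apply: commutator_lower_central; apply: lower_central_decr.
- move=> g h Kg _; have := commutator_lower_central (inv h) Kg.
  by rewrite /commutator ginvK !gmulA.
Qed.

(** Averaging over an almost invariant list makes the right-hand side arbitrarily small, while it
    would have to stay above [c]. *)
Lemma amenable_no_coboundary (n : nat) (g : 'I_n -> V) (W : 'I_n -> V -> R) (B c : R) :
  amenable classical_sets.setT -> (forall l x, `|W l x| <= B) -> 0 < c ->
  ~ forall x, c <= \sum_l (W l (x · g l) - W l x).
Proof.
move=> amT WB c0 cW.
pose B1 := `|B| + 1.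
have B10 : 0 < B1 by rewrite ltr_wpDl.
have W1 l x : `|W l x / B1| <= 1.
  rewrite normrM normfV (gtr0_norm B10) ler_pdivrMr // mul1r.
  by apply: le_trans (WB l x) _; rewrite ler_wpDr // ler_norm.
(* With this choice the [n] errors add up to the fraction [n / n.+1] of [c], strictly below [c] even
   for [n = 0]. *)
pose eps := c / (B1 * n.+1%:R).
have eps0 : 0 < eps by rewrite divr_gt0 // mulr_gt0 // ltr0n.
have [S S0 invS] := amT [seq g l | l <- enum 'I_n] (fun _ _ => I) eps eps0.
have : c * (size S)%:R <= \sum_(s <- S) \sum_l (W l (s · g l) - W l s).
  by rewrite mulr_natr -sumr_const_seq; apply: ler_sum.
rewrite exchange_big /= leNgt => /negP; apply.
apply: le_lt_trans (ler_norm _) _; apply: le_lt_trans (ler_norm_sum _ _ _) _.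
apply: le_lt_trans (_ : \sum_(l < n) B1 * (eps * (size S)%:R) < _).
  apply: ler_sum => l _.
  have /= := invS (fun x => W l x / B1) (W1 l) (g l) (map_f _ (mem_enum _ l)).
  under eq_bigr do rewrite -mulrBl.
  rewrite -mulr_suml normrM normfV (gtr0_norm B10) ler_pdivrMr //.
  by rewrite [B1 * _]mulrC.
have -> : \sum_(l < n) B1 * (eps * (size S)%:R) =
    c * (size S)%:R * (n%:R / n.+1%:R).
  rewrite sumr_const card_ord -[LHS]mulr_natr /eps; field.
  by rewrite addrC -mulrSr pnatr_eq0 (gt_eqF B10).
rewrite gtr_pMr ?mulr_gt0 ?ltr0n //.
by rewrite ltr_pdivrMr ?ltr0n // mul1r ltr_nat.
Qed.

End Amenability.

(** * Left-invariant derivatives and divergences *)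

Section SmoothFunctions.
Local Open Scope classical_set_scope.
Variables (R : realType) (m : nat).
Local Notation V := 'rV[R]_m.
Implicit Types (f g : V -> R) (i : 'I_m).

Lemma Ck_continuous k f : Ck k f -> continuous f.
Proof. by case: k => [|k] // []. Qed.

Lemma CkW k f : Ck k.+1 f -> Ck k f.
Proof.
elim: k f => [|k IHk] f; first exact: Ck_continuous.
move=> [cf df]; split=> // i; have [dfi Cfi] := df i; split=> //.
exact: IHk.
Qed.

Lemma Ck_cst k (c : R) : Ck k (fun _ : V => c).
Proof.
elim: k c => [|k IHk] c; first exact: cst_continuous.
split=> [|i]; first exact: cst_continuous.
split=> [x|]; first exact: derivable_cst.
have -> : pderiv (fun=> c) i = fun=> 0 by apply/funext => x; apply: derive_cst.
exact: IHk.
Qed.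

Lemma CkD k f g : Ck k f -> Ck k g -> Ck k (fun x => f x + g x).
Proof.
elim: k f g => [|k IHk] f g; first by move=> cf cg x; apply: continuousD; [exact: cf|exact: cg].
move=> [cf df] [cg dg]; split=> [x|i]; first by apply: continuousD; [exact: cf|exact: cg].
have [dfi Cfi] := df i; have [dgi Cgi] := dg i.
split=> [x|]; first exact: derivableD.
have -> : pderiv (fun x => f x + g x) i = fun x => pderiv f i x + pderiv g i x.
  by apply/funext => x; apply: deriveD.
exact: IHk.
Qed.

Lemma CkM k f g : Ck k f -> Ck k g -> Ck k (fun x => f x * g x).
Proof.
elim: k f g => [|k IHk] f g; first by move=> cf cg x; apply: continuousM; [exact: cf|exact: cg].
move=> Cf Cg; move: (Cf) (Cg) => [cf df] [cg dg].
split=> [x|i]; first by apply: continuousM; [exact: cf|exact: cg].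
have [dfi Cfi] := df i; have [dgi Cgi] := dg i.
split=> [x|]; first exact: derivableM.
have -> : pderiv (fun x => f x * g x) i =
    fun x => f x * pderiv g i x + g x * pderiv f i x.
  by apply/funext => x; rewrite /pderiv deriveM.
by apply: CkD; apply: IHk => //; apply: CkW.
Qed.

Lemma smooth_cst (c : R) : smooth (fun _ : V => c).
Proof. by move=> k; apply: Ck_cst. Qed.

Lemma smoothD f g : smooth f -> smooth g -> smooth (fun x => f x + g x).
Proof. by move=> sf sg k; apply: CkD. Qed.

Lemma smoothM f g : smooth f -> smooth g -> smooth (fun x => f x * g x).
Proof. by move=> sf sg k; apply: CkM. Qed.

Lemma smoothN f : smooth f -> smooth (fun x => - f x).
Proof.
move=> sf; have -> : (fun x => - f x) = (fun x => -1 * f x).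
  by apply/funext => x; rewrite mulN1r.
by apply: smoothM => //; apply: smooth_cst.
Qed.

Lemma smooth_pderiv f i : smooth f -> smooth (pderiv f i).
Proof. by move=> sf k; have [_ /(_ i)[]] := sf k.+1. Qed.

Lemma smooth_derivable f i x : smooth f -> derivable f x (delta_mx 0 i).
Proof. by move=> sf; have [_ /(_ i)[]] := sf 1%N. Qed.

Lemma smooth_continuous f : smooth f -> continuous f.
Proof. by move=> /(_ 0%N). Qed.

End SmoothFunctions.

(** * A chain rule from continuous partial derivatives *)

Section ChainRule.
Local Open Scope classical_set_scope.
Variables (R : realType) (m : nat).
Local Notation V := 'rV[R]_m.
Implicit Types (f : V -> R).

Lemma rV_cvg (T : Type) (F : set_system T) (c : T -> V) (a : V) : Filter F ->
  (forall j, (fun t => c t 0 j) @ F --> a 0 j) -> c @ F --> a.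
Proof.
move=> FF cj; apply/cvg_ballP => e e0.
have : \forall t \near F, forall j, ball (a 0 j) e (c t 0 j).
  by apply: filter_forall => j; have /cvg_ballP := cj j; apply.
by apply: filterS => t Ht; split=> // k j; rewrite (ord1 k).
Qed.

Lemma is_derive_line f (x v : V) (s : R) : derivable f (x + s *: v) v ->
  is_derive s 1 (fun t : R => f (x + t *: v)) ('D_v f (x + s *: v)).
Proof.
move=> df.
have eqf : (fun h : R => h^-1 *: (f (x + (h *: 1 + s) *: v) - f (x + s *: v))) =
    (fun h : R => h^-1 *: (f (h *: v + (x + s *: v)) - f (x + s *: v))).
  apply/funext => h; congr (_ *: (f _ - _)).
  by rewrite [h *: 1]mulr1 scalerDl addrCA.
by apply: DeriveDef; [rewrite /derivable eqf | rewrite /derive eqf].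
Qed.

Lemma mean_value0 (g dg : R -> R) (d : R) :
  (forall s : R, is_derive s 1 g (dg s)) ->
  exists2 s, `|s| <= `|d| & g d - g 0 = dg s * d.
Proof.
move=> Dg.
have cg a b : {within `[a, b], continuous g}.
  apply: continuous_subspaceT => x; apply: differentiable_continuous.
  by apply/derivable1_diffP; have [] := Dg x.
have [d0|d0|->] := ltgtP d 0; last by exists 0; rewrite ?mulr0 ?subrr.
- have [s] := MVT d0 (fun x _ => Dg x) (cg _ _).
  rewrite in_itv /= => /andP[ds s0] e; exists s.
    by rewrite !ltr0_norm // lerN2 ltW.
  by rewrite -opprB e sub0r mulrN opprK.
- have [s] := MVT d0 (fun x _ => Dg x) (cg _ _).
  rewrite in_itv /= => /andP[ds s0] e; exists s.
    by rewrite !gtr0_norm // ltW.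
  by rewrite e subr0.
Qed.

(** Move from [p] to [y] one coordinate at a time, along the points [mix k], and apply the
    one-variable mean value theorem to each move. *)
Lemma mean_value_coord f (p y : V) :
  (forall i x, derivable f x (delta_mx 0 i)) ->
  exists2 xi : 'I_m -> V,
    (forall i j, `|xi i 0 j - p 0 j| <= `|y 0 j - p 0 j|) &
    f y - f p = \sum_i pderiv f i (xi i) * (y 0 i - p 0 i).
Proof.
move=> df.
pose mix k : V := \row_j (if (j < k)%N then y 0 j else p 0 j).
have mixS (i : 'I_m) : mix i.+1 = mix i + (y 0 i - p 0 i) *: delta_mx 0 i.
  apply/rowP => j; rewrite !mxE /= ltnS; have [->|neji] := eqVneq j i.
    by rewrite leqnn ltnn mulr1 addrCA subrr addr0.
  by rewrite mulr0 addr0 leq_eqVlt (inj_eq val_inj) (negPf neji).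
have stepP (i : 'I_m) : exists s : R, `|s| <= `|y 0 i - p 0 i| /\
    f (mix i.+1) - f (mix i) =
    pderiv f i (mix i + s *: delta_mx 0 i) * (y 0 i - p 0 i).
  have [s|s sle e] := @mean_value0 (fun t => f (mix i + t *: delta_mx 0 i))
     (fun t => pderiv f i (mix i + t *: delta_mx 0 i)) (y 0 i - p 0 i).
    by apply: is_derive_line.
  by exists s; split=> //; rewrite mixS -e scale0r addr0.
have [s sP] := boolp.choice stepP.
exists (fun i : 'I_m => mix i + s i *: delta_mx 0 i) => [i j|].
  rewrite !mxE /=; have [->|neji] := eqVneq j i.
    by rewrite ltnn mulr1 addrAC subrr add0r; case: (sP i).
  by rewrite mulr0 addr0; case: ifP => _ //; rewrite subrr normr0.
transitivity (\sum_(i < m) (f (mix i.+1) - f (mix i))); last first.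
  by apply: eq_bigr => i _; case: (sP i).
rewrite -(big_mkord predT (fun k => f (mix k.+1) - f (mix k))) telescope_sumr //.
congr (f _ - f _); apply/rowP => j; rewrite !mxE //.
by rewrite ltn_ord.
Qed.

(** [Ck] speaks of partial derivatives only, so the increment of [f] is split by coordinates; the
    intermediate points tend to [c t0], where the partial derivatives are continuous. *)
Lemma C1_chain_rule f (c : R -> V) (dc : V) (t0 : R) : Ck 1 f ->
  (forall j, is_derive t0 1 (fun t => c t 0 j) (dc 0 j)) ->
  is_derive t0 1 (fun t => f (c t)) (\sum_j pderiv f j (c t0) * dc 0 j).
Proof.
move=> [cf df] Dc.
have dfi i x : derivable f x (delta_mx 0 i) by have [] := df i.
have cdf i : continuous (pderiv f i) by have [_] := df i; apply.
have [xi xiP] := boolp.choice (fun h : R =>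
  let: ex_intro2 xi H1 H2 := mean_value_coord (c t0) (c (h + t0)) dfi in
  ex_intro (fun xi : 'I_m -> V => (forall i j, `|xi i 0 j - c t0 0 j| <= `|c (h + t0) 0 j - c t0 0 j|) /\
     f (c (h + t0)) - f (c t0) = \sum_i pderiv f i (xi i) * (c (h + t0) 0 i - c t0 0 i)) xi (conj H1 H2)).
have quot j : (fun h : R => h^-1 *: (c (h *: 1 + t0) 0 j - c t0 0 j)) @ 0^' --> dc 0 j.
  have [dj <-] := Dc j; exact: dj.
have ccont j : (fun h => c (h + t0) 0 j) @ 0^' --> c t0 0 j.
  have : {for t0, continuous (fun t => c t 0 j)}.
    by apply: differentiable_continuous; apply/derivable1_diffP; have [] := Dc j.
  rewrite continuous_shift => H.
  have {}H : (fun h => c (h + t0) 0 j) @ (0 : R) --> c t0 0 j.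
    by have := H; rewrite /prop_for /continuous_at /= add0r.
  by apply: cvg_trans H; apply: cvg_app; apply: cvg_within.
have xicvg i : (fun h => xi h i) @ 0^' --> c t0.
  apply/cvg_ballP => e e0.
  have : \forall h \near 0^', forall j, ball (c t0 0 j) e (c (h + t0) 0 j).
    apply: filter_forall => j; have /cvg_ballP := ccont j; apply.
    exact: e0.
  apply: filterS => h Hh; split=> // k j; rewrite (ord1 k).
  have := Hh j; rewrite /ball /= => Hj; rewrite distrC.
  by apply: le_lt_trans ((xiP h).1 i j) _; rewrite distrC.
have lim : (fun h : R => h^-1 *: (f (c (h *: 1 + t0)) - f (c t0))) @ 0^' -->
    \sum_j pderiv f j (c t0) * dc 0 j.
  have -> : (fun h : R => h^-1 *: (f (c (h *: 1 + t0)) - f (c t0))) =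
      (fun h => \sum_j pderiv f j (xi h j) * (h^-1 *: (c (h *: 1 + t0) 0 j - c t0 0 j))).
    apply/funext => h; rewrite [h *: 1]mulr1 (xiP h).2 scaler_sumr.
    by apply: eq_bigr => j _; rewrite /GRing.scale /= mulrCA.
  apply: (cvg_big (op := +%R)) => [|j _]; first exact: add_continuous.
  apply: cvgM => //.
  by apply: continuous_cvg; [exact: cdf | exact: xicvg].
apply: DeriveDef; first by apply/cvg_ex; exists (\sum_j pderiv f j (c t0) * dc 0 j).
exact: cvg_lim lim.
Qed.

End ChainRule.

(** * Divergences of lattice-invariant functions *)

Section Divergence.
Local Open Scope classical_set_scope.
Variables (R : realType) (m : nat) (G : lie_group R m).
Local Notation V := 'rV[R]_m.
Implicit Types (f : V -> R) (x y : V) (l j : 'I_m).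

Definition mulcoord j (z : 'rV[R]_(m + m)) : R :=
  gmul G (lsubmx z) (rsubmx z) 0 j.

Lemma row_mx_line x y (t : R) l :
  row_mx x y + t *: delta_mx 0 (rshift m l) = row_mx x (y + t *: delta_mx 0 l).
Proof.
apply/rowP => k; rewrite !mxE; case: splitP => j ek; rewrite ?mxE.
  have -> : (k == rshift m l) = false.
    by apply/eqP => e; have := ltn_ord j; rewrite -ek e /= ltnNge leq_addr.
  by rewrite andbF mulr0 addr0.
congr (_ + _ * (_ && _)%:R); apply/eqP/eqP => [e|ejl].
  by apply/val_inj/(@addnI m); rewrite -ek e.
by apply/val_inj; rewrite /= ek ejl.
Qed.

(** A left translate of a coordinate line through the identity. It is explicit, unlike a
    one-parameter subgroup, and its point at time [t] is still [x] times an element independent of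
    [x], as the averaging requires. *)
Definition left_curve l x (t : R) : V := gmul G x (gone G + t *: delta_mx 0 l).

(* The derivative of [f] along the curve [left_curve l x]; at [t = 0] it is the
   left-invariant vector field with value [e_l] at the identity. *)
Definition curve_deriv l f x (t : R) : R :=
  \sum_j pderiv f j (left_curve l x t) *
          pderiv (mulcoord j) (rshift m l) (row_mx x (gone G + t *: delta_mx 0 l)).

Definition left_deriv l f x : R := curve_deriv l f x 0.

Lemma left_curve0 l x : left_curve l x 0 = x.
Proof. by rewrite /left_curve scale0r addr0 gmulr1. Qed.

Lemma is_derive_left_curve l f x (t : R) : smooth f ->
  is_derive t 1 (fun s => f (left_curve l x s)) (curve_deriv l f x t).
Proof.
move=> sf; pose dc : V := \row_j pderiv (mulcoord j) (rshift m l)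
  (row_mx x (gone G + t *: delta_mx 0 l)).
have -> : curve_deriv l f x t = \sum_j pderiv f j (left_curve l x t) * dc 0 j.
  by apply: eq_bigr => j _; rewrite mxE.
apply: C1_chain_rule => [|j]; first exact: sf.
rewrite mxE.
have -> : (fun s => left_curve l x s 0 j) =
    (fun s : R => mulcoord j (row_mx x (gone G) + s *: delta_mx 0 (rshift m l))).
  by apply/funext => s; rewrite row_mx_line /mulcoord row_mxKl row_mxKr.
rewrite -row_mx_line; apply: is_derive_line.
exact/smooth_derivable/gmul_smooth.
Qed.

Lemma left_deriv_invariant l f g x : smooth f ->
  (forall y, f (gmul G g y) = f y) ->
  left_deriv l f (gmul G g x) = left_deriv l f x.
Proof.
move=> sf inv; rewrite /left_deriv.
have [_ <-] := is_derive_left_curve l (gmul G g x) 0 sf.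
have [_ <-] := is_derive_left_curve l x 0 sf.
congr (derive _ _ _); apply/funext => s.
by rewrite /left_curve -gmulA inv.
Qed.

(** Joint continuity makes the lower bound for the difference quotients uniform near a point and for
    small [t]. *)
Lemma curve_deriv_continuous l f : smooth f ->
  continuous (fun p : V * R => curve_deriv l f p.1 p.2).
Proof.
move=> sf.
have crow : continuous (fun p : V * R => row_mx p.1 (gone G + p.2 *: delta_mx 0 l)).
  move=> p; apply: rV_cvg => k; rewrite /=.
  case: (split_ordP k) => j ->.
    under eq_cvg do rewrite row_mxEl; rewrite row_mxEl.
    apply: (@cvg_comp _ _ _ fst (fun y : V => y 0 j)); first exact: cvg_fst.
    exact: coord_continuous.
  under eq_cvg do rewrite row_mxEr mxE [X in _ + X]mxE.
  rewrite row_mxEr mxE [X in _ + X]mxE.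
  apply: cvgD; first exact: cvg_cst.
  by apply: cvgM; [exact: cvg_snd | exact: cvg_cst].
have ccurve : continuous (fun p : V * R => left_curve l p.1 p.2).
  move=> p; apply: rV_cvg => j.
  have -> : (fun q : V * R => left_curve l q.1 q.2 0 j) =
     mulcoord j \o (fun q : V * R => row_mx q.1 (gone G + q.2 *: delta_mx 0 l)).
    by apply/funext => q; rewrite /= /mulcoord row_mxKl row_mxKr.
  have -> : left_curve l p.1 p.2 0 j =
     mulcoord j (row_mx p.1 (gone G + p.2 *: delta_mx 0 l)).
    by rewrite /mulcoord row_mxKl row_mxKr.
  apply: continuous_comp; first exact: crow.
  exact/smooth_continuous/gmul_smooth.
move=> p; apply: (cvg_big (op := +%R)) => [|j _]; first exact: add_continuous.
apply: cvgM.
  apply: (@continuous_comp _ _ _ (fun q : V * R => left_curve l q.1 q.2) (pderiv f j) p); first exact: ccurve.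
  exact/smooth_continuous/smooth_pderiv.
apply: (@continuous_comp _ _ _
  (fun q : V * R => row_mx q.1 (gone G + q.2 *: delta_mx 0 l)) (pderiv (mulcoord j) (rshift m l)) p); first exact: crow.
exact/smooth_continuous/smooth_pderiv/gmul_smooth.
Qed.

Lemma left_curve_mean_value l f x (t : R) : smooth f -> exists2 s : R, `|s| <= `|t| &
  f (left_curve l x t) - f x = curve_deriv l f x s * t.
Proof.
move=> sf; have [s sle e] := mean_value0 t (fun s => is_derive_left_curve l x s sf).
by exists s => //; rewrite -e left_curve0.
Qed.

Theorem no_positive_divergence (Gamma : set V) (W : 'I_m -> V -> R) :
  nilpotent_group G -> lattice G Gamma ->
  (forall l, smooth (W l)) ->
  (forall l g x, Gamma g -> W l (gmul G g x) = W l x) ->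
  ~ forall x, 0 < \sum_l left_deriv l (W l) x.
Proof.
move=> nilG [_ _ [K cK covK]] sW invW pos.
have cover_near x : K x -> \forall x' \near x & t \near (0 : R)^'+,
    0 < \sum_l (W l (left_curve l x' t) - W l x').
  move=> _; set D := \sum_l left_deriv l (W l) x.
  (* An error [eps] in each of the [m] derivatives costs strictly less than [D]. *)
  pose eps := D / m.+1%:R.
  have eps0 : 0 < eps by rewrite divr_gt0 // ?pos // ltr0n.
  have : \forall p \near (x, 0 : R), forall l,
      ball (left_deriv l (W l) x) eps (curve_deriv l (W l) p.1 p.2).
    apply: (@filter_forall _ _ (fun l => [set p : V * R | ball (left_deriv l (W l) x) eps
      (curve_deriv l (W l) p.1 p.2)]) (nbhs ((x, 0) : V * R))) => l.
    by have /cvg_ballP := @curve_deriv_continuous l _ (sW l) (x, 0); apply.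
  case=> -[U I] /= [Ux /nbhs_ballP[d /= d0 dI]] sub.
  exists (U, [set t : R | 0 < t < d]) => /=.
    split=> //; near=> t; apply/andP; split; last by [].
    by near: t; apply: nbhs_right_gt.
  move=> [y t] /= [Uy /andP[t0 td]].
  have lower l : t * (left_deriv l (W l) x - eps) <= W l (left_curve l y t) - W l y.
    have [s sle ->] := left_curve_mean_value l y t (sW l).
    rewrite mulrC ler_pM2r // lerBlDl -lerBlDr.
    have Is : I s.
      by apply: dI; rewrite /ball /= sub0r normrN (le_lt_trans sle) // gtr0_norm.
    have := sub (y, s) (conj Uy Is) l; rewrite /ball /= => /ltW.
    by apply: le_trans; rewrite ler_norm.
  apply: lt_le_trans (ler_sum _ (fun l _ => lower l)).
  rewrite -mulr_sumr pmulr_rgt0 // big_split /= -/D sumr_const card_ord.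
  rewrite mulNrn -[_ *+ m]mulr_natr subr_gt0 /eps mulrAC ltr_pdivrMr ?ltr0n //.
  by rewrite ltr_pM2l ?pos // ltr_nat.
(* Compactness of [K] turns the local statements into one time [t] that serves at every point of
   [K]. *)
have /compact_near_coveringP cK' := cK.
have near_t : \forall t \near (0 : R)^'+, K `<=`
    (fun x => 0 < \sum_l (W l (left_curve l x t) - W l x)).
  exact: (cK' _ _ (fun t x => 0 < \sum_l (W l (left_curve l x t) - W l x))).
have [t tpos] := @filter_ex _ _ (at_right_proper_filter (0 : R)) _ near_t.
pose g l := gone G + t *: delta_mx 0 l.
pose h x := \sum_l (W l (gmul G x (g l)) - W l x).
have K0 : K !=set0 by have [_ [k [_ Kk _]]] := covK (gone G); exists k.
have cWg l : continuous (fun x => W l (gmul G x (g l))).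
  move=> x; apply: (@continuous_comp _ _ _ (fun y => gmul G y (g l)) (W l) x).
    apply: (@rV_cvg _ _ _ _ _ _ (nbhs_filter x)) => j.
    have -> : (fun y => gmul G y (g l) 0 j) = mulcoord j \o (fun y => row_mx y (g l)).
      by apply/funext => y; rewrite /= /mulcoord row_mxKl row_mxKr.
    have -> : gmul G x (g l) 0 j = mulcoord j (row_mx x (g l)).
      by rewrite /mulcoord row_mxKl row_mxKr.
    apply: continuous_comp; last exact/smooth_continuous/gmul_smooth.
    apply: (@rV_cvg _ _ _ _ _ _ (nbhs_filter x)) => k; case: (split_ordP k) => i ->.
      under eq_cvg do rewrite row_mxEl; rewrite row_mxEl; exact: coord_continuous.
    under eq_cvg do rewrite row_mxEr; rewrite row_mxEr; exact: cst_continuous.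
  exact: smooth_continuous.
have ch : continuous h.
  apply: (continuous_big (op := +%R)) => [|l _ x]; first exact: add_continuous.
  by apply: continuousB; [exact: cWg | exact: smooth_continuous].
have [k0 Kk0 minh] := compact_EVT_min K0 cK (continuous_subspaceT ch).
have c0 : 0 < h k0 by apply: tpos; apply: set_mem.
pose B x := \sum_l `|W l x|.
have cB : continuous B.
  apply: (continuous_big (op := +%R)) => [|l _ x]; first exact: add_continuous.
  by apply: (@continuous_comp _ _ _ (W l) (fun r : R => `|r|) x); [exact: smooth_continuous | exact: norm_continuous].
have [k1 Kk1 maxB] := compact_EVT_max K0 cK (continuous_subspaceT cB).
apply: (amenable_no_coboundary (g := g) (W := W) (B := B k1) (nilpotent_amenable nilG) _ c0).
  move=> l x; have [a [k [Ga Kk ->]]] := covK x; rewrite invW //.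
  apply: le_trans (maxB k (mem_set Kk)); rewrite /B (bigD1 l) //= lerDl.
  by apply: sumr_ge0.
(* Left multiplication by a lattice element commutes with right translation, so the bound passes
   from [K] to the whole group. *)
move=> x; have [a [k [Ga Kk ->]]] := covK x.
apply: le_trans (minh k (mem_set Kk)) _; rewrite /h.
by apply: ler_sum => l _; rewrite -gmulA (invW _ a _ Ga) (invW _ a k Ga).
Unshelve. all: by end_near.
Qed.

End Divergence.

(** * Calculus of differential forms *)

Section ComplexSmooth.
Variables (R : realType) (m : nat).
Local Notation C := R[i].
Local Notation V := 'rV[R]_m.
Implicit Types (f g : V -> C) (i : 'I_m).

Lemma cRe_M (x y : C) :
  complex.Re (x * y) = complex.Re x * complex.Re y - complex.Im x * complex.Im y.
Proof. by case: x => a b; case: y. Qed.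
Lemma cIm_M (x y : C) :
  complex.Im (x * y) = complex.Re x * complex.Im y + complex.Im x * complex.Re y.
Proof. by case: x => a b; case: y. Qed.
Lemma cRe_D (x y : C) : complex.Re (x + y) = complex.Re x + complex.Re y.
Proof. by case: x => a b; case: y. Qed.
Lemma cIm_D (x y : C) : complex.Im (x + y) = complex.Im x + complex.Im y.
Proof. by case: x => a b; case: y. Qed.
Lemma cRe_sum (I : Type) (r : seq I) (P : pred I) (F : I -> C) :
  complex.Re (\sum_(k <- r | P k) F k) = \sum_(k <- r | P k) complex.Re (F k).
Proof. by apply: (big_morph (@complex.Re R)) => // x y; rewrite cRe_D. Qed.

Lemma smooth_ext (f g : V -> R) : f =1 g -> smooth g -> smooth f.
Proof. by move=> /funext ->. Qed.
Lemma csmooth_ext f g : f =1 g -> csmooth g -> csmooth f.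
Proof. by move=> /funext ->. Qed.

Lemma csmooth_cst (c : C) : csmooth (fun _ : V => c).
Proof. by split; apply: smooth_cst. Qed.

Lemma csmoothD f g : csmooth f -> csmooth g -> csmooth (fun x => f x + g x).
Proof.
case=> rf jf [rg jg]; split.
  by exact: (smooth_ext (fun x => cRe_D _ _)) (smoothD _ _).
by exact: (smooth_ext (fun x => cIm_D _ _)) (smoothD _ _).
Qed.

Lemma csmoothM f g : csmooth f -> csmooth g -> csmooth (fun x => f x * g x).
Proof.
case=> rf jf [rg jg]; split.
  apply: (smooth_ext (fun x => cRe_M _ _)).
  by apply: smoothD; [|apply: smoothN]; apply: smoothM.
apply: (smooth_ext (fun x => cIm_M _ _)).
by apply: smoothD; apply: smoothM.
Qed.

Lemma csmooth_sum (I : Type) (r : seq I) (P : pred I) (F : I -> V -> C) :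
  (forall k, P k -> csmooth (F k)) -> csmooth (fun x => \sum_(k <- r | P k) F k x).
Proof.
move=> sF; elim: r => [|k r IHr].
  by apply: (csmooth_ext (fun x => @big_nil _ _ _ _ _ _)); apply: csmooth_cst.
case Pk: (P k).
  apply: (@csmooth_ext _ (fun x => F k x + \sum_(j <- r | P j) F j x)) => [x|].
    by rewrite big_cons Pk.
  by apply: csmoothD; [apply: sF | exact: IHr].
by apply: csmooth_ext IHr => x; rewrite big_cons Pk.
Qed.

Lemma csmooth_conj f : csmooth f -> csmooth (fun x => conjc (f x)).
Proof.
case=> rf jf; split.
  by have -> : (fun x => complex.Re (conjc (f x))) = (fun x => complex.Re (f x))
    by apply/funext => x; case: (f x).
have -> : (fun x => complex.Im (conjc (f x))) = (fun x => - complex.Im (f x)).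
  by apply/funext => x; case: (f x).
exact: smoothN.
Qed.

Lemma csmooth_cpderiv f i : csmooth f -> csmooth (cpderiv f i).
Proof. by case=> rf jf; split; apply: smooth_pderiv. Qed.

Lemma csmooth_real (f : V -> R) : smooth f -> csmooth (fun x => (f x)%:C).
Proof. by move=> sf; split=> //=; apply: smooth_cst. Qed.

Lemma eq_cpderiv f g i x : f =1 g -> cpderiv f i x = cpderiv g i x.
Proof. by move=> /funext ->. Qed.

Lemma cpderiv_cst (c : C) i x : cpderiv (fun=> c) i x = 0.
Proof. by rewrite /cpderiv /pderiv !derive_cst. Qed.

Lemma cpderivD f g i x : csmooth f -> csmooth g ->
  cpderiv (fun y => f y + g y) i x = cpderiv f i x + cpderiv g i x.
Proof.
case=> rf jf [rg jg]; rewrite /cpderiv /pderiv.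
rewrite (funext (fun y => cRe_D (f y) (g y))) (funext (fun y => cIm_D (f y) (g y))).
by rewrite !deriveD; try exact: smooth_derivable.
Qed.

Lemma pderivM (u s : V -> R) i x : smooth u -> smooth s ->
  pderiv (fun y => u y * s y) i x = u x * pderiv s i x + s x * pderiv u i x.
Proof.
move=> /(@smooth_derivable _ _ _ i x) du /(@smooth_derivable _ _ _ i x) ds.
by rewrite /pderiv deriveM.
Qed.

Lemma pderivMD (u s v t : V -> R) i x :
  smooth u -> smooth s -> smooth v -> smooth t ->
  pderiv (fun y => u y * s y + v y * t y) i x =
  (u x * pderiv s i x + s x * pderiv u i x) + (v x * pderiv t i x + t x * pderiv v i x).
Proof.
move=> su ss sv st; rewrite -(pderivM i x su ss) -(pderivM i x sv st).
have du := @smooth_derivable _ _ _ i x su; have ds := @smooth_derivable _ _ _ i x ss.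
have dv := @smooth_derivable _ _ _ i x sv; have dt := @smooth_derivable _ _ _ i x st.
exact: (deriveD (derivableM du ds) (derivableM dv dt)).
Qed.

Lemma pderivMB (u s v t : V -> R) i x :
  smooth u -> smooth s -> smooth v -> smooth t ->
  pderiv (fun y => u y * s y - v y * t y) i x =
  (u x * pderiv s i x + s x * pderiv u i x) - (v x * pderiv t i x + t x * pderiv v i x).
Proof.
move=> su ss sv st; rewrite -(pderivM i x su ss) -(pderivM i x sv st).
have du := @smooth_derivable _ _ _ i x su; have ds := @smooth_derivable _ _ _ i x ss.
have dv := @smooth_derivable _ _ _ i x sv; have dt := @smooth_derivable _ _ _ i x st.
exact: (deriveB (derivableM du ds) (derivableM dv dt)).
Qed.

Lemma cpderivM f g i x : csmooth f -> csmooth g ->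
  cpderiv (fun y => f y * g y) i x = cpderiv f i x * g x + f x * cpderiv g i x.
Proof.
case=> rf jf [rg jg]; rewrite /cpderiv.
rewrite (funext (fun y => cRe_M (f y) (g y))) (funext (fun y => cIm_M (f y) (g y))).
rewrite (pderivMB i x rf rg jf jg) (pderivMD i x rf jg jf rg).
move: (pderiv _ i x) (pderiv _ i x) (pderiv _ i x) (pderiv _ i x) => a b c d.
case: (f x) => u v; case: (g x) => s t.
by apply/eqP; rewrite eq_complex /=; apply/andP; split; apply/eqP; ring.
Qed.

Lemma cpderiv_sum (I : Type) (r : seq I) (F : I -> V -> C) i x :
  (forall k, csmooth (F k)) ->
  cpderiv (fun y => \sum_(k <- r) F k y) i x = \sum_(k <- r) cpderiv (F k) i x.
Proof.
move=> sF; elim: r => [|k r IHr].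
  rewrite big_nil -[RHS](cpderiv_cst 0 i x); apply: eq_cpderiv => y.
  exact: big_nil.
rewrite big_cons -IHr -cpderivD //; last by apply: csmooth_sum.
by apply: eq_cpderiv => y; apply: big_cons.
Qed.

Lemma cpderiv_conj f i x : csmooth f ->
  cpderiv (fun y => conjc (f y)) i x = conjc (cpderiv f i x).
Proof.
case=> rf jf; rewrite /cpderiv /pderiv.
have -> : (fun x => complex.Re (conjc (f x))) = (fun x => complex.Re (f x)).
  by apply/funext => y; case: (f y).
have -> : (fun x => complex.Im (conjc (f x))) = (fun x => - complex.Im (f x)).
  by apply/funext => y; case: (f y).
by rewrite deriveN //; apply: smooth_derivable.
Qed.

End ComplexSmooth.

(** * The exterior derivative: linearity, Leibniz rule, conjugation *)

Section FormCalculus.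
Variables (R : realType) (m : nat).
Local Notation C := R[i].
Local Notation V := 'rV[R]_m.
Local Notation E := (ext R m).
Local Notation parity := (ext_map (- 1%:M)).
Implicit Types (a b : diff_form R m) (f g : V -> C) (i : 'I_m).

Definition dform a i : diff_form R m :=
  fun x => [ffun I => cpderiv (fun y => a y I) i x].

Lemma ext_dE a x : ext_d a x = \sum_i dx R i * dform a i x.
Proof. by []. Qed.

Lemma smooth_form_ext a b : a =1 b -> smooth_form b -> smooth_form a.
Proof. by move=> /funext ->. Qed.

Lemma smooth_formD a b : smooth_form a -> smooth_form b ->
  smooth_form (fun x => a x + b x).
Proof.
by move=> sa sb I; apply: (csmooth_ext (fun x => @ffunE _ _ _ _)); apply: csmoothD.
Qed.

Lemma smooth_formZ f a : csmooth f -> smooth_form a ->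
  smooth_form (fun x => f x *: a x).
Proof.
by move=> sf sa I; apply: (csmooth_ext (fun x => ext_scaleE _ _ _)); apply: csmoothM.
Qed.

Lemma smooth_form_cst (c : E) : smooth_form (fun=> c : E).
Proof. by move=> I; apply: csmooth_cst. Qed.

Lemma smooth_formN a : smooth_form a -> smooth_form (fun x => - a x).
Proof.
move=> sa; apply: (smooth_form_ext (fun x => esym (scaleN1r _))).
by apply: smooth_formZ => //; apply: csmooth_cst.
Qed.

Lemma smooth_formM a b : smooth_form a -> smooth_form b ->
  smooth_form (fun x => a x * b x).
Proof.
move=> sa sb I; apply: (csmooth_ext (fun x => ext_coefM _ _ _)).
apply: csmooth_sum => J _; apply: csmoothM => //; apply: csmoothM => //.
exact: csmooth_cst.
Qed.

Lemma smooth_form_sum (I : Type) (r : seq I) (P : pred I) (F : I -> diff_form R m) :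
  (forall k, P k -> smooth_form (F k)) ->
  smooth_form (fun x => \sum_(k <- r | P k) F k x).
Proof.
move=> sF J; apply: (csmooth_ext (fun x => @sum_ffunE _ _ _ _ _ _ _)).
by apply: csmooth_sum => k Pk; apply: sF.
Qed.

Lemma smooth_form_prod (I : Type) (r : seq I) (P : pred I) (F : I -> diff_form R m) :
  (forall k, P k -> smooth_form (F k)) ->
  smooth_form (fun x => \prod_(k <- r | P k) F k x).
Proof.
move=> sF; elim: r => [|k r IHr].
  by apply: (smooth_form_ext (fun x => @big_nil _ _ _ _ _ _)); apply: smooth_form_cst.
case Pk: (P k).
  apply: (@smooth_form_ext _ (fun x => F k x * \prod_(j <- r | P j) F j x)) => [x|].
    by rewrite big_cons Pk.
  by apply: smooth_formM; [apply: sF | exact: IHr].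
by apply: smooth_form_ext IHr => x; rewrite big_cons Pk.
Qed.

Lemma smooth_formX a n : smooth_form a -> smooth_form (fun x => a x ^+ n).
Proof.
move=> sa; elim: n => [|n IHn].
  by apply: (smooth_form_ext (fun x => expr0 _)); apply: smooth_form_cst.
by apply: (smooth_form_ext (fun x => exprS _ _)); apply: smooth_formM.
Qed.

Lemma smooth_dform a i : smooth_form a -> smooth_form (dform a i).
Proof.
by move=> sa I; apply: (csmooth_ext (fun x => @ffunE _ _ _ _)); apply: csmooth_cpderiv.
Qed.

Lemma smooth_ext_d a : smooth_form a -> smooth_form (ext_d a).
Proof.
move=> sa; apply: (@smooth_form_sum _ _ _ (fun i x => dx R i * dform a i x)) => i _.
by apply: smooth_formM; [apply: smooth_form_cst | apply: smooth_dform].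
Qed.

Lemma smooth_fconj a : smooth_form a -> smooth_form (fconj a).
Proof.
by move=> sa I; apply: (csmooth_ext (fun x => @ffunE _ _ _ _)); apply: csmooth_conj.
Qed.

Lemma dformD a b i x : smooth_form a -> smooth_form b ->
  dform (fun y => a y + b y) i x = dform a i x + dform b i x.
Proof.
move=> sa sb; apply/ffunP => I; rewrite !ffunE -cpderivD //.
by apply: eq_cpderiv => y; cbv beta; rewrite ffunE.
Qed.

Lemma dform_sum (I : Type) (r : seq I) (F : I -> diff_form R m) i x :
  (forall k, smooth_form (F k)) ->
  dform (fun y => \sum_(k <- r) F k y) i x = \sum_(k <- r) dform (F k) i x.
Proof.
move=> sF; apply/ffunP => K; rewrite sum_ffunE ffunE.
under [RHS]eq_bigr do rewrite ffunE.
rewrite -cpderiv_sum => [|k]; last exact: sF.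
by apply: eq_cpderiv => y; cbv beta; rewrite sum_ffunE.
Qed.

Lemma dformM a b i x : smooth_form a -> smooth_form b ->
  dform (fun y => a y * b y) i x = dform a i x * b x + a x * dform b i x.
Proof.
move=> sa sb; apply/ffunP => K; rewrite ffunE [RHS]ffunE !ext_coefM -big_split /=.
have -> : (fun y => (a y * b y) K) = (fun y => \sum_(I in powerset K)
     (-1) ^+ inversions I (K :\: I) * (a y I * b y (K :\: I))).
  by apply/funext => y; rewrite ext_coefM; apply: eq_bigr => I _; rewrite mulrA.
have -> : (fun y => \sum_(I in powerset K)
     (-1) ^+ inversions I (K :\: I) * (a y I * b y (K :\: I))) =
   (fun y => \sum_(I <- enum (powerset K))
     (-1) ^+ inversions I (K :\: I) * (a y I * b y (K :\: I))).
  by apply/funext => y; rewrite big_enum.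
rewrite cpderiv_sum; last first.
  by move=> I; apply: csmoothM; [exact: csmooth_cst | apply: csmoothM].
rewrite big_enum; apply: eq_bigr => I _; rewrite !ffunE.
rewrite cpderivM; [|exact: csmooth_cst|exact: csmoothM].
rewrite cpderiv_cst mul0r add0r cpderivM //.
by rewrite mulrDr !mulrA.
Qed.

(** With the sign carried by [parity], the graded Leibniz rule holds for forms of mixed degree. *)
Lemma ext_dM a b x : smooth_form a -> smooth_form b ->
  ext_d (fun y => a y * b y) x = ext_d a x * b x + parity (a x) * ext_d b x.
Proof.
move=> sa sb; rewrite !ext_dE mulr_suml mulr_sumr -big_split /=.
apply: eq_bigr => i _; rewrite dformM // mulrDr mulrA; congr (_ + _).
by rewrite !mulrA dx_parity.
Qed.

Lemma ext_dD a b x : smooth_form a -> smooth_form b ->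
  ext_d (fun y => a y + b y) x = ext_d a x + ext_d b x.
Proof.
move=> sa sb; rewrite !ext_dE -big_split /=; apply: eq_bigr => i _.
by rewrite dformD // mulrDr.
Qed.

Lemma ext_d_sum (I : Type) (r : seq I) (F : I -> diff_form R m) x :
  (forall k, smooth_form (F k)) ->
  ext_d (fun y => \sum_(k <- r) F k y) x = \sum_(k <- r) ext_d (F k) x.
Proof.
move=> sF; rewrite ext_dE; under eq_bigr do rewrite dform_sum // mulr_sumr.
by rewrite exchange_big.
Qed.

Lemma ext_dZ f a x : csmooth f -> smooth_form a ->
  ext_d (fun y => f y *: a y) x =
  (\sum_i cpderiv f i x *: dx R i) * a x + f x *: ext_d a x.
Proof.
move=> sf sa; rewrite !ext_dE mulr_suml scaler_sumr -big_split /=.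
apply: eq_bigr => i _; rewrite ext_mulZl -ext_mulZr -(ext_mulZr (f x)) -mulrDr.
congr (_ * _); apply/ffunP => I.
rewrite [RHS]ffunE !ext_scaleE !ffunE -cpderivM //.
by apply: eq_cpderiv => y; cbv beta; rewrite ext_scaleE.
Qed.

Lemma ext_d0 x : ext_d (fun=> 0 : E) x = 0.
Proof.
rewrite ext_dE big1 // => i _.
have -> : dform (fun=> 0 : E) i x = 0; last by rewrite mulr0.
by apply/ffunP => I; rewrite !ffunE cpderiv_cst.
Qed.

Lemma ext_dN a x : smooth_form a -> ext_d (fun y => - a y) x = - ext_d a x.
Proof.
move=> sa; apply/eqP; rewrite -addr_eq0 -ext_dD //; last exact: smooth_formN.
have -> : (fun y => - a y + a y) = fun=> 0 by apply/funext => y; apply: addNr.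
by rewrite ext_d0.
Qed.

Lemma ext_conjM (u v : E) : ext_conj (u * v) = ext_conj u * ext_conj v.
Proof.
apply/ffunP => K; rewrite ffunE !ext_coefM rmorph_sum; apply: eq_bigr => I _.
by rewrite !rmorphM rmorphXn rmorphN1 !ffunE.
Qed.

Lemma ext_conjD (u v : E) : ext_conj (u + v) = ext_conj u + ext_conj v.
Proof. by apply/ffunP => K; rewrite !ffunE rmorphD. Qed.

Lemma ext_conj0 : ext_conj (0 : E) = 0.
Proof. by apply/ffunP => K; rewrite !ffunE rmorph0. Qed.

Lemma ext_conj_sum (I : Type) (r : seq I) (P : pred I) (F : I -> E) :
  ext_conj (\sum_(k <- r | P k) F k) = \sum_(k <- r | P k) ext_conj (F k).
Proof. by apply: (big_morph (@ext_conj R m)); [exact: ext_conjD|exact: ext_conj0]. Qed.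

Lemma ext_conjZ (z : C) (u : E) : ext_conj (z *: u) = conjc z *: ext_conj u.
Proof. by apply/ffunP => K; rewrite ffunE !ext_scaleE rmorphM ffunE. Qed.

Lemma ext_conjK (u : E) : ext_conj (ext_conj u) = u.
Proof. by apply/ffunP => K; rewrite !ffunE conjcK. Qed.

Lemma ext_conj_dx i : ext_conj (dx R i) = dx R i.
Proof. by apply/ffunP => K; rewrite !ffunE rmorph_nat. Qed.

Lemma ext_d_conj a x : smooth_form a -> ext_d (fconj a) x = ext_conj (ext_d a x).
Proof.
move=> sa; rewrite !ext_dE ext_conj_sum; apply: eq_bigr => i _.
rewrite ext_conjM ext_conj_dx; congr (_ * _); apply/ffunP => I; rewrite !ffunE.
by rewrite -cpderiv_conj //; apply: eq_cpderiv => y; apply: ffunE.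
Qed.

End FormCalculus.

(** * One-forms: type, conjugation and pullback *)

Section DegreeOneParts.
Variables (R : realType) (m : nat).
Local Notation C := R[i].
Local Notation E := (ext R m).

Lemma sum_set1 (F : {set 'I_m} -> E) : (forall I : {set 'I_m}, #|I| != 1%N -> F I = 0) ->
  \sum_I F I = \sum_i F [set i].
Proof.
move=> F0; rewrite (bigID (fun I : {set 'I_m} => #|I| == 1%N)) /=.
rewrite [X in _ + X]big1 ?addr0 => [|I /F0 //].
rewrite -[RHS](big_imset (fun I => F I) (in2W set1_inj)) /=.
apply: eq_bigl => I; apply/cards1P/imsetP => [[i ->]|[i _ ->]]; by exists i.
Qed.

Lemma pq_part10 (J : 'M[R]_m) (a : E) :
  pq_part J 1 0 a = lform ((\row_j a [set j]) *m p10 J).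
Proof.
rewrite -ext_map_lform lformE ext_map_sum /pq_part sum_set1 => [|I nI]; last first.
  rewrite big1 ?scaler0 // => A /andP[]; rewrite powersetE => AI /andP[A1].
  rewrite cards_eq0 setD_eq0 => IA; case/negP: nI.
  by have /eqP <- : A == I by rewrite eqEsubset AI.
apply: eq_bigr => i _; rewrite ext_mapZ ext_map_dx lform_p10 mxE; congr (_ *: _).
rewrite (bigD1 [set i]) /=; last by rewrite powersetE subxx cards1 setDv cards0.
rewrite big1 ?addr0 => [|A /andP[/andP[]]]; last first.
  rewrite powersetE => AI /andP[/eqP A1 _]; case/negP.
  by rewrite eqEcard AI cards1 A1.
by rewrite prod_wedges big_set1 set11.
Qed.

Lemma map_conj_p10 (J : 'M[R]_m) : map_mx conjc (p10 J) = p01 J.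
Proof.
apply/matrixP => i j; rewrite !mxE rmorphM rmorphB fmorphV !rmorph_nat rmorphM.
congr (_ * (_ + _)); rewrite -mulNr; congr (_ * _); last exact: conjc_real.
by rewrite -rmorphN /=; congr (_ +i* _); rewrite ?oppr0 ?opprK.
Qed.

Lemma p01_p10 (J : 'M[R]_m) : J *m J = - 1%:M -> p01 J *m p10 J = 0.
Proof.
move=> J2; have -> : p10 J = map_mx conjc (p01 J).
  by apply/matrixP => i j; rewrite -map_conj_p10 !mxE conjcK.
by rewrite -{1}map_conj_p10 -map_mxM p10_p01 // map_mx0.
Qed.

Lemma lform_inj (r s : 'rV[C]_m) : lform r = lform s -> r = s.
Proof. by move=> e; apply/rowP => j; rewrite -!lform_set1 e. Qed.

Lemma lform_sum (I : Type) (r : seq I) (F : I -> 'rV[C]_m) :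
  lform (\sum_(k <- r) F k) = \sum_(k <- r) lform (F k).
Proof.
apply: (big_morph _ (@lformD R m)).
by rewrite -(scale0r (0 : 'rV[C]_m)) lformZ scale0r.
Qed.

Lemma lform0 : lform (0 : 'rV[C]_m) = 0.
Proof. by rewrite -(scale0r (0 : 'rV[C]_m)) lformZ scale0r. Qed.

Lemma ext_conj_lform (r : 'rV[C]_m) : ext_conj (lform r) = lform (map_mx conjc r).
Proof.
rewrite !lformE ext_conj_sum; apply: eq_bigr => j _.
by rewrite ext_conjZ ext_conj_dx mxE.
Qed.

Lemma pullbackE (phi : 'rV[R]_m -> 'rV[R]_m) (a : diff_form R m) x :
  pullback phi a x = ext_map (map_mx (real_complex R) (jac phi x)^T) (a (phi x)).
Proof.
rewrite ext_mapE; apply: eq_bigr => I _; congr (_ *: _); rewrite prod_wedges.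
by apply: eq_bigr => i _; rewrite lformE; apply: eq_bigr => j _; rewrite !mxE.
Qed.

End DegreeOneParts.

(** * Left translations and derivatives along left-invariant fields *)

Section RowSmooth.
Variables (R : realType) (m : nat).

Lemma smooth_row_mx (F : 'rV[R]_(m + m) -> R) (c : 'rV[R]_m) :
  smooth F -> smooth (fun x => F (row_mx x c)).
Proof.
have crow : continuous (fun x : 'rV[R]_m => row_mx x c).
  move=> x; apply: (@rV_cvg _ _ _ _ _ _ (nbhs_filter x)) => k.
  case: (split_ordP k) => i ->.
    under eq_cvg do rewrite row_mxEl; rewrite row_mxEl; exact: coord_continuous.
  under eq_cvg do rewrite row_mxEr; rewrite row_mxEr; exact: cst_continuous.
have cF k (H : 'rV[R]_(m + m) -> R) : Ck k H -> continuous (fun x => H (row_mx x c)).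
  move=> CH x; apply: (@continuous_comp _ _ _ (fun y => row_mx y c) H x).
    exact: crow.
  by have cH := Ck_continuous CH; apply: cH.
move=> sF k; elim: k F {sF}(sF k) => [|k IHk] F CF; first exact: cF CF.
split=> [|i]; first exact: cF CF.
have [_ /(_ (lshift m i))[dF CdF]] := CF.
have rowE (x : 'rV[R]_m) (h : R) :
    row_mx (h *: delta_mx 0 i + x) c = h *: delta_mx 0 (lshift m i) + row_mx x c.
  apply/rowP => l; case: (split_ordP l) => j ->; rewrite [RHS]mxE.
    by rewrite !row_mxEl !mxE (inj_eq (@lshift_inj _ _)).
  by rewrite !row_mxEr !mxE eq_rlshift andbF mulr0 add0r.
have quotE x : (fun h : R => h^-1 *: (F (row_mx (h *: delta_mx 0 i + x) c) - F (row_mx x c))) =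
   (fun h : R => h^-1 *: (F (h *: delta_mx 0 (lshift m i) + row_mx x c) - F (row_mx x c))).
  by apply/funext => h; rewrite rowE.
split=> [x|].
  by have := dF (row_mx x c); rewrite /derivable -quotE.
have -> : pderiv (fun x => F (row_mx x c)) i =
    fun x => pderiv F (lshift m i) (row_mx x c).
  by apply/funext => x; rewrite /pderiv /derive quotE.
exact: IHk.
Qed.

Variable G : lie_group R m.

(** Seen as a partial derivative of the multiplication in its second argument, the Jacobian of a
    left translation at the identity is visibly smooth in [x]. *)
Lemma jac_gmulE x l j :
  jac (gmul G x) (gone G) l j =
  pderiv (mulcoord G j) (rshift m l) (row_mx x (gone G)).
Proof.
have coordE y : gmul G x y 0 j = mulcoord G j (row_mx x y).
  by rewrite /mulcoord row_mxKl row_mxKr.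
have quotE : (fun h : R => h^-1 *: (gmul G x (h *: delta_mx 0 l + gone G) 0 j -
                                    gmul G x (gone G) 0 j)) =
   (fun h : R => h^-1 *: (mulcoord G j (h *: delta_mx 0 (rshift m l) + row_mx x (gone G)) -
                          mulcoord G j (row_mx x (gone G)))).
  apply/funext => h; rewrite !coordE; congr (_ *: (mulcoord _ _ _ - _)).
  by rewrite [RHS]addrC row_mx_line addrC.
by rewrite mxE /pderiv /derive quotE.
Qed.

Lemma left_derivE l (f : 'rV[R]_m -> R) x :
  left_deriv G l f x = \sum_j jac (gmul G x) (gone G) l j * pderiv f j x.
Proof.
rewrite /left_deriv /curve_deriv; apply: eq_bigr => j _.
by rewrite left_curve0 scale0r addr0 -jac_gmulE mulrC.
Qed.

Lemma smooth_jac_gmul l j : smooth (fun x => jac (gmul G x) (gone G) l j).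
Proof.
apply: (smooth_ext (fun x => jac_gmulE x l j)).
exact/smooth_row_mx/smooth_pderiv/gmul_smooth.
Qed.

Definition cleft_deriv l (f : 'rV[R]_m -> R[i]) x : R[i] :=
  left_deriv G l (fun y => complex.Re (f y)) x +i*
  left_deriv G l (fun y => complex.Im (f y)) x.

Lemma cleft_derivE l (f : 'rV[R]_m -> R[i]) x :
  cleft_deriv l f x = \sum_j (jac (gmul G x) (gone G) l j)%:C * cpderiv f j x.
Proof.
rewrite /cleft_deriv !left_derivE.
elim/big_rec3: _ => [//|j u v w _ <-]; rewrite /cpderiv.
by apply/eqP; rewrite eq_complex /=; apply/andP; split; apply/eqP; ring.
Qed.

End RowSmooth.

(** * Powers of positive (1,1)-forms against the volume form *)

Section Volume.
Variables (R : realType) (N : nat).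
Local Notation C := R[i].
Local Notation E := (ext R N.*2).
Local Notation vol := (\prod_(k <- enum 'I_N) pairform R k).

Lemma dx_lo_hi (k l : 'I_N) :
  dx R (lo k) * dx R (hi l) = ext_basis R [set lo k; hi l].
Proof.
rewrite -wedgeE (wedge_basis R [set lo k] [set hi l]) disjoints1 inE lo_hi.
rewrite inversions_set1 (_ : [set j in [set hi l] | (j < lo k)%N] = finset.set0) ?cards0 ?scale1r //.
apply/setP => j; rewrite !inE; case: eqP => //= ->.
by rewrite ltnNge /= (leq_trans (ltnW (ltn_ord k))) // leq_addr.
Qed.

Lemma bidegree11_herm_form (c : E) : bidegree 1 1 c ->
  c = herm_form (fun k l => c [set lo k; hi l]) (enum 'I_N).
Proof.
case=> lc hc; apply/ffunP => I; rewrite /herm_form sum_ffunE.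
under eq_bigr do rewrite sum_ffunE.
have [cI0|nz] := eqVneq (c I) 0.
  rewrite cI0 big1 // => k _; rewrite big1 // => l _.
  rewrite ext_scaleE dx_lo_hi ffunE; case: eqP => [<-|_]; last by rewrite mulr0.
  by rewrite cI0 mul0r.
have pickw (w : 'I_(N.*2) -> nat) : (\sum_(i in I) w i)%N = 1%N ->
    exists2 i, i \in I & w i = 1%N /\ forall j, j \in I -> j != i -> w j = 0%N.
  move=> w1; have [i iI wi] : exists2 i, i \in I & w i != 0%N.
    apply/exists_inP; apply: contra_eqT w1 => /exists_inPn w0.
    by rewrite big1 // => i /w0; rewrite negbK => /eqP.
  exists i => //; rewrite (bigD1 i) //= in w1.
  have [wi1 rest] : w i = 1%N /\ (\sum_(j in I | j != i) w j = 0)%N.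
    by move: w1 wi; move: (w i) (\sum_(j in I | j != i) w j)%N => p q; lia.
  split=> // j jI nji; apply/eqP; rewrite -leqn0 -rest (bigD1 j) ?jI //=.
  exact: leq_addr.
have [i0 i0I [lo1 lo0]] := pickw _ (lc _ nz).
have [j0 j0I [hi1 hi0]] := pickw _ (hc _ nz).
have [k0 ek0] : exists k, i0 = lo k.
  by case: (lohiP i0) => -[k ek]; [exists k | rewrite ek lo_wt_hi in lo1].
have [l0 el0] : exists l, j0 = hi l.
  by case: (lohiP j0) => -[l el]; [rewrite el hi_wt_lo in hi1 | exists l].
have eI : I = [set lo k0; hi l0].
  apply/setP => i; rewrite !inE; apply/idP/idP => [iI|/orP[]/eqP ->]; rewrite -?ek0 -?el0 //.
  apply/contraT; rewrite negb_or => /andP[ni nj].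
  case: (lohiP i) iI ni nj => -[k ->] iI ni nj.
    by have := lo0 _ iI ni; rewrite lo_wt_lo.
  by have := hi0 _ iI nj; rewrite hi_wt_hi.
have pair_eq k l : (I == [set lo k; hi l]) = (k == k0) && (l == l0).
  apply/eqP/andP => [|[/eqP -> /eqP ->] //].
  rewrite eI => e; split; apply/eqP.
    have : lo k \in [set lo k0; hi l0] by rewrite e !inE eqxx.
    by rewrite !inE lo_hi orbF => /eqP /lo_inj.
  have : hi l \in [set lo k0; hi l0] by rewrite e !inE eqxx orbT.
  by rewrite !inE hi_lo => /eqP /hi_inj.
have coefE k l : (c [set lo k; hi l] *: (dx R (lo k) * dx R (hi l)) : E) I =
    if (k == k0) && (l == l0) then c I else 0.
  rewrite ext_scaleE dx_lo_hi ffunE pair_eq.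
  by case: ifP => [/andP[/eqP -> /eqP ->]|_]; rewrite ?mulr0 // -eI mulr1.
transitivity (\sum_(k <- enum 'I_N) \sum_(l <- enum 'I_N)
    (if (k == k0) && (l == l0) then c I else 0)); last first.
  by apply: eq_bigr => k _; apply: eq_bigr => l _; rewrite coefE.
rewrite (bigD1_seq k0) ?mem_enum ?enum_uniq //= (bigD1_seq l0) ?mem_enum ?enum_uniq //=.
rewrite !eqxx [X in _ + X + _]big1 => [|l /negPf ->]; last by rewrite andbF.
by rewrite addr0 big1 ?addr0 // => k /negPf nk; rewrite big1 // => l _; rewrite nk.
Qed.

Lemma top_vol_neq0 : top (vol : E) != 0.
Proof.
pose pairs (U : seq 'I_N) := flatten [seq [:: lo k; hi k] | k <- U].
have mem_pairs U k : ((lo k \in pairs U) = (k \in U)) * ((hi k \in pairs U) = (k \in U)).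
  elim: U => // u U IH; rewrite /pairs /= !inE -/(pairs U) !IH.
  by split; rewrite ?(inj_eq (@lo_inj N)) ?(inj_eq (@hi_inj N)) ?lo_hi ?hi_lo.
have uniq_pairs U : uniq U -> uniq (pairs U).
  elim: U => // u U IH /= /andP[nu uU]; rewrite -/(pairs U) !inE.
  by rewrite lo_hi /= !mem_pairs nu IH.
have volE U : \prod_(k <- U) pairform R k = \prod_(j <- pairs U) dx R j.
  elim: U => [|u U IH]; first by rewrite !big_nil.
  by rewrite big_cons IH /pairs /= !big_cons mulrA.
have [z nz e] := prod_dx_uniq R (uniq_pairs _ (enum_uniq 'I_N)).
rewrite volE e topZ mulf_neq0 // /top ffunE.
have -> : [set: 'I_(N.*2)] == [set j in pairs (enum 'I_N)].
  apply/eqP/setP => j; rewrite !inE.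
  by case: (lohiP j) => -[k ->]; rewrite mem_pairs mem_enum.
exact: oner_neq0.
Qed.

(** A term with an index in [V] repeats a factor of the product. *)
Lemma herm_form_killed h (U V : seq 'I_N) :
  herm_form h (U ++ V) * \prod_(k <- V) pairform R k =
  herm_form h U * \prod_(k <- V) pairform R k.
Proof.
rewrite /herm_form big_cat mulrDl /= [X in _ + X](_ : _ = 0) ?addr0; last first.
  rewrite mulr_suml big_seq big1 // => k kV; rewrite mulr_suml big1 // => l _.
  rewrite ext_mulZl dx_anti mulNr -mulrA (prod_pairform_dx0 R kV).1.
  by rewrite mulr0 oppr0 scaler0.
rewrite !mulr_suml; apply: eq_bigr => k _; rewrite big_cat mulrDl /=.
rewrite [X in _ + X](_ : _ = 0) ?addr0 // mulr_suml big_seq big1 // => l lV.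
by rewrite ext_mulZl -mulrA (prod_pairform_dx0 R lV).2 mulr0 scaler0.
Qed.

Lemma pos_def_sub h (U V : seq 'I_N) : uniq U -> uniq V -> {subset U <= V} ->
  pos_def (R := R) h V -> pos_def h U.
Proof.
move=> uU uV UV hV z [k kU zk].
pose z' k := if k \in U then z k else 0.
have := hV z' (ex_intro2 _ _ k (UV _ kU) _); rewrite {1}/z' kU => /(_ zk).
have restr (g : 'I_N -> C) : (forall k, k \notin U -> g k = 0) ->
    \sum_(k <- V) g k = \sum_(k <- U) g k.
  move=> g0; rewrite (bigID (fun k => k \in U)) /= [X in _ + X]big1 => [|i /g0 //].
  rewrite addr0 -big_filter; apply: perm_big; apply: uniq_perm => //.
    exact: filter_uniq.
  by move=> i; rewrite mem_filter andb_idr // => /UV.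
rewrite restr => [|i niU]; last first.
  by rewrite big1 // => l _; rewrite /z' (negPf niU) mul0r mulr0.
congr (0 < _); rewrite big_seq [RHS]big_seq; apply: eq_bigr => i iU.
rewrite restr => [|l nlU]; last by rewrite /z' (negPf nlU) conjc0 !mulr0.
rewrite big_seq [RHS]big_seq; apply: eq_bigr => l lU.
by rewrite /z' iU lU.
Qed.

(** Multiplying by the pairs of [V] leaves the principal block of [h] on the other indices. This
    block is again positive definite, so its full power is a positive multiple of the missing
    pairs. *)
Lemma herm_form_pow_pairs h (V : seq 'I_N) : pos_def h (enum 'I_N) -> uniq V ->
  exists2 r : C, 0 < r &
    herm_form h (enum 'I_N) ^+ (N - size V) * \prod_(k <- V) pairform R k = r *: vol.
Proof.
move=> hpos uV; pose U := [seq k <- enum 'I_N | k \notin V].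
have uU : uniq U by rewrite filter_uniq ?enum_uniq.
have pUV : perm_eq (U ++ V) (enum 'I_N).
  apply: uniq_perm; rewrite ?enum_uniq // ?cat_uniq ?uU ?uV ?andbT.
    by apply/hasPn => k kV; rewrite mem_filter kV.
  by move=> k; rewrite mem_cat mem_filter mem_enum /= andbT orNb.
have sU : size U = (N - size V)%N.
  have := perm_size pUV; rewrite size_cat size_enum_ord => e.
  by have := congr1 (subn^~ (size V)) e; rewrite addnK.
have hU : pos_def h U.
  by apply: pos_def_sub hpos => //; rewrite ?enum_uniq // => k; rewrite mem_enum.
have [r r0 hr] := wedge_pow_pos uU hU.
exists r; first exact: r0.
have -> : herm_form h (enum 'I_N) = herm_form h (U ++ V).
  rewrite /herm_form (perm_big _ pUV) /=; apply: eq_bigr => k _.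
  by rewrite (perm_big _ pUV).
have step n : herm_form h (U ++ V) ^+ n * \prod_(k <- V) pairform R k =
    herm_form h U ^+ n * \prod_(k <- V) pairform R k.
  elim: n => [|n IHn]; first by rewrite !expr0.
  have even_form W : supported (fun=> 1%N) 2 (herm_form (R := R) h W).
    apply: supported_sum => k _; apply: supported_sum => l _; apply: supportedZ.
    by apply: (@supportedM _ _ _ 1 1); apply: supported_dx.
  have comm W a : herm_form (R := R) h W * a = a * herm_form h W.
    exact: (even_comm (k := 1) _ (even_form W)).
  rewrite exprS -mulrA IHn comm -mulrA -(comm _ (\prod_(k <- V) _)).
  by rewrite herm_form_killed mulrA -exprSr.
rewrite step -sU hr ext_mulZl -big_cat /=; congr (_ *: _).
by apply: prod_comm_perm pUV => k l; apply: pairform_comm.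
Qed.

End Volume.

(** * Values of two-forms on real vectors *)

Section Eval2.
Variables (R : realType) (m : nat).
Local Notation C := R[i].
Local Notation E := (ext R m).
Implicit Types (v u : 'rV[R]_m) (r s : 'rV[C]_m).

Definition pairing r v : C := \sum_j r 0 j * (v 0 j)%:C.

Lemma eval2_sum (I : Type) (t : seq I) (F : I -> E) v u :
  eval2 (\sum_(k <- t) F k) v u = \sum_(k <- t) eval2 (F k) v u.
Proof.
rewrite /eval2 exchange_big; apply: eq_bigr => i _.
rewrite exchange_big; apply: eq_bigr => j _.
by rewrite sum_ffunE mulr_suml.
Qed.

Lemma eval2Z (z : C) (a : E) v u : eval2 (z *: a) v u = z * eval2 a v u.
Proof.
rewrite /eval2 mulr_sumr; apply: eq_bigr => i _; rewrite mulr_sumr.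
by apply: eq_bigr => j _; rewrite ext_scaleE mulrA.
Qed.

Lemma eval2_dx i j v u :
  eval2 (dx R i * dx R j) v u = (v 0 i * u 0 j - v 0 j * u 0 i)%:C.
Proof.
have lt_case (p q : 'I_m) : (p < q)%N ->
    eval2 (dx R p * dx R q) v u = (v 0 p * u 0 q - v 0 q * u 0 p)%:C.
  move=> pq; have -> : dx R p * dx R q = ext_basis R [set p; q].
    rewrite -wedgeE (wedge_basis R [set p] [set q]) disjoints1 inE.
    rewrite (_ : (p == q) = false) /=; last by apply/negbTE; rewrite neq_ltn pq.
    rewrite inversions_set1 (_ : [set l in [set q] | (l < p)%N] = finset.set0) ?cards0 ?scale1r //.
    apply/setP => l; rewrite !inE; case: eqP => //= ->.
    by rewrite ltnNge ltnW.
  have pairE (k l : 'I_m) : (k < l)%N -> ([set k; l]%SET == [set p; q]%SET) = (k == p) && (l == q).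
    move=> kl; apply/eqP/andP => [e|[/eqP -> /eqP ->] //].
    have := set21 p q; rewrite -e !inE; have := set22 p q; rewrite -e !inE.
    case/orP=> /eqP eq1 /orP[]/eqP ep; subst => //; rewrite ?eqxx //; by lia.
  rewrite /eval2 (bigD1 p) //= (bigD1 q) //= ffunE eqxx mul1r.
  rewrite [X in _ + X + _]big1 => [|l /andP[pl nl]]; last first.
    by rewrite ffunE pairE // (negPf nl) andbF mul0r.
  rewrite [X in _ + X]big1 ?addr0 // => k nk; rewrite big1 // => l kl.
  by rewrite ffunE pairE // (negPf nk) mul0r.
have [ij|ji|/val_inj ->] := ltngtP i j; first exact: lt_case.
  rewrite dx_anti -scaleN1r eval2Z lt_case // mulN1r -rmorphN opprB.
  by [].
by rewrite dx_sq -(scale0r (0 : E)) eval2Z mul0r subrr.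
Qed.

Lemma eval2_lform r s v u :
  eval2 (lform r * lform s) v u = pairing r v * pairing s u - pairing r u * pairing s v.
Proof.
have rowE i : eval2 (r 0 i *: dx R i * \sum_j s 0 j *: dx R j) v u =
    \sum_j r 0 i * (s 0 j * (v 0 i * u 0 j - v 0 j * u 0 i)%:C).
  rewrite ext_mulZl eval2Z [dx R i * _]mulr_sumr eval2_sum mulr_sumr.
  by apply: eq_bigr => j _; rewrite ext_mulZr eval2Z eval2_dx.
rewrite !lformE mulr_suml eval2_sum (eq_bigr _ (fun i _ => rowE i)).
rewrite /pairing !mulr_suml -sumrB; apply: eq_bigr => i _.
rewrite !mulr_sumr -sumrB; apply: eq_bigr => j _.
by rewrite rmorphB !rmorphM; ring.
Qed.

End Eval2.

(** * Forms in a left-invariant coframe *)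

Lemma smooth_ext_map (R : realType) (m : nat) (M : 'rV[R]_m -> 'M[R[i]]_m) (a : diff_form R m) :
  (forall i j, csmooth (fun x => M x i j)) -> smooth_form a ->
  smooth_form (fun x => ext_map (M x) (a x)).
Proof.
move=> sM sa; apply: (smooth_form_ext (fun x => ext_mapE _ _)).
apply: smooth_form_sum => I _; apply: smooth_formZ; first exact: sa.
apply: smooth_form_prod => i _; apply: (smooth_form_ext (fun x => lformE _)).
apply: smooth_form_sum => j _; apply: smooth_formZ; last exact: smooth_form_cst.
by apply: (csmooth_ext (g := fun x => M x i j)) => // x; rewrite mxE.
Qed.

Lemma sum2_only (M : nmodType) n (p0 q0 : 'I_n) (F : 'I_n -> 'I_n -> M) :
  (forall p q : 'I_n, (p : nat, q : nat) != (p0 : nat, q0 : nat) -> F p q = 0) ->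
  \sum_p \sum_q F p q = F p0 q0.
Proof.
move=> F0; rewrite pair_bigA (bigD1 (p0, q0)) //= big1 ?addr0 // => -[p q] /= neq.
by apply: F0; apply: contra neq => /eqP[/val_inj -> /val_inj ->].
Qed.

Section Frame.
Variables (R : realType) (N : nat) (X : complex_nilmanifold R N).
Variable e : 'I_N -> diff_form R N.*2.
Local Notation C := R[i].
Local Notation m := (N.*2).
Local Notation V := 'rV[R]_m.
Local Notation E := (ext R m).
Local Notation G := (cn_group X).
Local Notation J := (cn_J X).
Local Notation parity := (ext_map (- 1%:M)).
Implicit Types (a b : diff_form R m) (x g : V) (k : 'I_N) (i j l : 'I_m) (I : {set 'I_m}).

Hypothesis e_li : forall k, left_invariant_form X (e k).
Hypothesis e_type : forall k, has_type X 1 0 (e k).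
Hypothesis e_free : forall x (c : 'rV[C]_N), \sum_k c 0 k *: e k x = 0 -> c = 0.

Definition frame i : diff_form R m :=
  match lohiP i with
  | inl s => e (sval s)
  | inr s => fconj (e (sval s))
  end.

Lemma frame_lo k : frame (lo k) = e k.
Proof.
rewrite /frame; case: lohiP => -[k' ek] /=; first by rewrite (lo_inj ek).
by have := lo_hi k k'; rewrite ek eqxx.
Qed.

Lemma frame_hi k : frame (hi k) = fconj (e k).
Proof.
rewrite /frame; case: lohiP => -[k' ek] /=; last by rewrite (hi_inj ek).
by have := hi_lo k k'; rewrite ek eqxx.
Qed.

Definition Fr x : 'M[C]_m := \matrix_(i, j) frame i x [set j].

Lemma Fr_hi k x : row (hi k) (Fr x) = map_mx conjc (row (lo k) (Fr x)).
Proof. by apply/rowP => j; rewrite !mxE frame_lo frame_hi ffunE. Qed.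

Lemma e_lform k x : e k x = lform (row (lo k) (Fr x) *m p10 (J x)).
Proof.
rewrite -{1}(e_type k x) /fpq_part pq_part10; congr (lform (_ *m _)).
by apply/rowP => j; rewrite !mxE frame_lo.
Qed.

Lemma Fr_lo_p10 k x : row (lo k) (Fr x) *m p10 (J x) = row (lo k) (Fr x).
Proof.
by apply/rowP => j; rewrite [RHS]mxE [RHS]mxE frame_lo e_lform lform_set1.
Qed.

Lemma frame_lform i x : frame i x = lform (row i (Fr x)).
Proof.
case: (lohiP i) => -[k ->]; first by rewrite frame_lo e_lform Fr_lo_p10.
by rewrite frame_hi Fr_hi -ext_conj_lform /fconj e_lform Fr_lo_p10.
Qed.

Lemma Fr_lo_p01 k x : row (lo k) (Fr x) *m p01 (J x) = 0.
Proof. by rewrite -Fr_lo_p10 -mulmxA p10_p01 ?mulmx0 //; apply: cn_J_sqr. Qed.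

Lemma Fr_hi_p01 k x : row (hi k) (Fr x) *m p01 (J x) = row (hi k) (Fr x).
Proof. by rewrite Fr_hi -map_conj_p10 -map_mxM Fr_lo_p10. Qed.

Lemma Fr_hi_p10 k x : row (hi k) (Fr x) *m p10 (J x) = 0.
Proof. by rewrite -Fr_hi_p01 -mulmxA p01_p10 ?mulmx0 //; apply: cn_J_sqr. Qed.

Lemma Fr_type x (t s : C) :
  Fr x *m type_mx (J x) t s = diag_mx (type_vec N t s) *m Fr x.
Proof.
apply/row_matrixP => i; rewrite row_mul mulmxDr -(scalemxAr t) -(scalemxAr s).
have -> : row i (diag_mx (type_vec N t s) *m Fr x) = type_vec N t s 0 i *: row i (Fr x).
  by apply/rowP => j; rewrite mul_diag_mx !mxE.
rewrite mxE; case: (lohiP i) => -[k ->].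
  by rewrite Fr_lo_p10 Fr_lo_p01 scaler0 addr0 /= ltn_ord.
by rewrite Fr_hi_p10 Fr_hi_p01 scaler0 add0r /= ltnNge leq_addr.
Qed.

(** A linear relation between the rows persists when the (1,0)-forms are scaled by [t] and the
    (0,1)-forms by [s]. The choices (1,0) and (0,1) for [(t, s)] separate the [e k] from their
    conjugates, and [e_free] applies to each. *)
Lemma Fr_unit x : Fr x \in unitmx.
Proof.
rewrite -row_free_unit -kermx_eq0; apply/rowV0P => v /sub_kermxP vF.
have type0 t s : \sum_i (v 0 i * type_vec N t s 0 i) *: frame i x = 0.
  have e0 : v *m diag_mx (type_vec N t s) *m Fr x = 0.
    by rewrite -mulmxA -Fr_type mulmxA vF mul0mx.
  rewrite -[RHS](@lform0 R m) -e0 mulmx_sum_row lform_sum; apply: eq_bigr => i _.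
  by rewrite lformZ frame_lform mul_mx_diag mxE.
have vlo k : v 0 (lo k) = 0.
  have := type0 1 0; rewrite big_lohi /= [X in _ + X]big1 => [|l _]; last first.
    by rewrite mxE /= ltnNge leq_addr mulr0 scale0r.
  rewrite addr0 => e0.
  have c0 : \sum_k (\row_k v 0 (lo k)) 0 k *: e k x = 0.
    rewrite -[RHS]e0; apply: eq_bigr => l _.
    by rewrite !mxE /= ltn_ord mulr1 frame_lo.
  by have /rowP/(_ k) := e_free c0; rewrite !mxE.
have vhi k : v 0 (hi k) = 0.
  have := type0 0 1; rewrite big_lohi /= [X in X + _]big1 => [|l _]; last first.
    by rewrite mxE /= ltn_ord mulr0 scale0r.
  rewrite add0r => /(congr1 (@ext_conj R m)); rewrite ext_conj0 ext_conj_sum => e0.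
  have c0 : \sum_k (\row_k conjc (v 0 (hi k))) 0 k *: e k x = 0.
    rewrite -[RHS]e0; apply: eq_bigr => l _.
    rewrite !mxE /= ltnNge leq_addr mulr1 frame_hi.
    by rewrite ext_conjZ ext_conjK.
  have /rowP/(_ k) := e_free c0; rewrite !mxE => /(congr1 (@conjc R)).
  by rewrite conjcK conjc0.
by apply/rowP => i; rewrite [RHS]mxE; case: (lohiP i) => -[k ->].
Qed.

Definition Sm x : 'M[C]_m := invmx (Fr x).

Lemma Fr_Sm x : Fr x *m Sm x = 1%:M. Proof. exact/mulmxV/Fr_unit. Qed.
Lemma Sm_Fr x : Sm x *m Fr x = 1%:M. Proof. exact/mulVmx/Fr_unit. Qed.

Lemma Sm_uniq x B : Fr x *m B = 1%:M -> Sm x = B.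
Proof. by move=> FB; rewrite -[LHS]mulmx1 -FB mulmxA Sm_Fr mul1mx. Qed.

Local Notation JT g x := (map_mx (real_complex R) (jac (gmul G g) x)^T).

Lemma Fr_translate g x : Fr (gmul G g x) *m JT g x = Fr x.
Proof.
have lo_case k : row (lo k) (Fr (gmul G g x)) *m JT g x = row (lo k) (Fr x).
  have [_ /(_ g I x)] := e_li k.
  rewrite pullbackE -!frame_lo !frame_lform ext_map_lform; exact: lform_inj.
apply/row_matrixP => i; rewrite row_mul.
case: (lohiP i) => -[k ->] //; rewrite !Fr_hi -lo_case map_mxM; congr (_ *m _).
by apply/matrixP => p q; rewrite !mxE; apply/esym/conjc_real.
Qed.

Lemma Sm_translate g x : JT g x *m Sm x = Sm (gmul G g x).
Proof. by apply/esym/Sm_uniq; rewrite mulmxA Fr_translate Fr_Sm. Qed.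

(** The columns of [Sm] are the vector fields dual to the coframe. Being left-invariant, they are
    determined by their values at the identity, which also yields their smoothness. *)
Lemma SmE g i j : Sm g i j =
  \sum_l (jac (gmul G g) (gone G) l i)%:C * Sm (gone G) l j.
Proof.
rewrite -[in LHS](gmulr1 G g) -Sm_translate mxE.
by apply: eq_bigr => l _; rewrite !mxE.
Qed.

Lemma csmooth_Sm i j : csmooth (fun x => Sm x i j).
Proof.
apply: (csmooth_ext (fun x => SmE x i j)); apply: csmooth_sum => l _.
apply: csmoothM; last exact: csmooth_cst.
exact/csmooth_real/smooth_jac_gmul.
Qed.

Lemma smooth_frame i : smooth_form (frame i).
Proof.
case: (lohiP i) => -[k ->]; have [sk _] := e_li k; first by rewrite frame_lo.
by rewrite frame_hi; apply: smooth_fconj.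
Qed.

Lemma csmooth_Fr i j : csmooth (fun x => Fr x i j).
Proof.
by apply: (csmooth_ext (g := fun x => frame i x [set j])) => [x|]; [rewrite mxE | apply: smooth_frame].
Qed.

(** The coefficients of [a] in the coframe, kept in the same algebra with [dx i] in the role of
    [frame i]. *)
Definition fr a : diff_form R m := fun x => ext_map (Sm x) (a x).

Lemma fr_frame i x : fr (frame i) x = dx R i.
Proof.
rewrite /fr frame_lform ext_map_lform -row_mul Fr_Sm; exact: lform_row1.
Qed.

Lemma frK a x : ext_map (Fr x) (fr a x) = a x.
Proof. by rewrite /fr ext_map_comp Sm_Fr ext_map1. Qed.

Lemma fr_ext_map (c : E) x : ext_map (Sm x) (ext_map (Fr x) c) = c.
Proof. by rewrite ext_map_comp Fr_Sm ext_map1. Qed.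

Lemma smooth_fr a : smooth_form a -> smooth_form (fr a).
Proof. by move=> sa; apply: smooth_ext_map => // i j; apply: csmooth_Sm. Qed.

Lemma fr_pq p q a x : (p <= m)%N -> (q <= m)%N ->
  fr (fpq_part X p q a) x = bipart p q (fr a x).
Proof.
move=> pm qm; rewrite /fr /fpq_part -{1}(frK a x).
by rewrite (pq_part_ext_map (Fr_type x)) // fr_ext_map.
Qed.

Lemma fr_bidegree p q a x : (p <= m)%N -> (q <= m)%N ->
  has_type X p q a -> bidegree p q (fr a x).
Proof.
move=> pm qm ta; have -> : fr a x = bipart p q (fr a x).
  by rewrite -fr_pq // /fr ta.
exact: bidegree_bipart.
Qed.

Lemma fr_translate g a x : pullback (gmul G g) a x = a x ->
  fr a (gmul G g x) = fr a x.
Proof.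
move=> inv; rewrite /fr -inv pullbackE ext_map_comp.
by rewrite Sm_translate.
Qed.

Lemma frM a b x : fr (fun y => a y * b y) x = fr a x * fr b x.
Proof. exact: ext_mapM. Qed.

Definition frame_basis I : diff_form R m := fun x => \prod_(i in I) frame i x.

Lemma frame_basisE I x : frame_basis I x = ext_map (Fr x) (ext_basis R I).
Proof. by rewrite ext_map_basis; apply: eq_bigr => i _; apply: frame_lform. Qed.

Lemma frame_expansion a x : a x = \sum_I fr a x I *: frame_basis I x.
Proof.
rewrite -[LHS]frK [X in ext_map _ X]ext_sum_basis ext_map_sum.
by apply: eq_bigr => I _; rewrite ext_mapZ frame_basisE.
Qed.

Lemma smooth_frame_basis I : smooth_form (frame_basis I).
Proof.
by apply: (@smooth_form_prod _ _ _ _ _ frame) => i _; apply: smooth_frame.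
Qed.

(** The derivative along the complex left-invariant field dual to [frame j]. *)
Definition Zderiv j (f : V -> C) x : C := \sum_(i < m) Sm x i j * cpderiv f i x.

Definition Zform j a : diff_form R m :=
  fun x => [ffun I => Zderiv j (fun y => fr a y I) x].

Lemma ZformE j a x I : Zform j a x I = Zderiv j (fun y => fr a y I) x.
Proof. exact: ffunE. Qed.

Lemma Zderiv_left j f x :
  Zderiv j f x = \sum_l Sm (gone G) l j * cleft_deriv G l f x.
Proof.
rewrite /Zderiv; under eq_bigr do rewrite SmE mulr_suml.
rewrite exchange_big; apply: eq_bigr => l _; rewrite cleft_derivE mulr_sumr.
by apply: eq_bigr => i _; rewrite mulrAC mulrC.
Qed.

(** In the expansion of [a] in frame monomials, the first sum differentiates the coefficients and
    the second one contains the structure constants. *)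
Lemma fr_ext_d a x : smooth_form a ->
  fr (ext_d a) x = \sum_j dx R j * Zform j a x +
                   \sum_I fr a x I *: fr (ext_d (frame_basis I)) x.
Proof.
move=> sa.
have sfr I : csmooth (fun y => fr a y I) by apply: smooth_fr.
have -> : fr (ext_d a) x = \sum_I (\sum_j Zderiv j (fun y => fr a y I) x *: (dx R j * ext_basis R I)
    + fr a x I *: fr (ext_d (frame_basis I)) x).
  rewrite /fr (_ : ext_d a x = ext_d (fun y => \sum_I fr a y I *: frame_basis I y) x);
    last by congr (ext_d _ x); apply/funext => y; apply: frame_expansion.
  rewrite ext_d_sum => [|I]; last by apply: smooth_formZ => //; apply: smooth_frame_basis.
  rewrite ext_map_sum; apply: eq_bigr => I _.
  rewrite ext_dZ //; last exact: smooth_frame_basis.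
  rewrite ext_mapD ext_mapZ; congr (_ + _).
  rewrite ext_mapM frame_basisE fr_ext_map ext_map_sum.
  under eq_bigr do rewrite ext_mapZ ext_map_dx lformE scaler_sumr.
  rewrite exchange_big mulr_suml; apply: eq_bigr => j _.
  rewrite /Zderiv scaler_suml mulr_suml; apply: eq_bigr => i _.
  rewrite mxE scalerA (ext_mulZl _ (dx R j) (ext_basis R I)).
  by congr (_ *: _); apply: mulrC.
rewrite big_split exchange_big /=; congr (_ + _); apply: eq_bigr => j _.
rewrite [Zform j a x]ext_sum_basis mulr_sumr; apply: eq_bigr => I _.
by rewrite ext_mulZr ffunE.
Qed.

Variable w : 'I_m -> nat.
Hypothesis w_gt0 : forall i, (0 < w i)%N.
Hypothesis structure_eq : forall i, exists c : E,
  [/\ forall x, fr (ext_d (frame i)) x = c, supported w (w i) c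
    & supported (fun=> 1%N) 2 c].

(** The Leibniz rule replaces one factor at a time by a two-form of the same weight. *)
Lemma frame_basis_structure I : exists c : E,
  [/\ forall x, fr (ext_d (frame_basis I)) x = c,
      supported w (\sum_(i in I) w i) c & supported (fun=> 1%N) #|I|.+1 c].
Proof.
suff gen (r : seq 'I_m) : exists c : E,
   [/\ forall x, fr (ext_d (fun y => \prod_(i <- r | i \in I) frame i y)) x = c,
      supported w (\sum_(i <- r | i \in I) w i) c &
      supported (fun=> 1%N) (\sum_(i <- r | i \in I) 1).+1 c].
  by have [c] := gen (index_enum _); rewrite sum1_card; exists c.
elim: r => [|i r [c [frc wc dc]]].
  exists 0; split=> [x||]; try exact: supported0.
  have -> : (fun y => \prod_(i <- [::] | i \in I) frame i y) = (fun y => 1 : E).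
    by apply/funext => y; rewrite big_nil.
  have d1 : ext_d (fun=> 1 : E) x = 0.
    rewrite ext_dE big1 // => i _.
    have -> : dform (fun=> 1 : E) i x = 0 by apply/ffunP => K; rewrite !ffunE cpderiv_cst.
    by rewrite mulr0.
  by rewrite /fr d1 ext_map0.
case iI: (i \in I); last first.
  have -> : (fun y => \prod_(j <- i :: r | j \in I) frame j y) =
      (fun y => \prod_(j <- r | j \in I) frame j y).
    by apply/funext => y; rewrite big_cons iI.
  by exists c; rewrite !big_cons iI.
have [ci [frci wci dci]] := structure_eq i.
pose P := \prod_(j <- r | j \in I) dx R j.
exists (ci * P - dx R i * c).
have wP (u : 'I_m -> nat) : supported u (\sum_(j <- r | j \in I) u j) P.
  apply: big_ind2 => //; first exact: supported1.
    by move=> *; apply: supportedM.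
  by move=> j _; apply: supported_dx.
split=> [x||].
- have -> : (fun y => \prod_(j <- i :: r | j \in I) frame j y) =
      (fun y => frame i y * \prod_(j <- r | j \in I) frame j y).
    by apply/funext => y; rewrite big_cons iI.
  have sP : smooth_form (fun y => \prod_(j <- r | j \in I) frame j y).
    by apply: (@smooth_form_prod _ _ _ _ _ frame) => j _; apply: smooth_frame.
  rewrite {1}/fr ext_dM //; last exact: smooth_frame.
  rewrite ext_mapD !ext_mapM -/(fr (ext_d (frame i)) x) frci; congr (_ * _ + _).
    by rewrite ext_map_prod; apply: eq_bigr => j _; apply: fr_frame.
  rewrite -[X in _ * X]/(fr _ x) frc -mulNr; congr (_ * _).
  rewrite frame_lform ext_map_lform mulmxN mulmx1.
  by rewrite -scaleN1r lformZ scaleN1r ext_mapN -frame_lform -/(fr _ x) fr_frame.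
- rewrite big_cons iI; apply: supportedD; first exact: supportedM.
  by apply/supportedN/supportedM => //; apply: supported_dx.
- rewrite big_cons iI; apply: supportedD.
    by rewrite -addSn; apply: (supportedM dci (wP _)).
  apply: supportedN; rewrite -addnS; apply: supportedM => //.
  exact: (@supported_dx R m (fun=> 1%N)).
Qed.

(** A top-degree term would involve an index outside [I] besides those of [I], hence have a weight
    strictly above that of [I]. This is the unimodularity of the group. *)
Lemma top_frame_basis I x : top (fr (ext_d (frame_basis I)) x) = 0.
Proof.
have [c [-> wc dc]] := frame_basis_structure I.
apply/eqP/contraT => nz.
have := dc _ nz; rewrite sum1_card => cI.
have := wc _ nz; rewrite (big_setID I) /= setTI => /eqP; rewrite -[X in _ == X]addn0 eqn_add2l.
have [i iI] : exists i, i \in [set: 'I_m] :\: I.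
  apply/set0Pn; rewrite -card_gt0 cardsD setTI.
  by rewrite -[X in (X - _)%N]/(#|[set: 'I_m]|) cI subSnn.
by rewrite (bigD1 i) //= addn_eq0 eqn0Ngt w_gt0.
Qed.

Lemma fr_ext_d_translate a g x : smooth_form a ->
  (forall y, fr a (gmul G g y) = fr a y) ->
  fr (ext_d a) (gmul G g x) = fr (ext_d a) x.
Proof.
move=> sa inv; apply: etrans (fr_ext_d _ sa) _; apply: etrans (esym (fr_ext_d _ sa)).
apply: (congr2 +%R).
  apply: eq_bigr => j _; congr (_ * _); apply/ffunP => I; rewrite !ZformE !Zderiv_left.
  apply: eq_bigr => l _; congr (_ * _).
  have [sre sim] : csmooth (fun y => fr a y I) by apply: smooth_fr.
  by rewrite /cleft_deriv !left_deriv_invariant // => y; rewrite inv.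
rewrite inv; apply: eq_bigr => I _; congr (_ *: _).
by have [c [frc _ _]] := frame_basis_structure I; rewrite !frc.
Qed.

(** Invariance under the lattice is read on coefficients, where its stability under products,
    [ext_d] and bidegree parts is easy to see. *)
Definition good a := smooth_form a /\
  forall g x, cn_lattice X g -> fr a (gmul G g x) = fr a x.

Lemma goodM a b : good a -> good b -> good (fun x => a x * b x).
Proof.
move=> [sa ia] [sb ib]; split=> [|g x Gg]; first exact: smooth_formM.
by rewrite !frM ia ?ib.
Qed.

Lemma goodX a n : good a -> good (fun x => a x ^+ n).
Proof.
move=> [sa ia]; split=> [|g x Gg]; first exact: smooth_formX.
by rewrite /fr !ext_mapX -!/(fr a _) ia.
Qed.

Lemma goodB a b : good a -> good b -> good (fun x => a x - b x).
Proof.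
move=> [sa ia] [sb ib]; split=> [|g x Gg].
  by apply: smooth_formD => //; apply: smooth_formN.
by rewrite /fr !ext_mapD !ext_mapN -!/(fr _ _) ia ?ib.
Qed.

Lemma good_ext_d a : good a -> good (ext_d a).
Proof.
move=> [sa ia]; split=> [|g x Gg]; first exact: smooth_ext_d.
by apply: fr_ext_d_translate => // y; apply: ia.
Qed.

Lemma good_pq p q a : (p <= m)%N -> (q <= m)%N -> good a -> good (fpq_part X p q a).
Proof.
move=> pm qm [sa ia]; split=> [|g x Gg]; last by rewrite !fr_pq // ia.
apply: (@smooth_form_ext _ _ _ (fun x => ext_map (Fr x) (bipart p q (fr a x)))) => [x|].
  by rewrite -fr_pq // frK.
apply: smooth_ext_map => [i j|I]; first exact: csmooth_Fr.
case E : ((\sum_(i in I) lo_wt i == p) && (\sum_(i in I) hi_wt i == q))%N.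
  by apply: (csmooth_ext (g := fun x => fr a x I)) => [x|]; [rewrite ffunE E | apply: smooth_fr].
by apply: (csmooth_ext (g := fun x => 0)) => [x|]; [rewrite ffunE E | apply: csmooth_cst].
Qed.

Lemma good_frame i : good (frame i).
Proof. by split=> [|g x _]; [apply: smooth_frame | rewrite !fr_frame]. Qed.

Lemma good_form_on a : form_on X a -> good a.
Proof. by case=> sa ia; split=> // g x Gg; apply/fr_translate/ia. Qed.

(* Only the derivatives of the coefficients of [a] contribute to the top part of
   [d a], and they form a divergence. *)
Theorem top_ext_d_not_pos a (kappa : C) : good a ->
  ~ forall x, 0 < kappa * top (fr (ext_d a) x).
Proof.
move=> [sa ia] pos.
(* The components along the real left-invariant fields: the constants [Sm (gone G) l j] express the
   complex dual fields through them. *)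
pose W l x : C := \sum_j kappa * Sm (gone G) l j * top (dx R j * fr a x).
have topE x : top (fr (ext_d a) x) = \sum_j top (dx R j * Zform j a x).
  rewrite fr_ext_d // topD !top_sum [X in _ + X]big1 ?addr0 // => I _.
  by rewrite topZ top_frame_basis mulr0.
have top_dxE j (b : E) : top (dx R j * b) = \sum_I top (dx R j * ext_basis R I) * b I.
  rewrite {1}[b]ext_sum_basis mulr_sumr top_sum; apply: eq_bigr => I _.
  by rewrite ext_mulZr topZ mulrC.
have sW l : csmooth (W l).
  apply: csmooth_sum => j _; apply: csmoothM; first exact: csmooth_cst.
  apply: (csmooth_ext (fun x => top_dxE j (fr a x))); apply: csmooth_sum => I _.
  by apply: csmoothM; [exact: csmooth_cst | apply: smooth_fr].
have cleftW l x : cleft_deriv G l (W l) x = \sum_j kappa * Sm (gone G) l j *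
    \sum_I top (dx R j * ext_basis R I) * cleft_deriv G l (fun y => fr a y I) x.
  rewrite cleft_derivE.
  have -> : W l = (fun y => \sum_j \sum_I (kappa * Sm (gone G) l j *
      top (dx R j * ext_basis R I)) * fr a y I).
    apply/funext => y; apply: eq_bigr => j _; rewrite top_dxE mulr_sumr.
    by apply: eq_bigr => I _; rewrite mulrA.
  have sterm j I : csmooth (fun y => (kappa * Sm (gone G) l j *
      top (dx R j * ext_basis R I)) * fr a y I).
    by apply: csmoothM; [exact: csmooth_cst | apply: smooth_fr].
  under eq_bigr => i _.
    rewrite cpderiv_sum => [|j]; last by apply: csmooth_sum => I _; apply: sterm.
    under eq_bigr => j _.
      rewrite cpderiv_sum; last by move=> I; apply: sterm.
      under eq_bigr => I _.
        rewrite cpderivM; [|exact: csmooth_cst|exact: smooth_fr].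
        rewrite cpderiv_cst mul0r add0r; over.
      over.
    rewrite mulr_sumr; over.
  rewrite exchange_big; apply: eq_bigr => j _ /=.
  under eq_bigr do rewrite mulr_sumr.
  rewrite exchange_big mulr_sumr; apply: eq_bigr => I _ /=.
  rewrite cleft_derivE !mulr_sumr; apply: eq_bigr => i _.
  by rewrite mulrCA !mulrA.
apply: (no_positive_divergence (G := G) (Gamma := cn_lattice X)
    (W := fun l x => complex.Re (W l x)) (cn_nilpotent X) (cn_latticeP X)).
- by move=> l; have [] := sW l.
- by move=> l g x Gg; congr complex.Re; apply: eq_bigr => j _; rewrite ia.
move=> x; have := pos x; rewrite topE.
have -> : kappa * \sum_j top (dx R j * Zform j a x) = \sum_l cleft_deriv G l (W l) x.
  under [RHS]eq_bigr do rewrite cleftW.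
  rewrite exchange_big mulr_sumr; apply: eq_bigr => j _.
  have -> : top (dx R j * Zform j a x) = \sum_I top (dx R j * ext_basis R I) *
      \sum_l Sm (gone G) l j * cleft_deriv G l (fun y => fr a y I) x.
    by rewrite top_dxE; apply: eq_bigr => I _; rewrite ZformE Zderiv_left.
  under [RHS]eq_bigr do rewrite -mulrA.
  rewrite -mulr_sumr; congr (_ * _).
  under eq_bigr do rewrite mulr_sumr.
  rewrite exchange_big; apply: eq_bigr => l _ /=; rewrite mulr_sumr.
  by apply: eq_bigr => I _; rewrite mulrCA.
(* A positive element of [R[i]] has positive real part, and the real part of the divergence is the
   divergence of the real parts. *)
rewrite ltcE /= cRe_sum => /andP[_]; apply.
Qed.

Lemma has_type_fr p q a : (p <= m)%N -> (q <= m)%N ->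
  (forall x, bidegree p q (fr a x)) -> has_type X p q a.
Proof.
by move=> pm qm bi x; rewrite -[LHS]frK fr_pq // bipart_id // frK.
Qed.

Lemma fpq_part_neq p q p' q' a x : (p <= m)%N -> (q <= m)%N ->
  (p' <= m)%N -> (q' <= m)%N -> has_type X p q a -> (p', q') != (p, q) ->
  fpq_part X p' q' a x = 0.
Proof.
move=> pm qm p'm q'm ta neq; rewrite -[LHS]frK fr_pq //.
by rewrite (bipart_neq (fr_bidegree x pm qm ta) neq) ext_map0.
Qed.

Lemma fpq_part_ext_d0 p q x : fpq_part X p q (ext_d (fun=> 0 : E)) x = 0.
Proof.
rewrite /fpq_part ext_d0 /pq_part big1 // => I _.
by rewrite ffunE scale0r.
Qed.

Section TypedDifferentials.
Variables (p q : nat) (a : diff_form R m).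
Hypotheses (N_gt0 : (0 < N)%N) (pN : (p <= N)%N) (qN : (q <= N)%N).
Hypothesis ta : has_type X p q a.

Let leNm r : (r <= N)%N -> (r <= m)%N.
Proof. by move=> rN; rewrite -addnn (leq_trans rN) // leq_addr. Qed.

Let leSm r : (r <= N)%N -> (r.+1 <= m)%N.
Proof. by move=> rN; rewrite -addnn -addn1 leq_add. Qed.

Lemma fpq_part_id : fpq_part X p q a = a.
Proof. exact/funext/ta. Qed.

Lemma fpq_part_eq0 (p' q' : 'I_N.+1) : (p' : nat, q' : nat) != (p, q) ->
  fpq_part X p' q' a = fun=> 0.
Proof.
move=> neq; apply/funext => x; apply: fpq_part_neq ta neq; apply: leNm => //.
  by rewrite -ltnS.
by rewrite -ltnS.
Qed.

(** For a form of pure type within the range of summation, a single term of [del] survives. *)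
Lemma delE : del X a = fpq_part X p.+1 q (ext_d a).
Proof.
apply/funext => x; rewrite -[in RHS]fpq_part_id.
apply: (@sum2_only _ _ (Ordinal (pN : (p < N.+1)%N)) (Ordinal (qN : (q < N.+1)%N))
  (fun p' q' => fpq_part X p'.+1 q' (ext_d (fpq_part X p' q' a)) x)) => p' q' neq.
by rewrite (fpq_part_eq0 neq) fpq_part_ext_d0.
Qed.

Lemma delbarE : delbar X a = fpq_part X p q.+1 (ext_d a).
Proof.
apply/funext => x; rewrite -[in RHS]fpq_part_id.
apply: (@sum2_only _ _ (Ordinal (pN : (p < N.+1)%N)) (Ordinal (qN : (q < N.+1)%N))
  (fun p' q' => fpq_part X p' q'.+1 (ext_d (fpq_part X p' q' a)) x)) => p' q' neq.
by rewrite (fpq_part_eq0 neq) fpq_part_ext_d0.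
Qed.

Lemma fr_del x : fr (del X a) x = bipart p.+1 q (fr (ext_d a) x).
Proof. by rewrite delE fr_pq //; [apply: leSm | apply: leNm]. Qed.

Lemma fr_delbar x : fr (delbar X a) x = bipart p q.+1 (fr (ext_d a) x).
Proof. by rewrite delbarE fr_pq //; [apply: leNm | apply: leSm]. Qed.

Lemma good_delbar : good a -> good (delbar X a).
Proof.
by move=> ga; rewrite delbarE; apply: good_pq; [apply: leNm | apply: leSm | apply: good_ext_d].
Qed.

End TypedDifferentials.

Local Notation imag := (0 +i* 1 : C).

Lemma p10_eigen (r : 'rV[C]_m) x : r *m p10 (J x) = r -> r *m cJ (J x) = imag *: r.
Proof.
rewrite /p10 -scalemxAr mulmxBr mulmx1 -scalemxAr => e1.
have e2 : r - imag *: (r *m cJ (J x)) = r + r.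
  rewrite -[LHS]scale1r -(@divff _ (2 : C)) ?pnatr_eq0 // -scalerA e1.
  by rewrite scaler_nat mulr2n.
have e3 : - (imag *: (r *m cJ (J x))) = r.
  by move/eqP: e2; rewrite (inj_eq (addrI r)) => /eqP.
by rewrite -{2}e3 scalerN scalerA imag_sqr scaleN1r opprK.
Qed.

Lemma pairing_mul (r : 'rV[C]_m) (v : V) x :
  pairing r (v *m J x) = pairing (r *m cJ (J x)) v.
Proof.
rewrite /pairing; under eq_bigr do rewrite mxE rmorph_sum mulr_sumr.
rewrite exchange_big; apply: eq_bigr => j _; rewrite mxE mulr_suml.
by apply: eq_bigr => i _; rewrite !mxE rmorphM /= mulrCA [RHS]mulrC.
Qed.

Lemma pairing_conj (r : 'rV[C]_m) (v : V) : pairing (map_mx conjc r) v = conjc (pairing r v).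
Proof.
rewrite /pairing rmorph_sum; apply: eq_bigr => j _.
by rewrite mxE rmorphM; congr (_ * _); apply/esym/conjc_real.
Qed.

Lemma pairingZ (z : C) (r : 'rV[C]_m) (v : V) : pairing (z *: r) v = z * pairing r v.
Proof. by rewrite /pairing mulr_sumr; apply: eq_bigr => j _; rewrite mxE mulrA. Qed.

(** Prescribe [z k] on [e k] and its conjugate on the conjugate form. The complex solution is unique
    and its conjugate solves the same system, so it is a real vector. *)
Lemma exists_dual_vector x (z : 'I_N -> C) :
  exists v : V, forall k, pairing (row (lo k) (Fr x)) v = z k.
Proof.
pose u : 'cV[C]_m := \col_i (match lohiP i with inl s => z (sval s) | inr s => conjc (z (sval s)) end).
have u_lo k : u (lo k) 0 = z k.
  rewrite mxE; case: lohiP => -[k' ek] /=; first by rewrite (lo_inj ek).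
  by have := lo_hi k k'; rewrite ek eqxx.
have u_hi k : u (hi k) 0 = conjc (z k).
  rewrite mxE; case: lohiP => -[k' ek] /=; last by rewrite (hi_inj ek).
  by have := hi_lo k k'; rewrite ek eqxx.
have [y Fy] : exists y : 'cV[C]_m, Fr x *m y = u.
  by exists (Sm x *m u); rewrite mulmxA Fr_Sm mul1mx.
have FhiE k j : Fr x (hi k) j = conjc (Fr x (lo k) j).
  by have /rowP/(_ j) := Fr_hi k x; rewrite !mxE.
have Fcy : Fr x *m map_mx conjc y = u.
  apply/colP => i; rewrite mxE.
  have sumE (k : 'I_m) : \sum_j Fr x k j * y j 0 = u k 0 by rewrite -Fy mxE.
  case: (lohiP i) => -[k ->].
    rewrite u_lo -[RHS]conjcK -u_hi -sumE rmorph_sum; apply: eq_bigr => j _.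
    by rewrite rmorphM /= FhiE conjcK; congr (_ * _); rewrite mxE.
  rewrite u_hi -u_lo -sumE rmorph_sum; apply: eq_bigr => j _.
  by rewrite rmorphM /= FhiE; congr (_ * _); rewrite mxE.
have y_real j : (complex.Re (y j 0))%:C = y j 0.
  have : map_mx conjc y = y.
    by rewrite -[LHS]mul1mx -[RHS]mul1mx -(Sm_Fr x) -!mulmxA Fcy Fy.
  move/colP/(_ j); rewrite mxE; case: (y j 0) => s t /= [et].
  have -> : t = 0 by move: et; lra.
  by [].
exists (\row_j complex.Re (y j 0)) => k.
rewrite -u_lo -Fy mxE; apply: eq_bigr => j _.
by rewrite !mxE y_real.
Qed.

(** Take the real vector [v] on which the [e k] have the values [z k]. As [J] acts by [i] on
    (1,0)-covectors and by [-i] on their conjugates, each pair contributes [-2i] times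
    [z k * conjc (z k')] to [F(v, Jv)]: this is the origin of the constant. *)
Lemma metric_pos_def F x : (0 < N)%N -> hermitian_metric X F ->
  pos_def (fun k k' => - (imag *+ 2) * fr F x [set lo k; hi k']) (enum 'I_N).
Proof.
move=> N0 [_ tF _ posF] z [k0 _ zk0].
have [v vz] := exists_dual_vector x z.
have v0 : v != 0.
  apply: contra_neq zk0 => v0; rewrite -vz v0 /pairing big1 // => j _.
  by rewrite [(0 : V) 0 j]mxE mulr0.
have := posF x v v0.
have le1m : (1 <= m)%N by rewrite -addnn (leq_trans N0) // leq_addr.
have Fxe : F x = \sum_(k <- enum 'I_N) \sum_(k' <- enum 'I_N)
    fr F x [set lo k; hi k'] *: (lform (row (lo k) (Fr x)) * lform (row (hi k') (Fr x))).
  rewrite -[LHS]frK {1}(bidegree11_herm_form (fr_bidegree x le1m le1m tF)).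
  rewrite ext_map_sum; apply: eq_bigr => k _; rewrite ext_map_sum.
  by apply: eq_bigr => k' _; rewrite ext_mapZ ext_mapM !ext_map_dx.
rewrite Fxe eval2_sum; congr (0 < _); apply: eq_bigr => k _.
rewrite eval2_sum; apply: eq_bigr => k' _; rewrite eval2Z eval2_lform.
rewrite !pairing_mul (p10_eigen (Fr_lo_p10 k x)).
have -> : row (hi k') (Fr x) *m cJ (J x) = - imag *: row (hi k') (Fr x).
  rewrite Fr_hi; have -> : cJ (J x) = map_mx conjc (cJ (J x)).
    by apply/matrixP => i j; rewrite !mxE; apply/esym/conjc_real.
  rewrite -map_mxM p10_eigen ?Fr_lo_p10 //; apply/rowP => j; rewrite !mxE rmorphM.
  by congr (_ * _); apply/eqP; rewrite eq_complex /= oppr0 !eqxx.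
rewrite !pairingZ Fr_hi pairing_conj !vz mulr2n.
by ring.
Qed.

Lemma fr_ext_dM a b x : smooth_form a -> smooth_form b ->
  fr (ext_d (fun y => a y * b y)) x =
  fr (ext_d a) x * fr b x + parity (fr a x) * fr (ext_d b) x.
Proof.
move=> sa sb; rewrite /fr ext_dM // ext_mapD !ext_mapM; congr (_ + _ * _).
by rewrite !ext_map_comp mulNmx mul1mx mulmxN mulmx1.
Qed.

Lemma fr_ext_dB a b x : smooth_form a -> smooth_form b ->
  fr (ext_d (fun y => a y - b y)) x = fr (ext_d a) x - fr (ext_d b) x.
Proof.
move=> sa sb; rewrite /fr ext_dD //; last exact: smooth_formN.
by rewrite ext_dN // ext_mapD ext_mapN.
Qed.

Lemma parity_bidegree p q (c : E) : bidegree p q c -> parity c = (-1) ^+ (p + q) *: c.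
Proof. by move=> /bidegree_deg/parity_supported. Qed.

(** * The two obstructions *)

Section Obstruction.
Variables eta tau1 tau2 : 'I_N.
Hypotheses (N_ge2 : (2 <= N)%N) (tau12 : tau1 != tau2).
Hypothesis d_eta : forall x, ext_d (e eta) x =
  e tau1 x * fconj (e tau1) x + e tau2 x * fconj (e tau2) x.
Hypothesis d_tau : forall k x, k \in [:: tau1; tau2] -> ext_d (e k) x = 0.

Local Notation omega := (pairform R tau1 + pairform R tau2).
Local Notation vol := (\prod_(k <- enum 'I_N) pairform R k).
Local Notation imag2 := (- (imag *+ 2)).

Let omega_form : diff_form R m :=
  fun x => e tau1 x * fconj (e tau1) x + e tau2 x * fconj (e tau2) x.

Let N_gt0 : (0 < N)%N. Proof. exact: ltnW. Qed.
Let le_m r : (r <= N)%N -> (r <= m)%N.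
Proof. by move=> rN; rewrite -addnn (leq_trans rN) // leq_addr. Qed.

Lemma fr_omega x : fr omega_form x = omega.
Proof.
rewrite /fr /omega_form -!frame_hi -!frame_lo ext_mapD !ext_mapM.
by rewrite -!/(fr (frame _) x) !fr_frame.
Qed.

Lemma fr_d_eta x : fr (ext_d (frame (lo eta))) x = omega.
Proof. by rewrite -(fr_omega x) /fr frame_lo d_eta. Qed.

(** The sign appears because conjugation exchanges the two factors of each pair. *)
Lemma fr_d_eta_conj x : fr (ext_d (frame (hi eta))) x = - omega.
Proof.
have [se _] := e_li eta.
rewrite /fr frame_hi ext_d_conj // d_eta ext_conjD !ext_conjM.
rewrite !ext_conjK -!/(fconj _ _) -!frame_hi -!frame_lo ext_mapD !ext_mapM.
rewrite -!/(fr (frame _) x) !fr_frame opprD.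
by congr (_ + _); apply: dx_anti.
Qed.

Lemma smooth_omega : smooth_form omega_form.
Proof.
have [s1 _] := e_li tau1; have [s2 _] := e_li tau2.
by apply: smooth_formD; apply: smooth_formM => //; apply: smooth_fconj.
Qed.

Lemma good_omega : good omega_form.
Proof. by split=> [|g x _]; [exact: smooth_omega | rewrite !fr_omega]. Qed.

Lemma d_omega x : fr (ext_d omega_form) x = 0.
Proof.
have [s1 _] := e_li tau1; have [s2 _] := e_li tau2.
have dpair k y : smooth_form (e k) -> k \in [:: tau1; tau2] ->
    ext_d (fun z => e k z * fconj (e k) z) y = 0.
  move=> sk kin; rewrite ext_dM //; last exact: smooth_fconj.
  by rewrite ext_d_conj // d_tau // ext_conj0 mul0r mulr0 addr0.
rewrite /fr ext_dD; try by apply: smooth_formM => //; apply: smooth_fconj.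
by rewrite !dpair ?inE ?eqxx ?orbT // addr0 ext_map0.
Qed.

Lemma bidegree_pairform k : bidegree 1 1 (pairform R k).
Proof. exact: (bidegreeM (bidegree_lo R k) (bidegree_hi R k)). Qed.

Lemma bidegree_omega : bidegree 1 1 omega.
Proof. by apply: bidegreeD; apply: bidegree_pairform. Qed.

Lemma pairform_sq k : pairform R k * pairform R k = 0.
Proof. by apply: deg1_pair_sq; apply: (@supported_dx R m (fun=> 1%N)). Qed.

Lemma omega_sq : omega * omega = (pairform R tau1 * pairform R tau2) *+ 2.
Proof.
rewrite mulrDl !mulrDr !pairform_sq add0r addr0 [pairform R tau2 * _]pairform_comm.
by rewrite mulr2n.
Qed.

Lemma metric_powers F x (V : seq 'I_N) : hermitian_metric X F -> uniq V ->
  exists2 r : C, 0 < r & imag2 ^+ (N - size V) *: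
    (fr F x ^+ (N - size V) * \prod_(k <- V) pairform R k) = r *: vol.
Proof.
move=> hF uV; have hpos := metric_pos_def x N_gt0 hF.
have [r r0 hr] := herm_form_pow_pairs hpos uV.
exists r; first exact: r0.
rewrite -hr -ext_mulZl -exprZn; congr (_ ^+ _ * _).
have [_ tF _ _] := hF.
rewrite {1}(bidegree11_herm_form (fr_bidegree x (le_m N_gt0) (le_m N_gt0) tF)).
rewrite scaler_sumr; apply: eq_bigr => k _; rewrite scaler_sumr.
by apply: eq_bigr => k' _; rewrite scalerA.
Qed.

Lemma metric_bidegree F x n : hermitian_metric X F -> bidegree n n (fr F x ^+ n).
Proof.
move=> [_ tF _ _]; rewrite -{1 2}[n]muln1; apply: bidegreeX.
exact: (fr_bidegree x (le_m N_gt0) (le_m N_gt0) tF).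
Qed.

Lemma fr_fpow F n x : fr (fpow F n) x = fr F x ^+ n.
Proof. by rewrite /fr /fpow iter_wedge ext_mapX. Qed.

Lemma fpow_type F n : (n <= N)%N -> hermitian_metric X F -> has_type X n n (fpow F n).
Proof.
move=> nN hF; apply: has_type_fr => [||x]; rewrite ?le_m //.
by rewrite fr_fpow; apply: metric_bidegree.
Qed.

Lemma good_fpow F n : hermitian_metric X F -> good (fpow F n).
Proof.
move=> [oF _ _ _]; have := goodX n (good_form_on oF).
congr good; apply/funext => x; rewrite /fpow iter_wedge.
by [].
Qed.

Lemma parity_even n (c : E) : bidegree n n c -> parity c = c.
Proof. by move=> /parity_bidegree ->; rewrite addnn -signr_odd odd_double scale1r. Qed.

Let good_eta : good (frame (lo eta)). Proof. exact: good_frame. Qed.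
Let good_eta_bar : good (frame (hi eta)). Proof. exact: good_frame. Qed.

(** Dividing by the nonzero scalar [top vol] removes the orientation, and [kappa] removes the phase
    due to the powers of [-2i]. *)
Lemma exact_volume_absurd a (kappa : C) : kappa != 0 -> good a ->
  ~ forall x, exists2 r : C, 0 < r & kappa * top (fr (ext_d a) x) = r * top (vol : E).
Proof.
move=> k0 ga pos; apply: (top_ext_d_not_pos (kappa := kappa / top (vol : E)) ga) => x.
have [r r0 e1] := pos x.
by rewrite mulrAC e1 mulfK // top_vol_neq0.
Qed.

Lemma strongly_Gauduchon_absurd F : hermitian_metric X F -> ~ strongly_Gauduchon X F.
Proof.
move=> hF [gamma [ogamma tgamma dgamma]].
pose P := fpow F (N - 1).
have gP : good P by apply: good_fpow.
have gg : good gamma by apply: good_form_on.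
have N1 : (N - 1).+1 = N by rewrite subn1 prednK.
have N2 : (N - 2).+1 = (N - 1)%N by lia.
have tP : has_type X (N - 1) (N - 1) P by apply: fpow_type => //; rewrite leq_subr.
have frP x : fr P x = fr F x ^+ (N - 1) by apply: fr_fpow.
have {}dgamma x : fr (del X P) x = fr (delbar X gamma) x.
  exact: (congr1 (ext_map (Sm x)) (dgamma x)).
clearbody P.
have bP x : bidegree (N - 1) (N - 1) (fr P x) by rewrite frP; apply: metric_bidegree.
have bg x : bidegree N (N - 2) (fr gamma x).
  by apply: fr_bidegree tgamma; rewrite le_m // leq_subr.
(* The opposite of a primitive of [P /\ omega] in top degree, hence the sign in [topa] and in the
   constant below. *)
pose a := fun x => P x * frame (hi eta) x - gamma x * frame (hi eta) x.
have ga : good a by apply: goodB; apply: goodM.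
have topa x : top (fr (ext_d a) x) = - top (fr P x * omega).
  have [sP _] := gP; have [sg _] := gg; have [sb _] := good_eta_bar.
  have s1 : smooth_form (fun y => P y * frame (hi eta) y) := smooth_formM sP sb.
  have s2 : smooth_form (fun y => gamma y * frame (hi eta) y) := smooth_formM sg sb.
  rewrite (fr_ext_dB _ s1 s2) (fr_ext_dM _ sP sb) (fr_ext_dM _ sg sb).
  rewrite fr_d_eta_conj fr_frame (parity_even (bP x)).
  have pg : parity (fr gamma x) = fr gamma x.
    rewrite (parity_bidegree (bg x)) (_ : (N + (N - 2) = (N - 1).*2)%N); last by lia.
    by rewrite -signr_odd odd_double scale1r.
  rewrite pg !mulrN topD topN !topD !topN.
  (* Against a (0,1)-form only the part of type (N, N-1) counts, where [d P] is [del P] and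
     [d gamma] is [delbar gamma]; these two cancel. *)
  have cut (c : E) : top (c * dx R (hi eta)) = top (bipart N (N - 1)%N c * dx R (hi eta)).
    by apply: top_mul_bipart (bidegree_hi R eta); rewrite ?addn0 // addn1.
  have e1 : bipart N (N - 1)%N (fr (ext_d P) x) = bipart N (N - 1)%N (fr (ext_d gamma) x).
    have dP : fr (del X P) x = bipart (N - 1).+1 (N - 1)%N (fr (ext_d P) x).
      by exact: (fr_del N_gt0 (leq_subr 1 N) (leq_subr 1 N) tP x).
    have dg : fr (delbar X gamma) x = bipart N (N - 2).+1 (fr (ext_d gamma) x).
      by exact: (fr_delbar N_gt0 (leqnn N) (leq_subr 2 N) tgamma x).
    by have := dgamma x; rewrite dP dg N1 N2.
  (* The product has type (N+1, N-1). *)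
  have e2 : top (fr gamma x * omega) = 0.
    apply: (top_bidegree0 (bidegreeM (bg x) bidegree_omega)).
    by rewrite xpair_eqE negb_and addn1 neq_ltn ltnSn orbT.
  by rewrite (cut (fr (ext_d P) x)) e1 -cut e2 subr0 addrAC subrr add0r.
apply: (@exact_volume_absurd a (- imag2 ^+ (N - 1))) => //.
  rewrite oppr_eq0 expf_neq0 // oppr_eq0 mulrn_eq0 /= eq_complex /=.
  by rewrite oner_eq0 andbF.
move=> x; rewrite topa mulrNN frP mulrDr topD mulrDr.
(* Each of the two pairs in [omega] contributes a positive multiple of the volume. *)
have [r1 r10 e1] := metric_powers x (V := [:: tau1]) hF isT.
have [r2 r20 e2] := metric_powers x (V := [:: tau2]) hF isT.
exists (r1 + r2); first exact: addr_gt0.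
rewrite mulrDl -!topZ -e1 -e2 !big_seq1.
by [].
Qed.

Lemma astheno_Kahler_absurd F : hermitian_metric X F -> ~ astheno_Kahler X F.
Proof.
move=> hF aK.
pose H := fpow F (N - 2).
have gH : good H by apply: good_fpow.
have N1 : (N - 1).+1 = N by rewrite subn1 prednK.
have N2 : (N - 2).+1 = (N - 1)%N by lia.
have tH : has_type X (N - 2) (N - 2) H by apply: fpow_type => //; rewrite leq_subr.
have frH x : fr H x = fr F x ^+ (N - 2) by apply: fr_fpow.
have {}aK x : fr (del X (delbar X H)) x = 0.
  by rewrite -(ext_map0 (Sm x)); apply: (congr1 (ext_map (Sm x)) (aK x)).
clearbody H.
have bH x : bidegree (N - 2) (N - 2) (fr H x) by rewrite frH; apply: metric_bidegree.
pose b := delbar X H.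
have gb : good b by apply: good_delbar tH gH; rewrite // leq_subr.
have frb x : fr b x = bipart (N - 2)%N (N - 1)%N (fr (ext_d H) x).
  by rewrite -N2; exact: (fr_delbar N_gt0 (leq_subr 2 N) (leq_subr 2 N) tH x).
have {}aK x : fr (del X b) x = 0 := aK x.
clearbody b.
have bb x : bidegree (N - 2) (N - 1) (fr b x).
  by rewrite frb; apply: bidegree_bipart.
have tb : has_type X (N - 2) (N - 1) b.
  by apply: has_type_fr => //; rewrite le_m // leq_subr.
have db x : bipart (N - 1)%N (N - 1)%N (fr (ext_d b) x) = 0.
  by have := fr_del N_gt0 (leq_subr 2 N) (leq_subr 1 N) tb x; rewrite aK N2.
pose et := frame (lo eta); pose eb := frame (hi eta).
(* Only the part [b] of [d H] meets [et * omega] in top degree, and it is cancelled by the term of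
   the second summand in which [d] falls on [eb]. *)
pose a := fun x => H x * (et x * omega_form x) - b x * (eb x * et x).
have [sH _] := gH; have [sb _] := gb; have [st _] := good_eta.
have [sbar _] := good_eta_bar; have [so _] := good_omega.
have s1 : smooth_form (fun x => et x * omega_form x) := smooth_formM st so.
have s2 : smooth_form (fun x => eb x * et x) := smooth_formM sbar st.
have s3 : smooth_form (fun x => H x * (et x * omega_form x)) := smooth_formM sH s1.
have s4 : smooth_form (fun x => b x * (eb x * et x)) := smooth_formM sb s2.
have ga : good a.
  apply: goodB; apply: goodM => //; apply: goodM => //; exact: good_omega.
have topa x : top (fr (ext_d a) x) = top (fr H x * (omega * omega)).
  rewrite (fr_ext_dB _ s3 s4) (fr_ext_dM _ sH s1) (fr_ext_dM _ sb s2).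
  rewrite (fr_ext_dM _ st so) (fr_ext_dM _ sbar st).
  rewrite !frM !fr_frame fr_omega fr_d_eta fr_d_eta_conj d_omega mulr0 addr0.
  rewrite (parity_even (bH x)) (parity_dx R (hi eta)).
  have -> : parity (fr b x) = - fr b x.
    rewrite (parity_bidegree (bb x)) (_ : (N - 2 + (N - 1) = (N - 2).*2.+1)%N); last by lia.
    by rewrite exprS -signr_odd odd_double mulr1 scaleN1r.
  have b1 : bidegree 2 1 (dx R (lo eta) * omega).
    exact: (bidegreeM (bidegree_lo R eta) bidegree_omega).
  have b2 : bidegree 1 1 (dx R (hi eta) * dx R (lo eta)).
    exact: (bidegreeM (bidegree_hi R eta) (bidegree_lo R eta)).
  have b3 : bidegree 1 2 (dx R (hi eta) * omega).
    exact: (bidegreeM (bidegree_hi R eta) bidegree_omega).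
  have e1 : top (fr (ext_d H) x * (dx R (lo eta) * omega)) =
      top (fr b x * (dx R (lo eta) * omega)).
    by rewrite frb; apply: top_mul_bipart b1; lia.
  (* The part of type (N-1, N-1) of [d b] is [del b], which the astheno-Kähler equation
     annihilates. *)
  have e2 : top (fr (ext_d b) x * (dx R (hi eta) * dx R (lo eta))) = 0.
    have d1 : (N - 1 + 1 = N)%N by lia.
    by rewrite (top_mul_bipart _ d1 d1 b2) db mul0r top0.
  have e3 : top (fr b x * (dx R (hi eta) * omega)) = 0.
    apply: (top_bidegree0 (bidegreeM (bb x) b3)).
    by rewrite xpair_eqE negb_and; apply/orP; left; lia.
  have e4 : omega * dx R (lo eta) = dx R (lo eta) * omega.
    exact: (@even_comm _ _ 1 _ _ (bidegree_deg bidegree_omega)).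
  rewrite !mulNr -opprD mulrN opprK; set W := omega in e1 e3 e4 *.
  rewrite e4 (mulrDr (fr b x)) !topD topN !topD e1 e2 e3.
  by ring.
apply: (@exact_volume_absurd a (imag2 ^+ (N - 2))) => //.
  rewrite expf_neq0 // oppr_eq0 mulrn_eq0 /= eq_complex /=.
  by rewrite oner_eq0 andbF.
move=> x; rewrite topa frH omega_sq.
(* [omega * omega] is twice the product of two pairs, distinct by [tau12]. *)
have [|r r0 e1] := metric_powers x (V := [:: tau1; tau2]) hF.
  by rewrite /= inE tau12.
exists (r *+ 2); first by rewrite pmulrn_lgt0.
rewrite mulrnAr -topZ -[r *+ 2]mulr_natr mulrAC mulr_natr -topZ -e1.
rewrite !big_cons big_nil mulr1 /=.
by rewrite !topZ mulr2n topD mulrDr mulr2n.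
Qed.

End Obstruction.

End Frame.

(** * Homogeneity of the structure equations *)

Section StructureEquations.
Variables (R : realType) (N : nat) (X : complex_nilmanifold R N).
Variable e : 'I_N -> diff_form R N.*2.
Local Notation C := R[i].
Local Notation m := (N.*2).
Local Notation E := (ext R m).

Hypothesis e_li : forall k, left_invariant_form X (e k).
Hypothesis e_type : forall k, has_type X 1 0 (e k).
Hypothesis e_free : forall x (c : 'rV[C]_N), \sum_k c 0 k *: e k x = 0 -> c = 0.

Definition lohi (p : 'I_N * bool) : 'I_m := if p.2 then hi p.1 else lo p.1.

Definition lohi_weight (u : 'I_N -> nat) i :=
  match lohiP i with inl s => u (sval s) | inr s => u (sval s) end.

Lemma lohi_weightE u p : lohi_weight u (lohi p) = u p.1.
Proof.
rewrite /lohi_weight /lohi; case: p => k [] /=; case: lohiP => -[l el] /=.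
- by have := hi_lo k l; rewrite el eqxx.
- by rewrite (hi_inj el).
- by rewrite (lo_inj el).
- by have := lo_hi k l; rewrite el eqxx.
Qed.

Lemma frame_conj p x : ext_conj (frame e (lohi p) x) = frame e (lohi (p.1, ~~ p.2)) x.
Proof.
by case: p => k []; rewrite /lohi /= frame_lo frame_hi /fconj ?ext_conjK.
Qed.

(** Conjugation flips the boolean of every factor, so one list of products for [d e_k] serves [e_k]
    and its conjugate alike; in the coframe such products are constants. *)
Lemma structure_eq_products (u : 'I_N -> nat) i :
  (forall k, exists L : seq (('I_N * bool) * ('I_N * bool)),
    all (fun p => (u p.1.1 + u p.2.1)%N == u k) L /\
    forall x, ext_d (e k) x =
      \sum_(p <- L) frame e (lohi p.1) x * frame e (lohi p.2) x) ->
  exists c : E,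
    [/\ forall x, fr e (ext_d (frame e i)) x = c,
        supported (lohi_weight u) (lohi_weight u i) c & supported (fun=> 1%N) 2 c].
Proof.
have [p ->] : exists p, i = lohi p.
  by case: (lohiP i) => -[k ->]; [exists (k, false) | exists (k, true)].
case: p => k b /(_ k)[L [wL dL]].
pose sw (p : 'I_N * bool) := (p.1, b (+) p.2).
exists (\sum_(p <- L) dx R (lohi (sw p.1)) * dx R (lohi (sw p.2))); split=> [x||].
- have -> : fr e (ext_d (frame e (lohi (k, b)))) x = ext_map (Sm e x)
      (\sum_(p <- L) frame e (lohi (sw p.1)) x * frame e (lohi (sw p.2)) x).
    rewrite /fr; congr (ext_map _ _); rewrite /sw; case: (b) => /=.
      rewrite /lohi frame_hi ext_d_conj; last by have [] := e_li k.
      rewrite dL ext_conj_sum; apply: eq_bigr => p _.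
      by rewrite ext_conjM !frame_conj.
    by rewrite /lohi frame_lo dL; apply: eq_bigr => -[[i1 b1] [i2 b2]] _.
  rewrite ext_map_sum; apply: eq_bigr => p _; rewrite ext_mapM.
  have fF j : ext_map (Sm e x) (frame e j x) = dx R j := fr_frame e_type e_free j x.
  by rewrite (fF (lohi (sw p.1))) (fF (lohi (sw p.2))).
- rewrite lohi_weightE -[L](all_filterP wL) big_filter.
  apply: supported_sum => p /eqP <-; apply: supportedM.
    by have := @supported_dx R m (lohi_weight u) (lohi (sw p.1)); rewrite lohi_weightE.
  by have := @supported_dx R m (lohi_weight u) (lohi (sw p.2)); rewrite lohi_weightE.
- apply: supported_sum => p _.
  by apply: (@supportedM _ _ (fun=> 1%N) 1 1); apply: (@supported_dx _ _ (fun=> 1%N)).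
Qed.

End StructureEquations.

(** * Application to the Kasuya-Stelzig coframe *)

Local Open Scope nat_scope.

Theorem proposition6p4 (R : realType) (n : nat) (hn : 2 <= n)
    (X : complex_nilmanifold R (6 * n - 4))
    (tau theta eta : nat -> diff_form R (6 * n - 4).*2)
    (hcoframe : coframe10 X
       ([seq tau k | k <- iota 1 (4 * n - 2)]
         ++ [seq theta j | j <- iota 1 (n - 1)]
         ++ [seq eta j | j <- iota 1 (n - 1)]))
    (htau_closed : forall k, 1 <= k <= 3 * n - 2 ->
       forall x, ext_d (tau k) x = 0%R)
    (htau : forall j, 1 <= j <= n - 1 ->
       forall x, ext_d (tau (3 * n - 2 + j)) x =
         fadd (fwedge (tau j) (tau (n + j)))
              (fwedge (tau (n - 1 + j)) (fconj (tau (2 * n - 1 + j)))) x)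
    (htau_last : forall x, ext_d (tau (4 * n - 2)) x =
       fwedge (tau (2 * n)) (fconj (tau n)) x)
    (htheta : forall j, 1 <= j <= n - 1 ->
       forall x, ext_d (theta j) x =
         fadd (fwedge (tau (j + n - 1)) (fconj (tau (j + n - 1))))
              (fwedge (tau (j + 2 * n - 1)) (fconj (tau (j + 2 * n - 1)))) x)
    (heta : forall j, 1 <= j <= n - 1 ->
       forall x, ext_d (eta j) x =
         fadd (fwedge (tau j) (fconj (tau j)))
              (fwedge (tau (j + n)) (fconj (tau (j + n)))) x) :
  ~ (exists F, hermitian_metric X F /\ strongly_Gauduchon X F) /\
  ~ (exists F, hermitian_metric X F /\ astheno_Kahler X F).
Proof.
set N := 6 * n - 4.
set s := (X in coframe10 _ X) in hcoframe.
pose e (k : 'I_N) : diff_form R N.*2 := nth fzero s k.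
have [size_s s_forms s_basis] := hcoframe.
have e_li k : left_invariant_form X (e k) by have [] := s_forms k (ltn_ord k).
have e_type k : has_type X 1 0 (e k) by have [] := s_forms k (ltn_ord k).
(* The uniqueness of coordinates is applied to the zero covector. *)
have e_free x (c : 'rV[R[i]]_N) : (\sum_k c 0 k *: e k x = 0 -> c = 0)%R.
  move=> c0; have [|c1 [_ uc1]] := s_basis x 0%R.
    by rewrite /pq_part big1 // => I _; rewrite ffunE scale0r.
  rewrite -(uc1 c); last exact/esym.
  by apply: uc1; apply/esym/big1 => k _; rewrite mxE scale0r.
(* A two-step grading: the differential of every form of weight 2 is a sum of products of two closed
   [tau] or their conjugates. *)
pose u (k : 'I_N) := if k < 3 * n - 2 then 1 else 2.
have e_tau v (vN : v < N) : v < 4 * n - 2 -> e (Ordinal vN) = tau v.+1.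
  move=> v4; rewrite /e /s /= nth_cat size_map size_iota v4.
  by rewrite (nth_map 0) ?size_iota // nth_iota // add1n.
have e_theta v (vN : v < N) : 4 * n - 2 <= v -> v < 5 * n - 3 ->
    e (Ordinal vN) = theta (v - (4 * n - 2)).+1.
  move=> v4 v5; rewrite /e /s /= nth_cat size_map size_iota ltnNge v4 /=.
  have lt1 : v - (4 * n - 2) < n - 1 by lia.
  rewrite nth_cat size_map size_iota lt1.
  by rewrite (nth_map 0) ?size_iota // nth_iota // add1n.
have e_eta v (vN : v < N) : 5 * n - 3 <= v ->
    e (Ordinal vN) = eta (v - (5 * n - 3)).+1.
  move=> v5; rewrite /e /s /= nth_cat size_map size_iota ifN; last by lia.
  rewrite nth_cat size_map size_iota ifN; last by lia.
  have -> : v - (4 * n - 2) - (n - 1) = v - (5 * n - 3) by lia.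
  have lt1 : v - (5 * n - 3) < n - 1 by lia.
  by rewrite (nth_map 0) ?size_iota // nth_iota // add1n.
have closed a : 1 <= a <= 3 * n - 2 ->
    exists2 k : 'I_N, e k = tau a & u k = 1 /\ k = a.-1 :> nat.
  move=> /andP[a1 a3]; have aN : a.-1 < N by lia.
  exists (Ordinal aN); first by rewrite e_tau ?prednK //; lia.
  by rewrite /u /= ifT //; lia.
have prod2 a b c : 1 <= a <= 3 * n - 2 -> 1 <= b <= 3 * n - 2 ->
    exists2 p : ('I_N * bool) * ('I_N * bool), u p.1.1 + u p.2.1 = 2 &
    forall x, wedge (tau a x) (if c then fconj (tau b) x else tau b x) =
      (frame e (lohi p.1) x * frame e (lohi p.2) x)%R.
  move=> /closed[k1 e1 [u1 _]] /closed[k2 e2 [u2 _]].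
  exists ((k1, false), (k2, c)) => [|x] /=; first by rewrite u1 u2.
  by rewrite /lohi /= frame_lo e1; case: c; rewrite /= ?frame_hi ?frame_lo e2.
have d_products (k : 'I_N) : exists L : seq (('I_N * bool) * ('I_N * bool)),
    all (fun p => u p.1.1 + u p.2.1 == u k) L /\
    forall x, ext_d (e k) x =
      (\sum_(p <- L) frame e (lohi p.1) x * frame e (lohi p.2) x)%R.
  have sum2 a b c a' b' c' : u k = 2 ->
      [&& 1 <= a <= 3 * n - 2, 1 <= b <= 3 * n - 2,
          1 <= a' <= 3 * n - 2 & 1 <= b' <= 3 * n - 2] ->
      (forall x, ext_d (e k) x = (wedge (tau a x) (if c then fconj (tau b) x else tau b x)
        + wedge (tau a' x) (if c' then fconj (tau b') x else tau b' x))%R) ->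
      exists L : seq (('I_N * bool) * ('I_N * bool)),
        all (fun p => u p.1.1 + u p.2.1 == u k) L /\
        forall x, ext_d (e k) x =
          (\sum_(p <- L) frame e (lohi p.1) x * frame e (lohi p.2) x)%R.
    move=> uk /and4P[ha hb ha' hb'] dk.
    have [p up ep] := prod2 a b c ha hb; have [q uq eq] := prod2 a' b' c' ha' hb'.
    exists [:: p; q]; split=> [|x]; first by rewrite /= up uq uk.
    by rewrite dk ep eq big_cons big_seq1.
  case: k sum2 => v vN; rewrite /u /= => sum2.
  have [v3|v3] := ltnP v (3 * n - 2).
    exists [::]; split=> // x; rewrite big_nil e_tau; last by lia.
    by apply: htau_closed; lia.
  rewrite ltnNge v3 /= in sum2.
  have [v4|v4] := ltnP v (4 * n - 3).
    (* Positions count from 0 and [tau] from 1: position [v] holds [tau v.+1], and [v.+1] is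
       [3 * n - 2 + j]. *)
    pose j := v - (3 * n - 3).
    apply: (sum2 j (n + j) false (n - 1 + j) (2 * n - 1 + j) true) => // [|x]; first by lia.
    rewrite e_tau; last by lia.
    have -> : v.+1 = 3 * n - 2 + j by lia.
    by rewrite htau //; lia.
  have [v4'|v4'] := ltnP v (4 * n - 2).
    have [p up ep] := prod2 (2 * n) n true ltac:(lia) ltac:(lia).
    exists [:: p]; split=> [|x]; first by rewrite /= up.
    rewrite big_seq1 -ep e_tau //.
    have -> : v.+1 = 4 * n - 2 by lia.
    exact: htau_last.
  have [v5|v5] := ltnP v (5 * n - 3).
    pose j := (v - (4 * n - 2)).+1.
    apply: (sum2 (j + n - 1) (j + n - 1) true (j + 2 * n - 1) (j + 2 * n - 1) true)
      => // [|x]; first by lia.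
    by rewrite e_theta // htheta //; lia.
  pose j := (v - (5 * n - 3)).+1.
  apply: (sum2 j j true (j + n) (j + n) true) => // [|x]; first by lia.
  by rewrite e_eta // heta //; lia.
have structure_eq i := structure_eq_products e_li e_type e_free i d_products.
have w_gt0 i : 0 < lohi_weight u i.
  by rewrite /lohi_weight /u; case: lohiP => -[k _] /=; case: ifP.
have N_ge2 : 2 <= N by lia.
(* The position of [eta 1], after the [4 * n - 2] forms [tau] and the [n - 1] forms [theta]. *)
have etaN : 5 * n - 3 < N by lia.
have [k1 e1 [_ v1]] : exists2 k : 'I_N, e k = tau 1 & u k = 1 /\ k = 0 :> nat.
  by apply: closed; lia.
have [k2 e2 [_ v2]] : exists2 k : 'I_N, e k = tau (1 + n) & u k = 1 /\ k = n :> nat.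
  by apply: (closed (1 + n)); lia.
have k12 : k1 != k2 by rewrite -val_eqE /= v1 v2; lia.
have d_eta x : (ext_d (e (Ordinal etaN)) x =
    e k1 x * fconj (e k1) x + e k2 x * fconj (e k2) x)%R.
  by rewrite e_eta // subnn heta ?e1 ?e2 //; lia.
have d_tau k x : k \in [:: k1; k2] -> ext_d (e k) x = 0%R.
  rewrite !inE => /orP[] /eqP ->; rewrite ?e1 ?e2; apply: htau_closed; lia.
split=> -[F [hF]].
  exact: (strongly_Gauduchon_absurd e_li e_type e_free w_gt0 structure_eq N_ge2 k12 d_eta hF).
exact: (astheno_Kahler_absurd e_li e_type e_free w_gt0 structure_eq N_ge2 k12 d_eta d_tau hF).
Qed.
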